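(* Let the setting be as fixed in the context (space dimension $1$, $\eta\in(0,\infty)$, $\gamma\in[\tfrac14,\infty)$, nonlinearity $F(w)=R(\eta w-w\,\partial w)$). Let $(e_k)_{k\in\mathbb{Z}}\subseteq\mathbb{H}$, and assume for all $n\in\mathbb{N}$, $k\in\mathbb{Z}$, $v\in H_\gamma$ that $e_0$, $e_n$, $e_{-n}$ are the equivalence classes of the functions $x\mapsto1$, $x\mapsto\sqrt2\cos(2\pi nx)$, $x\mapsto\sqrt2\sin(2\pi nx)$ on $(0,1)$, respectively, that $\lambda_{e_k}=4k^2\pi^2-16k^4\pi^4-\eta$, and that $$r(v)\ge\max\big\{\sqrt\vartheta+\varepsilon\|v\|_H^2,\ \eta\|v\|_H+5\max\{1,\eta^{-\gamma}\}\|v\|_{H_\gamma}^2\big\}.$$ Then $$\sup_{\theta\in\varpi_T}\ \sup_{I\in\mathcal{P}_0(\mathbb{H})}\ \sup_{J\in\mathcal{P}_0(\mathbb{U})}\ \sup_{t\in[0,T]}\ \mathbb{E}\Big[\exp\Big(\tfrac{\varepsilon\|Y^{\theta,I,J}_t\|_H^2}{e^{2(\eta+\varepsilon\vartheta)t}}\Big)\Big]<\infty.$$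
   Context: Setting. $\mathcal{D}=(0,1)$, $\mu_{\mathcal D}$ is Lebesgue measure on $\mathcal D$, $\eta\in(0,\infty)$, $\gamma\in[\tfrac14,\infty)$, $T,\varepsilon\in(0,\infty)$, $\delta\in(0,\tfrac1{18})$, $U=L^2(\mu_{\mathcal D};\mathbb{R})$ with its usual scalar product and norm, $\mathbb{U}$ is an orthonormal basis of $U$, $H\subseteq U$ is a closed subspace of $U$ (with the induced scalar product), $\mathbb{H}\subseteq H$ is a non-empty orthonormal basis of $H$, $\lambda\colon\mathbb{H}\to\mathbb{R}$, $h\mapsto\lambda_h$, satisfies $\sup_{h\in\mathbb{H}}\lambda_h<0$. $(\Omega,\mathcal{F},\mathbb{P},(\mathcal{F}_t)_{t\in[0,T]})$ is a filtered probability space, $(W_t)_{t\in[0,T]}$ is an $\mathrm{Id}_U$-cylindrical $(\mathcal{F}_t)_{t\in[0,T]}$-Wiener process, $Q\in L(U)$ is a non-negative symmetric trace class operator. $A\colon D(A)\subseteq H\to H$ is the linear operator with $D(A)=\{w\in H:\sum_{h\in\mathbb{H}}|\lambda_h\langle h,w\rangle_H|^2<\infty\}$, $Av=\sum_{h\in\mathbb{H}}\lambda_h\langle h,v\rangle_Hh$. $H_s$, $s\in\mathbb{R}$, are the interpolation spaces associated to $-A$; for $s\ge0$: $H_s=\{v\in H:\sum_{h\in\mathbb{H}}|\lambda_h|^{2s}|\langle h,v\rangle_H|^2<\infty\}$, $\|v\|_{H_s}=\|(-A)^sv\|_H$. $r\colon H_\gamma\to[0,\infty)$ and $b\colon\mathcal{D}\times\mathbb{R}\to\mathbb{R}$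 are Borel measurable with $\sup_{x\in\mathcal D,\,y\in\mathbb{R},\,z\in\mathbb{R}\setminus\{y\}}\big(|b(x,y)|+\tfrac{|b(x,y)-b(x,z)|}{|y-z|}\big)<\infty$. $\vartheta=\operatorname{trace}_U(Q)\,\sup_{x\in\mathcal D,y\in\mathbb{R}}|b(x,y)|^2$ and $c\in[2\max\{1,\varepsilon\sqrt\vartheta,\varepsilon\},\infty)$. For $I\subseteq\mathbb{H}$, $J\subseteq\mathbb{U}$: $P_I(v)=\sum_{h\in I}\langle h,v\rangle_Hh$ for $v\in H$, and $\hat P_J(w)=\sum_{u\in J}\langle u,w\rangle_Uu$ for $w\in U$. $R\in L(U)$ is the orthogonal projection of $U$ on $H$. $\partial$ denotes the weak derivative on $W^{1,2}(\mathcal D,\mathbb{R})$. $F\colon H_\gamma\to H$, $B\colon H_\gamma\to\mathrm{HS}(U,H)$ (Hilbert–Schmidt operators) are functions and $\xi\colon\Omega\to H_\gamma$ is $\mathcal{F}_0/\mathcal{B}(H_\gamma)$-measurable such that: $\mathbb{E}[e^{\varepsilon\|\xi\|_H^2}]<\infty$; for every Borel function $v\colon\mathcal D\to\mathbb{R}$ whose equivalence class $[v]$ lies in $H_\gamma$ and every $u\in U$, $B([v])u=R\big([x\mapsto b(x,v(x))]\cdot(\sqrt Qu)\big)$ (pointwise product); and $F(w)=R(\eta w-w\,\partial w)$ for all $w\in H_\gamma\cap W^{1,2}(\mathcal D,\mathbb{R})\cap L^\infty(\mu_{\mathcal D};\mathbb{R})$. Scheme. $Y^{\theta,I,J}\colon[0,T]\times\Omega\to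 P_I(H)$, $\theta\in\varpi_T$, $I\in\mathcal{P}_0(\mathbb{H})$, $J\in\mathcal{P}_0(\mathbb{U})$, are $(\mathcal{F}_t)_{t\in[0,T]}$-adapted stochastic processes with continuous sample paths such that for all $t\in(0,T]$, $\theta,I,J$: $Y^{\theta,I,J}_0=P_I(\xi)$ and, $\mathbb{P}$-almost surely, with $\tau=\llcorner t\lrcorner_\theta$ and $\chi=1$ if $r(Y^{\theta,I,J}_\tau)\le c\,[|\theta|_T]^{-\delta}$, $\chi=0$ otherwise, $$Y^{\theta,I,J}_t=e^{(t-\tau)A}\big(Y^{\theta,I,J}_\tau+\chi\,P_IF(Y^{\theta,I,J}_\tau)(t-\tau)\big)+\frac{\int_\tau^te^{(t-\tau)A}\,\chi\,P_IB(Y^{\theta,I,J}_\tau)\hat P_J\,dW_s}{1+\big\|\int_\tau^tP_IB(Y^{\theta,I,J}_\tau)\hat P_J\,dW_s\big\|_H^2}.$$ Notation. $\mathcal{P}_0(X)$: set of finite subsets of $X$. $\varpi_T$: set of all finite $\theta\subseteq[0,T]$ with $\{0,T\}\subseteq\theta$; $|\theta|_T$: maximal distance between consecutive points of $\theta$; $\llcorner t\lrcorner_\theta=\max([0,t)\cap\theta)$ for $t\in(0,T]$. *)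

(* Defs.v *)
From HB Require Import structures.
From mathcomp Require Import all_boot all_order all_algebra.
From mathcomp Require Import finmap.
From mathcomp Require Import all_classical all_reals all_analysis.
From mathcomp Require Import measurable_realfun ess_sup_inf summability.
From mathcomp Require Import random_variable normal_distribution.

Set Implicit Arguments.
Unset Strict Implicit.
Unset Printing Implicit Defensive.

Import Order.TTheory GRing.Theory Num.Theory.
Import numFieldNormedType.Exports.

Local Open Scope classical_set_scope.
Local Open Scope ring_scope.

(* The library defines the Lebesgue spaces LspaceType as quotients modulo
   almost everywhere equality, but without vector space structure or norm.
   This section supplies the normed module structure; the norm is the
   library's 'N[mu]_p of a representative. *)
Section Lspace_lmod.
Context d (T : measurableType d) (R : realType).
Variables (mu : {measure set T -> \bar R}) (p : \bar R) (p1 : (1 <= p)%E).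
Local Notation Lp := (LspaceType mu p1).
Local Open Scope quotient_scope.

Lemma Lnorm_ae_eq (f g : T -> R) :
  measurable_fun setT f -> measurable_fun setT g ->
  f = g %[ae mu] -> ('N[mu]_p[EFin \o f] = 'N[mu]_p[EFin \o g])%E.
Proof.
move=> mf mg fg; rewrite unlock; case: p p1 => [r r1|_|//]; last first.
  case: ifPn => // _; apply: eq_ess_sup.
  by apply: filterS fg => x /= /(_ I) ->.
have mN (h : T -> R) : measurable_fun setT h ->
    measurable_fun setT (fun x => `|(h x)%:E| `^ r)%E.
  move=> mh; apply: (@measurableT_comp _ _ _ _ _ _ (fun x => x `^ r)%E) => //=.
    exact: (measurable_poweR _).
  by apply/measurable_EFinP; exact: measurableT_comp.
congr (_ `^ _)%E; apply: ge0_ae_eq_integral; try exact: mN; try by [].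
- by move=> x _; exact: poweR_ge0.
- by move=> x _; exact: poweR_ge0.
- exact: (ae_eq_comp (fun y : R => (`|y%:E| `^ r)%E) fg).
Qed.

Lemma Lspace_Lfun (u : Lp) : (u : T -> R) \in Lfun mu p.
Proof.
apply/andP; rewrite !inE/=; split; last exact: Lebesgue_finite.
exact: (@measurable_funPT _ _ _ _ (repr (LebesgueSpace.sort u))).
Qed.

Lemma Lspace_eqP (u v : Lp) : u = v <-> (u : T -> R) = v %[ae mu].
Proof.
split=> [->|]; first exact: ae_eq_refl.
case: u v => [u [[hu]]] [v [[hv]]]/= uv.
have {}uv : u = v.
  by rewrite -[u]reprK -[v]reprK; apply/eqmodP/asboolP.
by case: _ / uv hv => hv; rewrite (Prop_irrelevance hu hv).
Qed.

Lemma Lspace_pi (f : T -> R) : f \in Lfun mu p ->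
  {u : Lp | (u : T -> R) = f %[ae mu]}.
Proof.
move=> fL; have fm : f \in @mfun _ _ T (measurableTypeR R).
  exact: sub_Lfun_mfun fL.
pose g := @mfun_Sub _ _ T (measurableTypeR R) f fm.
pose x : {mfun_ mu, T >-> measurableTypeR R} := \pi g.
have xf : (x : T -> R) = f %[ae mu].
  suff /asboolP : ae_eq_op mu (repr x) g by [].
  by apply/eqmodP; rewrite reprK.
have xfin : finite_norm mu p (x : T -> R).
  rewrite /finite_norm (Lnorm_ae_eq _ _ xf) => [|//|].
  - exact: (set_mem (sub_Lfun_finLfun fL)).
  - exact: (@measurable_funPT _ _ _ _ (repr x)).
  - exact: (set_mem (sub_Lfun_mfun fL)).
by exists (@LebesgueSpace.Pack _ _ _ mu p p1 x
  (LebesgueSpace.Class (isFinLebesgue.Build _ _ _ _ _ p1 x xfin))).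
Qed.

Definition Lspace_of f (fL : f \in Lfun mu p) : Lp := sval (Lspace_pi fL).

Lemma Lspace_ofE f (fL : f \in Lfun mu p) :
  (Lspace_of fL : T -> R) = f %[ae mu].
Proof. exact: (svalP (Lspace_pi fL)). Qed.

HB.instance Definition _ := gen_eqMixin Lp.
HB.instance Definition _ := gen_choiceMixin Lp.

Let aeI (P Q : T -> Prop) : (\forall x \ae mu, P x) ->
  (\forall x \ae mu, Q x) -> \forall x \ae mu, P x /\ Q x.
Proof. by apply: filterS2. Qed.

Let LfunD (u v : Lp) : (u : T -> R) \+ v \in Lfun mu p.
Proof. by apply: (Lfun_addr_closed mu p1).2; exact: Lspace_Lfun. Qed.

Let LfunN (u : Lp) : \- (u : T -> R) \in Lfun mu p.
Proof. by apply: (Lfun_oppr_closed (p := p)); exact: Lspace_Lfun. Qed.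

Let LfunZ (a : R) (u : Lp) : a \*: (u : T -> R) \in Lfun mu p.
Proof.
have [L0 LZ] := Lfun_submod_closed mu p1.
have := LZ a _ _ (Lspace_Lfun u) L0.
by rewrite addr0.
Qed.

Let Lfun0 : cst 0 \in Lfun mu p.
Proof. exact: (Lfun_addr_closed mu p1).1. Qed.

Definition Lspace_add u v : Lp := Lspace_of (LfunD u v).
Definition Lspace_opp u : Lp := Lspace_of (LfunN u).
Definition Lspace_zero : Lp := Lspace_of Lfun0.
Definition Lspace_scale a u : Lp := Lspace_of (LfunZ a u).

Let addE u v : (Lspace_add u v : T -> R) = u \+ v %[ae mu].
Proof. exact: Lspace_ofE. Qed.
Let oppE u : (Lspace_opp u : T -> R) = \- (u : T -> R) %[ae mu].
Proof. exact: Lspace_ofE. Qed.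
Let zeroE : (Lspace_zero : T -> R) = cst 0 %[ae mu].
Proof. exact: Lspace_ofE. Qed.
Let scaleE a u : (Lspace_scale a u : T -> R) = a \*: (u : T -> R) %[ae mu].
Proof. exact: Lspace_ofE. Qed.

Let addA : associative Lspace_add.
Proof.
move=> u v w; apply/Lspace_eqP.
have := aeI (addE u (Lspace_add v w)) (addE v w).
have := aeI (addE (Lspace_add u v) w) (addE u v).
apply: filterS2 => x /= [/(_ I) -> /(_ I) ->] [/(_ I) -> /(_ I) ->] _.
by rewrite addrA.
Qed.

Let addC : commutative Lspace_add.
Proof.
move=> u v; apply/Lspace_eqP; have := addE u v; have := addE v u.
by apply: filterS2 => x /= /(_ I) -> /(_ I) -> _; rewrite addrC.
Qed.

Let add0 : left_id Lspace_zero Lspace_add.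
Proof.
move=> u; apply/Lspace_eqP; have := zeroE; have := addE Lspace_zero u.
by apply: filterS2 => x /= /(_ I) -> /(_ I) -> _; rewrite add0r.
Qed.

Let addN : left_inverse Lspace_zero Lspace_opp Lspace_add.
Proof.
move=> u; apply/Lspace_eqP.
have := zeroE; have := oppE u; have := addE (Lspace_opp u) u.
by apply: filterS3 => x /= /(_ I) -> /(_ I) -> /(_ I) -> _; rewrite addNr.
Qed.

HB.instance Definition _ := GRing.isZmodule.Build Lp addA addC add0 addN.

Let scaleA a b u : Lspace_scale a (Lspace_scale b u) = Lspace_scale (a * b) u.
Proof.
apply/Lspace_eqP; have := scaleE (a * b) u; have := scaleE b u.
have := scaleE a (Lspace_scale b u).
by apply: filterS3 => x /= /(_ I) -> /(_ I) -> /(_ I) -> _; rewrite scalerA.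
Qed.

Let scale1 : left_id 1 Lspace_scale.
Proof.
move=> u; apply/Lspace_eqP; have := scaleE 1 u.
by apply: filterS => x /= /(_ I) -> _; rewrite scale1r.
Qed.

Let scaleDr : right_distributive Lspace_scale +%R.
Proof.
move=> a u v; apply/Lspace_eqP; rewrite -[_ + _]/(Lspace_add _ _).
have := addE (Lspace_scale a u) (Lspace_scale a v).
have := aeI (scaleE a (Lspace_add u v)) (addE u v).
have := aeI (scaleE a u) (scaleE a v).
apply: filterS3 => x /= [/(_ I) e1 /(_ I) e2] [/(_ I) -> /(_ I) ->] /(_ I) -> _.
by rewrite e1 e2 scalerDr.
Qed.

Let scaleDl u : {morph Lspace_scale^~ u : a b / a + b}.
Proof.
move=> a b; apply/Lspace_eqP.
have := addE (Lspace_scale a u) (Lspace_scale b u).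
have := aeI (scaleE a u) (scaleE b u); have := scaleE (a + b) u.
apply: filterS3 => x /= /(_ I) -> [/(_ I) e1 /(_ I) e2] /(_ I) -> _.
by rewrite e1 e2 /= -scalerDl.
Qed.

HB.instance Definition _ :=
  GRing.Zmodule_isLmodule.Build R Lp scaleA scale1 scaleDr scaleDl.

Lemma Lspace_addE (u v : Lp) : 
  ((u + v : Lp) : T -> R) = (u : T -> R) \+ v %[ae mu].
Proof. exact: addE. Qed.

Lemma Lspace_scaleE a (u : Lp) : 
  ((a *: u : Lp) : T -> R) = a \*: (u : T -> R) %[ae mu].
Proof. exact: scaleE. Qed.

Lemma Lspace_0E : ((0 : Lp) : T -> R) = cst 0 %[ae mu].
Proof. exact: zeroE. Qed.

Definition Lspace_norm (u : Lp) : R := fine ('N[mu]_p[EFin \o (u : T -> R)])%E.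

Let normE (u : Lp) :
  (Lspace_norm u)%:E = ('N[mu]_p[EFin \o (u : T -> R)])%E.
Proof. by have := finite_norm_fine (Lfun_Sub p1 (Lspace_Lfun u)). Qed.

Let Lmeas (f : T -> R) : f \in Lfun mu p -> measurable_fun setT f.
Proof. by move=> /sub_Lfun_mfun/set_mem. Qed.

Let normD u v : Lspace_norm (u + v) <= Lspace_norm u + Lspace_norm v.
Proof.
rewrite -lee_fin EFinD !normE.
rewrite (Lnorm_ae_eq (Lmeas (Lspace_Lfun _)) (Lmeas (LfunD u v)) (addE u v)).
by apply: eminkowski => //; apply: Lmeas; exact: Lspace_Lfun.
Qed.

Let normZ a u : Lspace_norm (a *: u) = `|a| * Lspace_norm u.
Proof.
apply/EFin_inj; rewrite EFinM !normE.
rewrite (Lnorm_ae_eq (Lmeas (Lspace_Lfun _)) (Lmeas (LfunZ a u)) (scaleE a u)).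
exact: (LnormZ (Lfun_Sub p1 (Lspace_Lfun u)) a).
Qed.

Let norm_eq0 u : Lspace_norm u = 0 -> u = 0.
Proof.
move=> /(@fine_Lnormr_eq0 _ _ _ _ _ p1 (Lfun_Sub p1 (Lspace_Lfun u))) u0.
apply/Lspace_eqP; apply: ae_eq_trans u0 _; apply: ae_eq_sym.
exact: zeroE.
Qed.

HB.instance Definition _ :=
  Lmodule_isNormed.Build R Lp normD normZ norm_eq0.

Lemma Lspace_normE (u : Lp) : `|u|%:E = ('N[mu]_p[EFin \o (u : T -> R)])%E.
Proof. exact: normE. Qed.

End Lspace_lmod.

Lemma measurable_unit_itv (R : realType) :
  measurable (`]0, 1[%classic : set R).
Proof. exact: measurable_itv. Qed.

(* Functions on (0, 1) are represented by functions on R, considered modulo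
   equality almost everywhere for the restriction mu01 of Lebesgue measure. *)
Definition mu01 (R : realType) : {measure set (measurableTypeR R) -> \bar R} :=
  mrestr (@lebesgue_measure R) (@measurable_unit_itv R).

Definition L2 (R : realType) := LspaceType2 (mu01 R).

Section L2_space.
Variable R : realType.
Local Notation U := (L2 R).
Implicit Types (u v w dw : U) (B H S : set U) (I J : {fset U}).

(* The class of f, or 0 if f has no square integrable representative. *)
Definition L2_class (f : R -> R) : U :=
  xget 0 [set w : U | (w : R -> R) = f %[ae (mu01 R)]].

Definition inner u v : R := \int[mu01 R]_x (u x * v x).

Definition lin_span B : set U :=
  [set v | exists J (a : U -> R),
     [set` J] `<=` B /\ v = \sum_(u <- J) a u *: u].

Definition orthonormal B :=
  forall u v, B u -> B v -> inner u v = (u == v)%:R.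

Definition closed_subspace H :=
  [/\ H 0, forall (a : R) u v, H u -> H v -> H (a *: u + v) & closed H].

Definition orthonormal_basis B H :=
  [/\ B `<=` H, orthonormal B & H `<=` closure (lin_span B)].

Definition bounded_operator (S : U -> U) := linear S /\ continuous S.

Definition nonneg_symmetric (S : U -> U) :=
  [/\ bounded_operator S, forall u v, inner u (S v) = inner (S u) v
    & forall u, 0 <= inner u (S u)].

(* For a nonnegative operator |Q| = Q, so that being trace class means that
   the trace is finite; its value does not depend on the basis B. *)
Definition etrace B (Q : U -> U) : \bar R :=
  (\esum_(u in B) (inner u (Q u))%:E)%E.

Definition nonneg_trace_class B (Q : U -> U) :=
  nonneg_symmetric Q /\ (etrace B Q < +oo)%E.

Definition is_sqrt_operator (Q S : U -> U) :=
  nonneg_symmetric S /\ forall u, S (S u) = Q u.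

Definition hilbert_schmidt B H (S : U -> U) :=
  [/\ bounded_operator S, forall u, H (S u)
    & (\esum_(u in B) (`|S u| ^+ 2)%:E < +oo)%E].

Definition orthogonal_projection H (S : U -> U) :=
  forall v, H (S v) /\ forall w, H w -> inner (v - S v) w = 0.

(* For a finite set I of orthonormal vectors *)
Definition fproj I v : U := \sum_(h <- I) inner h v *: h.

(* phi(A) for the diagonal operator A with eigenvectors h and eigenvalues
   lam h, h in B; the sum over B is the limit of the net of partial sums over
   finite subsets. *)
Definition fcalc B (lam : U -> R) (phi : R -> R) v : U :=
  lim ((fun J => \sum_(h <- J | h \in B) (phi (lam h) * inner h v) *: h)
         @ totally).

(* e^(tA) *)
Definition semigroup B lam (t : R) := fcalc B lam (fun l => expR (t * l)).

(* For s >= 0, the interpolation space H_s and its norm |(-A)^s v| *)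
Definition Hs B H (lam : U -> R) (s : R) : set U :=
  [set v | H v /\
     (\esum_(h in B) (`|lam h| `^ (2 * s) * `|inner h v| ^+ 2)%:E < +oo)%E].

Definition Hs_norm B lam (s : R) v : R :=
  `|fcalc B lam (fun l => (- l) `^ s) v|.

Definition Hs_open B H lam (s : R) : set (set U) :=
  [set O | O `<=` Hs B H lam s /\ forall v, O v ->
     exists2 e : R, 0 < e & forall w, Hs B H lam s w ->
       Hs_norm B lam s (w - v) < e -> O w].

Definition Hs_borel B H lam s : set (set U) :=
  <<s Hs B H lam s, Hs_open B H lam s >>.

Definition test_function (phi : R -> R) :=
  (forall n x, derivable (derive1n n phi) x 1) /\
  exists a b : R, [/\ 0 < a, b < 1 &
    forall x, x \notin `[a, b] -> phi x = 0].

(* Membership of w in W^(1,2)(0, 1) means that such a dw exists in L2. *)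
Definition weak_derivative w dw :=
  forall phi, test_function phi ->
    \int[mu01 R]_x (w x * derive1 phi x) = - \int[mu01 R]_x (dw x * phi x).

Definition ess_bounded w := finite_norm (mu01 R) +oo w.

End L2_space.

Section partitions.
Variable R : realType.
Implicit Types (theta : {fset R}) (T t : R).

Definition partition_of T theta :=
  [/\ forall s, s \in theta -> 0 <= s <= T, 0 \in theta & T \in theta].

(* |theta|_T : the largest gap b - a with no point of theta in between *)
Definition mesh theta : R :=
  \big[Num.max/0]_(a <- theta)
    \big[Num.max/0]_(b <- theta |
        (a < b) && all (fun s => ~~ (a < s < b)) theta) (b - a).

(* max ([0, t) `&` theta) *)
Definition prev_point theta t : R :=
  \big[Num.max/0]_(s <- theta | s < t) s.

End partitions.

Section stochastics.
Context d (Omega : measurableType d) (R : realType) (P : probability Omega R).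
Local Notation U := (L2 R).

Definition filtration (T : R) (F : R -> set (set Omega)) :=
  [/\ forall t, 0 <= t <= T -> sigma_algebra setT (F t),
      forall t, 0 <= t <= T -> F t `<=` measurable
    & forall s t, 0 <= s -> s <= t -> t <= T -> F s `<=` F t].

(* G-Borel measurability, tested on the generating open sets *)
Definition borel_measurable_wrt (G : set (set Omega)) (E : topologicalType)
    (X : Omega -> E) := forall O : set E, open O -> G (X @^-1` O).

(* W t u is the value in the direction u of the cylindrical process at time t.
   The last clause says that the increments along orthonormal vectors are
   independent and centred normal of variance t - s, and jointly independent
   of F s (normal_prob takes the standard deviation). *)
Record cylindrical_wiener (T : R) (F : R -> set (set Omega))
    (W : R -> U -> Omega -> R) : Prop := CylindricalWiener {
  wiener0 : forall u, {ae P, forall om, W 0 u om = 0};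
  wiener_linear : forall t (a : R) u v, 0 <= t <= T ->
    {ae P, forall om, W t (a *: u + v) om = a * W t u om + W t v om};
  wiener_continuous : forall u,
    {ae P, forall om, {within `[0, T], continuous (fun t => W t u om)}};
  wiener_adapted : forall t u, 0 <= t <= T ->
    borel_measurable_wrt (F t) (W t u);
  wiener_increments : forall s t (J : {fset U}) (E : set Omega)
      (A : U -> set R),
    0 <= s -> s < t -> t <= T -> orthonormal [set` J] -> F s E ->
    (forall u, measurable (A u)) ->
    P (E `&` [set om | forall u, u \in J -> A u (W t u om - W s u om)]) =
    (P E * \prod_(u <- J) normal_prob 0 (Num.sqrt (t - s)) (A u))%E
}.

(* The stochastic integral of Phi \o P^_J over (s, t] for an F s-measurable
   random operator Phi that is constant in time and a finite orthonormal J: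
   since P^_J dW is the sum over u in J of u d(W u), the integrand is an
   elementary process, whose integral is this sum by definition. *)
Definition elementary_integral (W : R -> U -> Omega -> R) (J : {fset U})
    (Phi : Omega -> U -> U) (s t : R) (om : Omega) : U :=
  \sum_(u <- J) (W t u om - W s u om) *: Phi om u.

End stochastics.

(* Main.v *)
Require Import Defs.
From HB Require Import structures.
From mathcomp Require Import all_boot all_order all_algebra.
From mathcomp Require Import finmap.
From mathcomp Require Import all_classical all_reals all_analysis.
From mathcomp Require Import measurable_realfun ess_sup_inf summability.
From mathcomp Require Import random_variable normal_distribution.
From mathcomp Require Import ring lra.

Set Implicit Arguments.
Unset Strict Implicit.
Unset Printing Implicit Defensive.

Import Order.TTheory GRing.Theory Num.Theory.
Import numFieldNormedType.Exports.

Local Open Scope classical_set_scope.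
Local Open Scope ring_scope.

(* Write h for the time from the previous grid point tau to t, v = Y_tau + h F
   for the drift part of the step, Z for the Gaussian increment and zeta =
   Z / (1 + |Z|^2) for the tamed one.  Taming gives 2 <v, zeta> + |zeta|^2 <=
   2 <v, Z> + (1 + |v|) |Z|^2, whose exponential has an explicit conditional
   expectation, Z being Gaussian with covariance of trace at most h vartheta.
   The truncation bounds |Y_tau|^2 and |F| by multiples of h^(-delta), so that
   all error terms are O(h); the linear term vartheta |v| h is absorbed by the
   contraction e^(-2 k h) of the semigroup, and <w, w w'> = 0 leaves only
   eta |Y_tau|^2 of the drift.  When the Gaussian formula is not applicable,
   the cruder bound |v + zeta|^2 <= |v|^2 + |v| + 1/4 is enough.  Hence one step
   multiplies the weighted exponential moment by at most e^(C h), with C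
   independent of the grid and of the projections.

   As the trigonometric system is complete, the basis HH consists of the e_k
   only, and everything the scheme sees is a trigonometric polynomial: there
   the drift is explicit and controlled by the H_gamma norm for gamma >= 1/4,
   because -lambda_(e_k) grows like k^4. *)

(** * Gaussian integrals and freezing *)

(** The obstacle is that the exponential moment of a |Z|^2 is controlled only when 2 a h vartheta <
    1, whereas the coefficient produced by taming, a = rt (1 + |v|), is random and grows with Y_tau.
    The event 4 a h vartheta <= 1 belongs to the past up to tau, so the step can be split along it
    before the noise is integrated out. On its complement a <= a (4 a h vartheta)^2, which is cubic
    in 1 + |v|, and the truncation turns h^2 (1 + |v|)^3 into O(h). The truncation enters through a
    level q of order h^(-delta): |Y_tau|^2 = O(q), |F| = O(q), and h q^2 stays bounded. The rate 2
    (eta + eps vartheta) of the weight is the cost of a step: 2 eta h comes from the drift and 2 eps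
    vartheta h from the second-order term of the Gaussian formula. Drift and noise share the
    truncation factor chi, and the taming denominator contains no semigroup. So a step is e^(hA)
    applied to Y_tau + chi (h F + zeta), and the semigroup acts only as a contraction. *)

Section gaussian.
Variable R : realType.

(** The Radon-Nikodym derivative of [normal_prob] agrees almost everywhere with [normal_pdf], since
    the two have equal integrals over all measurable sets. *)
Lemma ge0_integral_normal_prob (m s : R) (f : R -> \bar R) :
  measurable_fun setT f -> (forall x, 0 <= f x)%E ->
  (\int[normal_prob m s]_x f x =
   \int[lebesgue_measure]_x (f x * (normal_pdf m s x)%:E))%E.
Proof.
move=> mf f0; have dom := normal_prob_dominates m s.
rewrite -(Radon_Nikodym_SigmaFinite.change_of_variables dom f0 measurableT mf).
have mg := measurable_int _ (Radon_Nikodym_SigmaFinite.f_integrable dom).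
have mn : measurable_fun setT (fun x => (normal_pdf m s x)%:E).
  by apply/measurable_EFinP; exact: measurable_normal_pdf.
apply: ae_eq_integral => //; [exact: emeasurable_funM..|].
apply: ae_eqe_mul2l; apply: integral_ae_eq => //.
  exact: Radon_Nikodym_SigmaFinite.f_integrable.
by move=> E _ mE; rewrite -Radon_Nikodym_SigmaFinite.f_integral.
Qed.

(* Completing the square. *)
Lemma integral_normal_expR_quadratic (h a b : R) : 0 < h -> 2 * a * h < 1 ->
  (\int[normal_prob 0 (Num.sqrt h)]_x (expR (a * x ^+ 2 + b * x))%:E =
   ((Num.sqrt (1 - 2 * a * h))^-1 *
      expR (b ^+ 2 * h / (2 * (1 - 2 * a * h))))%:E)%E.
Proof.
move=> h0 ah; set D := 1 - 2 * a * h; have D0 : 0 < D by rewrite subr_gt0.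
rewrite ge0_integral_normal_prob; last 2 first.
- apply/measurable_EFinP/measurableT_comp => //; apply: measurable_funD.
    by apply: measurable_funM => //; exact: measurable_funX.
  exact: measurable_funM.
- by move=> x; rewrite lee_fin expR_ge0.
have hD : 0 < h / D by rewrite divr_gt0.
set c := _ * expR _.
(* The integrand is [c] times the normal density of mean b h / D and variance h / D. *)
transitivity (\int[lebesgue_measure]_x
    (c%:E * (normal_pdf (b * h / D) (Num.sqrt (h / D)) x)%:E))%E.
  apply: eq_integral => x _; rewrite -!EFinM; congr EFin.
  rewrite !normal_pdfE ?gt_eqF ?sqrtr_gt0//.
  rewrite mulrCA /c -mulrA [in RHS]mulrCA mulrA.
  rewrite /normal_peak /normal_fun !sqr_sqrtr ?ltW//.
  have -> : h / D * pi *+ 2 = (h * pi *+ 2) / D by rewrite mulrAC mulrnAl.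
  rewrite sqrtrM; last by rewrite mulrn_wge0// mulr_ge0 ?pi_ge0 ?ltW.
  rewrite sqrtrV ?ltW// invfM invrK.
  have sD : Num.sqrt D != 0 by rewrite gt_eqF// sqrtr_gt0.
  rewrite mulrA [_ * Num.sqrt D]mulrC [in RHS]mulrA.
  rewrite !mulrA; rewrite -[RHS]mulrA -expRD -[LHS]mulrA -expRD.
  congr (_ * expR _).
    by rewrite mulrAC mulfV// mul1r.
  have D0' : D != 0 by rewrite gt_eqF.
  have h0' : h != 0 by rewrite gt_eqF.
  have -> : a = (1 - D) / (2 * h) by rewrite /D; field.
  rewrite subr0; clearbody D; field.
  by rewrite h0' D0'.
rewrite ge0_integralZl//.
- by rewrite integral_normal_pdf mule1.
- by apply/measurable_EFinP; exact: measurable_normal_pdf.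
- by move=> x _; rewrite lee_fin normal_pdf_ge0.
- by rewrite lee_fin mulr_ge0 ?invr_ge0 ?sqrtr_ge0 ?expR_ge0.
Qed.

End gaussian.

Section freezing.
Context d (Omega : measurableType d) (R : realType) (P : probability Omega R).

(* P (X in A | G) = nu A independently of G allows to integrate out X. *)
Lemma ge0_integral_independent (G : set (set Omega)) (X : Omega -> R)
    (nu : probability (measurableTypeR R) R)
    (f : g_sigma_algebraType G * measurableTypeR R -> \bar R) :
  sigma_algebra setT G -> G `<=` measurable ->
  measurable_fun setT X ->
  (forall E A, G E -> measurable A ->
     P (E `&` X @^-1` A) = P E * nu A)%E ->
  measurable_fun setT f -> (forall z, 0 <= f z)%E ->
  (\int[P]_om f (om, X om) = \int[P]_om \int[nu]_x f (om, x))%E.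
Proof.
move=> sG Gm mX ind mf f0.
have mGE : measurable = G :> set (set (g_sigma_algebraType G)).
  exact: measurable_g_measurableTypeE.
(* The identity into [Omega] with the smaller sigma-algebra G has P restricted to G as its
   distribution; this brings in the product measure to which Tonelli applies. *)
have mi : measurable_fun setT (id : Omega -> g_sigma_algebraType G).
  by move=> _ A; rewrite mGE setTI => /Gm.
pose iX : Omega -> g_sigma_algebraType G * measurableTypeR R := fun om => (om, X om).
have miX : measurable_fun setT iX by apply/measurable_fun_pairP; split.
pose i' : {mfun Omega >-> g_sigma_algebraType G} :=
  HB.pack (id : Omega -> g_sigma_algebraType G) (isMeasurableFun.Build _ _ _ _ _ mi).
pose iX' : {mfun Omega >-> (g_sigma_algebraType G * measurableTypeR R)%type} :=
  HB.pack iX (isMeasurableFun.Build _ _ _ _ _ miX).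
have mfF : measurable_fun setT (fun om : g_sigma_algebraType G =>
    \int[nu]_x f (om, x))%E.
  exact: (measurable_fun_fubini_tonelli_F f mf f0).
transitivity (\int[distribution P i']_om \int[nu]_x f (om, x))%E; last first.
  rewrite (ge0_integral_distribution i' mfF)//.
  by move=> y; exact: integral_ge0.
rewrite -[RHS](@fubini_tonelli1 _ _ _ _ _ (distribution P i') nu f mf f0).
(* By [ind], the law of (om, X om) agrees with the product measure on rectangles, hence
   everywhere. *)
rewrite (eq_measure_integral (distribution P iX')); last first.
  move=> A mA _; apply: product_measure_unique => //= E B mE mB.
  by rewrite /distribution /pushforward /= -ind//; rewrite -mGE.
by rewrite ge0_integral_distribution.
Qed.

End freezing.

Lemma measurable_fun_invr d (T : measurableType d) (R : realType) (f : T -> R) :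
  (forall x, 0 < f x) -> measurable_fun setT f ->
  measurable_fun setT (fun x => (f x)^-1).
Proof.
move=> f0 mf; apply: (eq_measurable_fun (fun x => expR (- ln (f x)))).
  by move=> x _; rewrite expRN lnK// posrE.
apply: measurableT_comp => //; apply: measurable_funN.
by apply: measurableT_comp => //; exact: measurable_ln.
Qed.

Lemma measurable_fun_sqrt d (T : measurableType d) (R : realType) (f : T -> R) :
  measurable_fun setT f -> measurable_fun setT (fun x => Num.sqrt (f x)).
Proof.
move=> mf; have ms : measurable_fun setT (Num.sqrt : R -> R).
  by apply: continuous_measurable_fun; exact: sqrt_continuous.
exact: measurableT_comp ms mf.
Qed.

Lemma measurable_fun_g_sigma_sub d d' (Omega : measurableType d)
    (T : measurableType d') (G : set (set Omega)) (f : Omega -> T) :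
  sigma_algebra setT G -> G `<=` measurable ->
  measurable_fun setT (f : g_sigma_algebraType G -> T) ->
  measurable_fun setT f.
Proof.
move=> sG Gm mf _ A mA; apply: Gm.
by have := mf measurableT A mA; rewrite (measurable_g_measurableTypeE sG).
Qed.

Lemma measurable_fun_g_sigma d d' (Omega : measurableType d)
    (T : measurableType d') (G G' : set (set Omega)) (f : Omega -> T) :
  sigma_algebra setT G -> G `<=` G' ->
  measurable_fun setT (f : g_sigma_algebraType G -> T) ->
  measurable_fun setT (f : g_sigma_algebraType G' -> T).
Proof.
move=> sG GG' mf _ A mA; apply: sub_sigma_algebra; apply: GG'.
have := mf measurableT A mA; rewrite setTI.
by rewrite (measurable_g_measurableTypeE sG).
Qed.

Lemma measurable_fun_sum d (T : measurableType d) (R : realType) (I : Type)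
    (s : seq I) (f : I -> T -> R) :
  (forall i, measurable_fun setT (f i)) ->
  measurable_fun setT (fun x => \sum_(i <- s) f i x).
Proof.
move=> mf; elim: s => [|i s IH].
  by under eq_fun do rewrite big_nil; exact: measurable_cst.
by under eq_fun do rewrite big_cons; exact: measurable_funD.
Qed.

(** Induction on the sequence: the new cross term 2 S x y is at most A y^2 + B x^2, because its
    square is at most 4 A B (x y)^2 by the induction hypothesis. *)
Lemma sum_mul_cauchy_schwarz (R : realType) (I : Type) (s : seq I)
    (x y : I -> R) :
  (\sum_(i <- s) x i * y i) ^+ 2 <=
  (\sum_(i <- s) x i ^+ 2) * (\sum_(i <- s) y i ^+ 2).
Proof.
elim: s => [|i s]; first by rewrite !big_nil expr0n /= mul0r.
rewrite !big_cons.
set S := \sum_(j <- s) _; set A := \sum_(j <- s) _; set B := \sum_(j <- s) _ => IH.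
have A0 : 0 <= A by apply: sumr_ge0 => j _; exact: sqr_ge0.
have B0 : 0 <= B by apply: sumr_ge0 => j _; exact: sqr_ge0.
suff : 2 * (S * (x i * y i)) <= A * y i ^+ 2 + B * x i ^+ 2 by nra.
apply: le_trans (ler_norm _) _; rewrite -ler_sqr ?nnegrE//; last first.
  by rewrite addr_ge0// mulr_ge0// sqr_ge0.
rewrite real_normK ?num_real//.
apply: (@le_trans _ _ (4 * (A * B) * (x i * y i) ^+ 2)).
  by have := sqr_ge0 (x i * y i); nra.
by have := sqr_ge0 (A * y i ^+ 2 - B * x i ^+ 2); nra.
Qed.

(** * Exponential moments of Gaussian vectors, conditionally on the past *)

Section gaussian_vector.
Context d (Omega : measurableType d) (R : realType) (P : probability Omega R).
Variables (U V : choiceType).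
Implicit Types (G : set (set Omega)) (s : seq U).

(** One clause for three facts: the variables are centred normal of variance h, independent of each
    other, and jointly independent of G. It has the shape of the increment property of the
    cylindrical Wiener process. *)
Definition independent_normal G (h : R) (X : U -> Omega -> R) s :=
  forall (E : set Omega) (A : U -> set R), G E -> (forall u, measurable (A u)) ->
  P (E `&` [set om | forall u, u \in s -> A u (X u om)]) =
  (P E * \prod_(u <- s) normal_prob 0 (Num.sqrt h) (A u))%E.

Lemma measurable_forall_seq (X : U -> Omega -> R) s (A : U -> set R) :
  (forall u, u \in s -> measurable_fun setT (X u)) ->
  (forall u, measurable (A u)) ->
  measurable [set om | forall u, u \in s -> A u (X u om)].
Proof.
move=> mX mA; elim: s mX => [_|u s IH mX].
  by rewrite [X in measurable X](_ : _ = setT)// -subTset => ? _ ?.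
rewrite [X in measurable X](_ : _ =
    (X u @^-1` A u) `&` [set om | forall u, u \in s -> A u (X u om)]).
  apply: measurableI; last by apply: IH => v vs; apply: mX; rewrite inE vs orbT.
  by rewrite -[X in measurable X]setTI; apply: mX => //; rewrite mem_head.
apply/seteqP; split => [om /= h|om /= [hu h] v].
  by split=> [|v vs]; apply: h; rewrite ?mem_head// inE vs orbT.
by rewrite inE => /predU1P[->//|]; exact: h.
Qed.

(** A pi-system generating the join of G and the sigma-algebra of X. *)
Definition cylinders G (X : Omega -> R) : set (set Omega) :=
  [set C | exists E A, [/\ G E, measurable A & C = E `&` X @^-1` A]].

Lemma setI_closed_cylinders G X : setI_closed G -> setI_closed (cylinders G X).
Proof.
move=> GI _ _ [E [A [GE mA ->]]] [E' [A' [GE' mA' ->]]].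
exists (E `&` E'), (A `&` A'); split; [exact: GI|exact: measurableI|].
by rewrite preimage_setI setIACA.
Qed.

Lemma cylinders_measurable G X : G `<=` measurable -> measurable_fun setT X ->
  cylinders G X `<=` measurable.
Proof.
move=> Gm mX _ [E [A [GE mA ->]]]; apply: measurableI; first exact: Gm.
by rewrite -[X in measurable X]setTI; exact: mX.
Qed.

Lemma independent_normal_head G h X u s : uniq (u :: s) ->
  independent_normal G h X (u :: s) ->
  forall E A, G E -> measurable A ->
  (P (E `&` X u @^-1` A) = P E * normal_prob 0 (Num.sqrt h) A)%E.
Proof.
move=> /= /andP[us _] ind B C GB mC; pose A v := if v == u then C else setT.
have mA v : measurable (A v) by rewrite /A; case: ifP.
rewrite (_ : _ @^-1` C = [set om | forall v, v \in u :: s -> A v (X v om)]).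
  rewrite ind// big_cons {1}/A eqxx big1_seq ?mule1// => v /= vs.
  rewrite /A; case: eqP => [vu|_]; first by rewrite -vu vs in us.
  exact: (probability_setT (normal_prob _ _)).
apply/seteqP; split => [om /= uC v|om /= h'].
  by rewrite /A; case: eqP => [->|].
by have := h' u (mem_head _ _); rewrite /A eqxx.
Qed.

(** Revealing [X u] preserves the independence of the remaining variables. For fixed sets [A v] both
    sides are finite measures in E; they agree on cylinders by the hypothesis for [u :: s], and
    cylinders are stable under intersection. *)
Lemma independent_normal_adjoin G h X u s : uniq (u :: s) ->
  sigma_algebra setT G -> G `<=` measurable ->
  (forall v, v \in u :: s -> measurable_fun setT (X v)) ->
  independent_normal G h X (u :: s) ->
  independent_normal <<s cylinders G (X u) >> h X s.
Proof.
move=> us sG Gm mX ind E A GE mA; have /andP[us' _] := us.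
have mXu : measurable_fun setT (X u) by apply: mX; rewrite mem_head.
have GI : setI_closed G.
  move=> B C GB GC; rewrite -(measurable_g_measurableTypeE sG).
  by apply: measurableI; rewrite (measurable_g_measurableTypeE sG).
have GT : G setT.
  by rewrite -(measurable_g_measurableTypeE sG).
set D := [set om | forall v, v \in s -> A v (X v om)].
have mD : measurable D.
  by apply: measurable_forall_seq => // v vs; apply: mX; rewrite inE vs orbT.
set p := (\prod_(v <- s) normal_prob 0 (Num.sqrt h) (A v))%E.
have p_ge0 : (0 <= p)%E by apply: prode_ge0 => v _; exact: measure_ge0.
have p_fin : p \is a fin_num.
  apply: prode_fin_num => v _; apply: (fin_num_measure (normal_prob _ _)); exact: mA.
have p0 : 0 <= fine p by exact: fine_ge0.
have -> : p = (fine p)%:E by rewrite fineK.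
have cylE B C : G B -> measurable C ->
    (P (B `&` X u @^-1` C `&` D) =
     P B * (normal_prob 0 (Num.sqrt h) C * p))%E.
  move=> GB mC; pose A' v := if v == u then C else A v.
  have mA' v : measurable (A' v) by rewrite /A'; case: ifP.
  rewrite -setIA (_ : _ `&` D = [set om | forall v, v \in u :: s -> A' v (X v om)]).
    rewrite ind// big_cons {1}/A' eqxx; congr (_ * (_ * _))%E.
    apply: eq_big_seq => v vs; rewrite /A'; case: eqP => // vu.
    by rewrite -vu vs in us'.
  apply/seteqP; split => [om [/= uC sA] v|om /= h'].
    rewrite inE /A'; case: eqP => [-> //|_] /= vs; exact: sA.
  split => [|v vs]; first by have := h' u (mem_head _ _); rewrite /A' eqxx.
  have := h' v; rewrite inE vs orbT /A' => /(_ isT).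
  by case: eqP => // vu; rewrite -vu vs in us'.
have cylE0 := independent_normal_head us ind.
rewrite muleC.
apply: (@g_sigma_algebra_measure_unique _ _ _ (cylinders G (X u)) _
  (fun=> setT) _ _ (mrestr P mD) (mscale (NngNum p0) P)) => //.
- exact: cylinders_measurable.
- by move=> _; exists setT, setT; split => //; rewrite preimage_setT setTI.
- by rewrite bigcup_const.
- exact: setI_closed_cylinders.
- move=> _ [B [C [GB mC ->]]].
  transitivity (P B * (normal_prob 0 (Num.sqrt h) C * p))%E; first exact: cylE.
  transitivity ((fine p)%:E * P (B `&` X u @^-1` C))%E => //.
  by rewrite cylE0// fineK// muleA muleC.
- move=> _; apply: (@le_lt_trans _ _ 1%E); last by rewrite ltry.
  by apply: (probability_le1 P); apply: measurableI.
Qed.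


(* The variables are integrated out one at a time: averaging over a centred
   normal variable of variance h multiplying the vector b turns the weight a
   into a / (1 - 2 a h |b|^2), and the factors produced along the way
   telescope. *)
Lemma expectation_expR_normal_vector (I : seq V) (h : R) (X : U -> Omega -> R)
    (b : U -> V -> Omega -> R) (a : Omega -> R) s :
  0 < h -> uniq s -> (forall om, 0 <= a om) ->
  (forall u, u \in s -> measurable_fun setT (X u)) ->
  forall G (K : Omega -> R) (z : V -> Omega -> R),
  sigma_algebra setT G -> G `<=` measurable -> independent_normal G h X s ->
  (forall om, 0 <= K om) ->
  measurable_fun setT (K : g_sigma_algebraType G -> R) ->
  measurable_fun setT (a : g_sigma_algebraType G -> R) ->
  (forall i, measurable_fun setT (z i : g_sigma_algebraType G -> R)) ->
  (forall u i, measurable_fun setT (b u i : g_sigma_algebraType G -> R)) ->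
  forall D : Omega -> R,
  (forall om, D om =
    1 - 2 * a om * (h * \sum_(u <- s) \sum_(i <- I) b u i om ^+ 2)) ->
  (forall om, 0 < D om) ->
  (\int[P]_om (K om * expR (a om *
      \sum_(i <- I) (z i om + \sum_(u <- s) X u om * b u i om) ^+ 2))%:E <=
   \int[P]_om (K om / Num.sqrt (D om) *
      expR (a om / D om * \sum_(i <- I) z i om ^+ 2))%:E)%E.
Proof.
move=> h0 + a0; elim: s => [_ _|u s IH us mX] G K z sG Gm ind K0 mK ma mz mb D DE0 D_gt0.
  rewrite le_eqVlt; apply/orP; left; apply/eqP; apply: eq_integral => om _.
  congr EFin; rewrite DE0 big_nil !mulr0 subr0 sqrtr1 !divr1.
  by congr (_ * expR (_ * _)); apply: eq_bigr => i _; rewrite big_nil addr0.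
have mXu : measurable_fun setT (X u) by apply: mX; rewrite mem_head.
have mXs v : v \in s -> measurable_fun setT (X v).
  by move=> vs; apply: mX; rewrite inE vs orbT.
set G' := <<s cylinders G (X u) >>.
have sG' : sigma_algebra setT G' by exact: smallest_sigma_algebra.
have G'm : G' `<=` measurable.
  apply: smallest_sub; first exact: sigma_algebra_measurable.
  exact: cylinders_measurable.
have GT : G setT by rewrite -(measurable_g_measurableTypeE sG).
have GG' : G `<=` G'.
  move=> E GE; apply: sub_sigma_algebra; exists E, setT; split => //.
  by rewrite preimage_setT setIT.
have mX' : measurable_fun setT (X u : g_sigma_algebraType G' -> R).
  move=> _ A mA; rewrite setTI; apply: sub_sigma_algebra.
  by apply: sub_sigma_algebra; exists setT, A; split => //; rewrite setTI.
pose S' om := \sum_(v <- s) \sum_(i <- I) b v i om ^+ 2.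
pose be om := \sum_(i <- I) b u i om ^+ 2.
have S0 om : 0 <= S' om.
  by apply: sumr_ge0 => v _; apply: sumr_ge0 => i _; exact: sqr_ge0.
have be0 om : 0 <= be om by apply: sumr_ge0 => i _; exact: sqr_ge0.
have DE om : D om = 1 - 2 * a om * (h * (be om + S' om)).
  by rewrite DE0 big_cons.
pose D' om := 1 - 2 * a om * (h * S' om).
have DD' om : D om = D' om - 2 * a om * h * be om by rewrite DE /D'; ring.
have D'_gt0 om : 0 < D' om.
  rewrite -(subrK (2 * a om * h * be om) (D' om)) -DD'.
  by rewrite ltr_wpDr// !mulr_ge0 ?a0// ltW.
have mS : measurable_fun setT (S' : g_sigma_algebraType G -> R).
  by do 2 (apply: measurable_fun_sum => ?); exact: measurable_funX.
have mD' : measurable_fun setT (D' : g_sigma_algebraType G -> R).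
  by apply: measurable_funB => //; apply: measurable_funM;
    [exact: measurable_funM|exact: measurable_funM].
(* The tail s is integrated out first, with [X u] absorbed into the shift z; [K'] and [a'] are the
   weights this leaves for the variable [X u]. *)
pose K' om := K om / Num.sqrt (D' om); pose a' om := a om / D' om.
have a'0 om : 0 <= a' om by rewrite divr_ge0 ?a0// ltW.
have K'0 om : 0 <= K' om by rewrite divr_ge0 ?sqrtr_ge0.
have mK' : measurable_fun setT (K' : g_sigma_algebraType G -> R).
  apply: measurable_funM => //; apply: measurable_fun_invr.
    by move=> om; rewrite sqrtr_gt0.
  exact: measurable_fun_sqrt.
have ma' : measurable_fun setT (a' : g_sigma_algebraType G -> R).
  by apply: measurable_funM => //; exact: measurable_fun_invr.
pose f (p : g_sigma_algebraType G * measurableTypeR R) : \bar R :=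
  (K' p.1 * expR (a' p.1 * \sum_(i <- I) (z i p.1 + p.2 * b u i p.1) ^+ 2))%:E.
have m1 (g : g_sigma_algebraType G -> R) : measurable_fun setT g ->
    measurable_fun setT (fun p : g_sigma_algebraType G * measurableTypeR R => g p.1).
  by move=> mg; apply: measurableT_comp mg _; exact: measurable_fst.
have mf : measurable_fun setT f.
  apply/measurable_EFinP; apply: measurable_funM; first exact: m1.
  apply: measurableT_comp => //; apply: measurable_funM; first exact: m1.
  apply: measurable_fun_sum => i; apply: measurable_funX; apply: measurable_funD.
    exact: m1.
  by apply: measurable_funM; [exact: measurable_snd|exact: m1].
have f0 p : (0 <= f p)%E by rewrite lee_fin mulr_ge0 ?expR_ge0.
apply: (@le_trans _ _ (\int[P]_om f (om, X u om))%E).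
  have := IH (andP us).2 mXs G' K (fun i om => z i om + X u om * b u i om)
    sG' G'm (independent_normal_adjoin us sG Gm mX ind) K0.
  have mG' (g : Omega -> R) :
      measurable_fun setT (g : g_sigma_algebraType G -> R) ->
      measurable_fun setT (g : g_sigma_algebraType G' -> R).
    exact: measurable_fun_g_sigma sG GG'.
  move=> /(_ (mG' _ mK) (mG' _ ma)) IH'.
  apply: le_trans (IH' _ _ D' (fun=> erefl) D'_gt0).
  - rewrite le_eqVlt; apply/orP; left; apply/eqP; apply: eq_integral => om _.
    congr (EFin (_ * expR (_ * _))); apply: eq_bigr => i _.
    by rewrite big_cons addrA.
  - move=> i; apply: measurable_funD; first exact: mG'.
    by apply: measurable_funM => //; exact: mG'.
  - by move=> v i; exact: mG'.
rewrite (ge0_integral_independent sG Gm mXu (independent_normal_head us ind) mf f0).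
apply: ge0_le_integral => //.
- by move=> om _; exact: integral_ge0.
- apply: (measurable_fun_g_sigma_sub sG Gm).
  exact: (measurable_fun_fubini_tonelli_F f mf f0).
- apply/measurable_EFinP; apply: (measurable_fun_g_sigma_sub sG Gm).
  have mbe : measurable_fun setT (be : g_sigma_algebraType G -> R).
    by apply: measurable_fun_sum => i; exact: measurable_funX.
  have mD : measurable_fun setT (D : g_sigma_algebraType G -> R).
    rewrite (funext DE); apply: measurable_funB => //; apply: measurable_funM.
      exact: measurable_funM.
    by apply: measurable_funM => //; exact: measurable_funD.
  apply: measurable_funM.
    apply: measurable_funM => //; apply: measurable_fun_invr.
      by move=> om; rewrite sqrtr_gt0.
    exact: measurable_fun_sqrt.
  apply: measurableT_comp => //; apply: measurable_funM.
    by apply: measurable_funM => //; exact: measurable_fun_invr.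
  by apply: measurable_fun_sum => i; exact: measurable_funX.
move=> om _.
(* In x the exponent reads a' p + a' be x^2 + 2 a' q x. Equality is lost only through q^2 <= p
   be. *)
pose p := \sum_(i <- I) z i om ^+ 2; pose q := \sum_(i <- I) z i om * b u i om.
have q2 : q ^+ 2 <= p * be om by exact: sum_mul_cauchy_schwarz.
have quadE (x : R) : a' om * \sum_(i <- I) (z i om + x * b u i om) ^+ 2 =
    a' om * p + (a' om * be om * x ^+ 2 + 2 * a' om * q * x).
  transitivity (a' om * (p + (x ^+ 2 * be om + 2 * x * q))); last by ring.
  congr (_ * _); rewrite /p /be /q !mulr_sumr.
  by rewrite -!big_split /=; apply: eq_bigr => i _; ring.
rewrite (_ : (fun x => _) = (fun x : measurableTypeR R =>
    (K' om * expR (a' om * p))%:E *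
    (expR (a' om * be om * x ^+ 2 + 2 * a' om * q * x))%:E)%E); last first.
  apply/funext => x; rewrite -EFinM; congr EFin.
  rewrite -[RHS]mulrA -expRD /=; congr (_ * expR _).
  exact: quadE.
have E2 : 1 - 2 * (a' om * be om) * h = D om / D' om.
  rewrite DD' /a'; field.
  by rewrite gt_eqF.
rewrite ge0_integralZl//; last 2 first.
- apply/measurable_EFinP/measurableT_comp => //; apply: measurable_funD.
    by apply: measurable_funM => //; exact: measurable_funX.
  exact: measurable_funM.
- by rewrite lee_fin mulr_ge0 ?expR_ge0.
rewrite integral_normal_expR_quadratic//; last first.
  by rewrite -subr_gt0 E2 divr_gt0.
rewrite E2 -EFinM lee_fin.
have -> : K' om * expR (a' om * p) *
    ((Num.sqrt (D om / D' om))^-1 *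
      expR ((2 * a' om * q) ^+ 2 * h / (2 * (D om / D' om)))) =
    K om / Num.sqrt (D om) *
      expR (a' om * p + (2 * a' om * q) ^+ 2 * h / (2 * (D om / D' om))).
  rewrite expRD mulrACA; congr (_ * _).
  rewrite sqrtrM ?ltW// sqrtrV ?ltW// invfM invrK /K' mulrACA mulrA.
  by rewrite -[LHS]mulrA mulVf ?mulr1// gt_eqF// sqrtr_gt0.
apply: ler_wpM2l; first by rewrite divr_ge0 ?sqrtr_ge0.
rewrite ler_expR.
have D0 := D_gt0 om; have D'0 := D'_gt0 om.
have -> : a om / D om = a' om + 2 * a' om ^+ 2 * h * be om / (D om / D' om).
  by rewrite /a' DD'; field; rewrite -DD' !gt_eqF.
rewrite -/p [leRHS]mulrDl lerD2l.
have -> : (2 * a' om * q) ^+ 2 * h / (2 * (D om / D' om)) =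
   2 * a' om ^+ 2 * h / (D om / D' om) * q ^+ 2.
  by field; rewrite !gt_eqF.
have -> : 2 * a' om ^+ 2 * h * be om / (D om / D' om) * p =
   2 * a' om ^+ 2 * h / (D om / D' om) * (p * be om).
  by field; rewrite !gt_eqF.
apply: ler_wpM2l => //; apply: divr_ge0; last by rewrite divr_ge0// ltW.
by apply: mulr_ge0; [apply: mulr_ge0 => //; exact: sqr_ge0|exact: ltW].
Qed.

End gaussian_vector.

(** * The inner product of L2 *)

Section unit_interval.
Variable R : realType.
Local Notation mu := (mu01 R).
Implicit Types (f g : measurableTypeR R -> R).

Lemma mu01_setT : mu setT = 1%E.
Proof.
transitivity (@lebesgue_measure R `]0, 1[%classic).
  by congr lebesgue_measure; rewrite setTI.
by rewrite lebesgue_measure_itv /= lte_fin ltr01 oppr0 adde0.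
Qed.

Lemma mu01_setC : mu (~` `]0, 1[%classic) = 0%E.
Proof.
transitivity (@lebesgue_measure R set0); last exact: measure0.
by congr lebesgue_measure; rewrite setICl.
Qed.

Lemma ae_mu01 : {ae mu, forall x, 0 < x < 1}.
Proof.
exists (~` `]0, 1[%classic); split; first exact: measurableC.
- exact: mu01_setC.
- by move=> x /= hx; rewrite in_itv.
Qed.

Lemma integrable_mu01 f : mu.-integrable setT (EFin \o f) ->
  (@lebesgue_measure R).-integrable `]0, 1[ (EFin \o f).
Proof.
move=> /integrableP[mf fi]; apply/integrableP; split.
  exact: measurable_funTS.
apply: le_lt_trans fi.
rewrite [leRHS](ge0_negligible_integral _ _ _ _ mu01_setC)//; last first.
- exact: measurableT_comp.
- exact: measurableC.
rewrite setTD setCK le_eqVlt; apply/orP; left; apply/eqP.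
apply: eq_measure_integral => A mA A01.
by congr lebesgue_measure; rewrite setIidl.
Qed.

Lemma integral_mu01 f : mu.-integrable setT (EFin \o f) ->
  (\int[mu]_x (f x)%:E = \int[lebesgue_measure]_(x in `]0%R, 1%R[) (f x)%:E)%E.
Proof.
move=> fi; rewrite (negligible_integral _ _ fi mu01_setC)//; last first.
  exact: measurableC.
rewrite setTD setCK; apply: eq_measure_integral => A mA A01.
by congr lebesgue_measure; rewrite setIidl.
Qed.

Lemma Rintegral_mu01 f : mu.-integrable setT (EFin \o f) ->
  \int[mu]_x f x = \int[lebesgue_measure]_(x in `]0, 1[) f x.
Proof. by move=> fi; rewrite /Rintegral integral_mu01. Qed.

Lemma Rintegral_ae_eq f g : measurable_fun setT f -> measurable_fun setT g ->
  f = g %[ae mu] -> \int[mu]_x f x = \int[mu]_x g x.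
Proof.
move=> mf mg fg; rewrite /Rintegral; congr fine.
apply: ae_eq_integral => //; try exact/measurable_EFinP.
exact: (ae_eq_comp EFin fg).
Qed.

Lemma Lfun2_of_sqr f : measurable_fun setT f ->
  mu.-integrable setT (EFin \o (fun x => f x ^+ 2)) -> f \in Lfun mu 2%:E.
Proof.
move=> mf /integrableP[_ fi]; apply/andP; rewrite !inE/=; split => //.
rewrite /finite_norm unlock poweR_lty//; apply: le_lt_trans fi.
rewrite le_eqVlt; apply/orP; left; apply/eqP; apply: eq_integral => x _ /=.
by rewrite normrX powR_mulrn.
Qed.

Lemma bounded_integrable f (C : R) : measurable_fun setT f ->
  {ae mu, forall x, `|f x| <= C} -> mu.-integrable setT (EFin \o f).
Proof.
move=> mf fC; apply/integrableP; split; first exact/measurable_EFinP.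
apply: (@le_lt_trans _ _ (\int[mu]_x (`|C|)%:E)%E); last first.
  by rewrite integral_cst// mu01_setT mule1 ltry.
apply: ae_ge0_le_integral => //.
  by apply: measurableT_comp => //; exact/measurable_EFinP.
by apply: filterS fC => x fC _; rewrite /= lee_fin (le_trans fC)// ler_norm.
Qed.

Lemma bounded_Lfun2 f (C : R) : measurable_fun setT f ->
  {ae mu, forall x, `|f x| <= C} -> f \in Lfun mu 2%:E.
Proof.
move=> mf fC; apply: Lfun2_of_sqr => //.
apply: (@bounded_integrable _ (C ^+ 2)); first exact: measurable_funX.
apply: filterS fC => x fC; rewrite normrX lerXn2r// nnegrE//.
exact: le_trans fC.
Qed.

Lemma Lfun2_measurable f : f \in Lfun mu 2%:E -> measurable_fun setT f.
Proof. by move=> /sub_Lfun_mfun/set_mem. Qed.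

Lemma Lfun2M_integrable f g : f \in Lfun mu 2%:E -> g \in Lfun mu 2%:E ->
  mu.-integrable setT (EFin \o (fun x => f x * g x)).
Proof. by move=> lf lg; apply/Lfun1_integrable; exact: Lfun2_mul_Lfun1. Qed.

Lemma Lfun2_bounded_mul f g (C : R) : f \in Lfun mu 2%:E -> measurable_fun setT g ->
  {ae mu, forall x, `|g x| <= C} -> (fun x => g x * f x) \in Lfun mu 2%:E.
Proof.
move=> lf mg gC; have mf := Lfun2_measurable lf.
apply: Lfun2_of_sqr; first exact: measurable_funM.
have i2 := Lfun2M_integrable lf lf.
have : mu.-integrable setT (fun x => (C ^+ 2)%:E * (f x * f x)%:E)%E.
  exact: integrableZl.
move/integrableP => [_ hi]; apply/integrableP; split.
  by apply/measurable_EFinP/measurable_funX; exact: measurable_funM.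
apply: le_lt_trans hi; apply: ae_ge0_le_integral => //.
- apply: measurableT_comp => //; apply/measurable_EFinP/measurable_funX.
  exact: measurable_funM.
- apply: measurableT_comp => //; apply/measurable_EFinP.
  by apply: measurable_funM => //; exact: measurable_funM.
apply: filterS gC => x gC _ /=; rewrite lee_fin (ger0_norm (sqr_ge0 _)).
rewrite -expr2 (ger0_norm (mulr_ge0 (sqr_ge0 _) (sqr_ge0 _))) exprMn.
rewrite ler_wpM2r ?sqr_ge0// -(real_normK (num_real (g x))).
by rewrite lerXn2r ?nnegrE// (le_trans _ gC).
Qed.

End unit_interval.

Section L2_inner.
Variable R : realType.
Local Notation U := (L2 R).
Local Notation mu := (mu01 R).
Implicit Types (u v w : U).

Lemma L2_measurable u : measurable_fun setT (u : measurableTypeR R -> R).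
Proof. exact: Lfun2_measurable (Lspace_Lfun u). Qed.

Lemma L2M_integrable u v : mu.-integrable setT (EFin \o (fun x => u x * v x)).
Proof. exact: Lfun2M_integrable (Lspace_Lfun u) (Lspace_Lfun v). Qed.

Lemma inner_ae u v (f g : measurableTypeR R -> R) :
  measurable_fun setT f -> measurable_fun setT g ->
  (u : R -> R) = f %[ae mu] -> (v : R -> R) = g %[ae mu] ->
  inner u v = \int[mu]_x (f x * g x).
Proof.
move=> mf mg uf vg; apply: Rintegral_ae_eq.
- by apply: measurable_funM; exact: L2_measurable.
- exact: measurable_funM.
have FF := ae_filter_ringOfSetsType mu.
by apply: (filterS2 _ _ uf vg) => x /= /(_ I) -> /(_ I) ->.
Qed.

Lemma inner_ael u v (f : measurableTypeR R -> R) : measurable_fun setT f ->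
  (u : R -> R) = f %[ae mu] -> inner u v = \int[mu]_x (f x * v x).
Proof.
move=> mf uf; apply: Rintegral_ae_eq.
- by apply: measurable_funM; exact: L2_measurable.
- by apply: measurable_funM => //; exact: L2_measurable.
have FF := ae_filter_ringOfSetsType mu.
by apply: (filterS _ uf) => x /= /(_ I) ->.
Qed.

Lemma innerC u v : inner u v = inner v u.
Proof. by apply: eq_Rintegral => x _; rewrite mulrC. Qed.

Lemma innerDl u v w : inner (u + v) w = inner u w + inner v w.
Proof.
rewrite (inner_ael _ _ (Lspace_addE u v)); last first.
  by apply: measurable_funD; exact: L2_measurable.
rewrite -RintegralD//; try exact: L2M_integrable.
by apply: eq_Rintegral => x _; rewrite mulrDl.
Qed.

Lemma innerZl a u w : inner (a *: u) w = a * inner u w.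
Proof.
rewrite (inner_ael _ _ (Lspace_scaleE a u)); last first.
  by apply: measurable_funM => //; exact: L2_measurable.
rewrite -RintegralZl//; last exact: L2M_integrable.
by apply: eq_Rintegral => x _; rewrite -mulrA.
Qed.

Lemma innerDr u v w : inner u (v + w) = inner u v + inner u w.
Proof. by rewrite innerC innerDl !(innerC u). Qed.

Lemma innerZr a u w : inner u (a *: w) = a * inner u w.
Proof. by rewrite innerC innerZl innerC. Qed.

Lemma inner0l w : inner 0 w = 0.
Proof. by rewrite -(scale0r 0) innerZl mul0r. Qed.

Lemma inner0r w : inner w 0 = 0.
Proof. by rewrite innerC inner0l. Qed.

Lemma innerNl u w : inner (- u) w = - inner u w.
Proof. by rewrite -scaleN1r innerZl mulN1r. Qed.

Lemma innerBl u v w : inner (u - v) w = inner u w - inner v w.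
Proof. by rewrite innerDl innerNl. Qed.

Lemma innerBr u v w : inner u (v - w) = inner u v - inner u w.
Proof. by rewrite innerC innerBl !(innerC u). Qed.

Lemma inner_suml I (s : seq I) (f : I -> U) w :
  inner (\sum_(i <- s) f i) w = \sum_(i <- s) inner (f i) w.
Proof.
elim: s => [|i s IH]; first by rewrite !big_nil inner0l.
by rewrite !big_cons innerDl IH.
Qed.

Lemma inner_sumr I (s : seq I) (f : I -> U) w :
  inner w (\sum_(i <- s) f i) = \sum_(i <- s) inner w (f i).
Proof. by rewrite innerC inner_suml; apply: eq_bigr => i _; rewrite innerC. Qed.

Lemma inner_norm u : inner u u = `|u| ^+ 2.
Proof.
apply: EFin_inj; rewrite -powR_mulrn// -poweR_EFin Lspace_normE poweR_Lnorm//.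
rewrite /inner /Rintegral fineK; last first.
  by apply: integrable_fin_num => //; exact: L2M_integrable.
apply: eq_integral => x _ /=.
by rewrite powR_mulrn// real_normK ?num_real// expr2.
Qed.

Lemma inner_ge0 u : 0 <= inner u u.
Proof. by rewrite inner_norm sqr_ge0. Qed.

Lemma inner_cauchy_schwarz u v : `|inner u v| <= `|u| * `|v|.
Proof.
rewrite -ler_sqr ?nnegrE ?mulr_ge0// real_normK ?num_real// exprMn -!inner_norm.
have [v0|v0] := eqVneq v 0; first by rewrite v0 !inner0r expr0n mulr0.
have vv : 0 < inner v v by rewrite inner_norm exprn_gt0// normr_gt0.
have := inner_ge0 (inner v v *: u - inner u v *: v).
rewrite innerBl !innerBr !innerZl !innerZr (innerC v u) => h.
by rewrite -(ler_pM2l vv); nra.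
Qed.


Lemma L2_classE (f : R -> R) : f \in Lfun mu 2%:E ->
  (L2_class f : R -> R) = f %[ae mu].
Proof.
move=> lf; have [u uf] := Lspace_pi (lee1n 2) lf.
by rewrite /L2_class; case: xgetP => [w _ //|/(_ u)]; case.
Qed.

Lemma le_mu01_Rintegral (f g : measurableTypeR R -> R) :
  mu.-integrable setT (EFin \o f) -> mu.-integrable setT (EFin \o g) ->
  {ae mu, forall x, f x <= g x} -> \int[mu]_x f x <= \int[mu]_x g x.
Proof.
move=> fi gi fg; rewrite -subr_ge0 -RintegralB//.
have gfi : mu.-integrable setT (EFin \o (fun x => g x - f x)).
  rewrite (_ : EFin \o _ = (EFin \o g) \- (EFin \o f))%E; last exact/funext.
  exact: integrableB.
(* The positive part is nonnegative at every point and equals g - f almost everywhere. *)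
rewrite -(@Rintegral_ae_eq _ (fun x => Num.max (g x - f x) 0)).
- by apply: Rintegral_ge0 => x _; rewrite le_max lexx orbT.
- apply: measurable_maxr => //; apply/measurable_EFinP.
  exact: measurable_int gfi.
- by apply/measurable_EFinP; exact: measurable_int gfi.
- have FF := ae_filter_ringOfSetsType mu.
  by apply: (filterS _ fg) => x fgx _; rewrite /= max_l// subr_ge0.
Qed.

Lemma norm_class_sqr_le (f g : measurableTypeR R -> R) : f \in Lfun mu 2%:E ->
  mu.-integrable setT (EFin \o g) ->
  {ae mu, forall x, f x ^+ 2 <= g x} ->
  `|L2_class f : U| ^+ 2 <= \int[mu]_x g x.
Proof.
move=> lf gi fg; rewrite -inner_norm (inner_ae _ _ (L2_classE lf) (L2_classE lf)).
- by apply: le_mu01_Rintegral => //; exact: Lfun2M_integrable.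
- exact: Lfun2_measurable.
- exact: Lfun2_measurable.
Qed.

Lemma Rintegral_sqr u : \int[mu]_x (u x ^+ 2) = `|u| ^+ 2.
Proof. by rewrite -inner_norm. Qed.

Section orthonormal_finite.
Variable I : {fset U}.
Hypothesis onI : Defs.orthonormal [set` I].

Lemma inner_sum_orthonormal (c : U -> R) h : h \in I ->
  inner h (\sum_(k <- I) c k *: k) = c h.
Proof.
move=> hI; rewrite inner_sumr (big_fsetD1 h)//= innerZr onI//= eqxx mulr1.
rewrite big_seq big1 ?addr0// => k /fsetD1P[kh kI].
by rewrite innerZr onI//= eq_sym (negbTE kh) mulr0.
Qed.

Lemma norm_sum_orthonormal (c : U -> R) :
  `|\sum_(k <- I) c k *: k| ^+ 2 = \sum_(k <- I) c k ^+ 2.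
Proof.
rewrite -inner_norm inner_suml; apply: eq_big_seq => h hI.
by rewrite innerZl inner_sum_orthonormal.
Qed.

Lemma inner_fproj v h : h \in I -> inner h (fproj I v) = inner h v.
Proof. exact: inner_sum_orthonormal. Qed.

Lemma norm_fproj v : `|fproj I v| ^+ 2 = \sum_(h <- I) inner h v ^+ 2.
Proof. exact: norm_sum_orthonormal. Qed.

Lemma fproj_id v : fproj I (fproj I v) = fproj I v.
Proof. by apply: eq_big_seq => h hI; rewrite inner_fproj. Qed.

Lemma inner_fproj_id u v : inner (fproj I u) v = inner (fproj I u) (fproj I v).
Proof.
rewrite !inner_suml; apply: eq_big_seq => h hI.
by rewrite !innerZl inner_fproj.
Qed.

Lemma norm_fproj_le v : `|fproj I v| <= `|v|.
Proof.
have := inner_cauchy_schwarz (fproj I v) v.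
rewrite inner_fproj_id inner_norm ger0_norm ?sqr_ge0// expr2.
have [->|p0] := eqVneq (fproj I v) 0; first by rewrite normr0.
by rewrite ler_pM2l// normr_gt0.
Qed.

End orthonormal_finite.

End L2_inner.

(** * Completeness of the trigonometric system *)

Section step_approximation.
Variable R : realType.
Implicit Types y : R.

Lemma bernoulli_inequality y n : -1 <= y -> 1 + n%:R * y <= (1 + y) ^+ n.
Proof.
move=> y1; elim: n => [|n IH]; first by rewrite mul0r addr0 expr0.
rewrite exprS; apply: (@le_trans _ _ ((1 + y) * (1 + n%:R * y))).
  rewrite -natr1 -subr_ge0 (_ : _ - _ = n%:R * y ^+ 2); last by ring.
  by rewrite mulr_ge0// sqr_ge0.
by apply: ler_wpM2l => //; rewrite -lerBlDl sub0r.
Qed.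

(* The classical polynomial approximation of a step at 1/2. *)
Definition step n y : R := (1 - y ^+ n) ^+ (2 ^ n).

Lemma step_itv n y : 0 <= y <= 1 -> 0 <= step n y <= 1.
Proof.
move=> /andP[y0 y1]; have yn0 := exprn_ge0 n y0; have yn1 := exprn_ile1 n y0 y1.
by rewrite /step exprn_ge0 ?exprn_ile1 ?subr_ge0// lerBlDr lerDl.
Qed.

(** Bernoulli's inequality gives 1 - (2 y)^n <= [step n y] <= 1. *)
Lemma cvg_step_lt y : 0 <= y -> y < 2^-1 -> step n y @[n --> \oo] --> (1 : R).
Proof.
move=> y0 y12; have z1 : `|2 * y| < 1 by rewrite ger0_norm; lra.
apply: (@squeeze_cvgr _ _ _ _ (fun n => 1 - (2 * y) ^+ n) (fun=> 1)).
- near=> n; have y01 : 0 <= y <= 1 by lra.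
  have /andP[_ ->] := step_itv n y01; rewrite andbT /step.
  have := @bernoulli_inequality (- y ^+ n) (2 ^ n) _.
  rewrite exprMn natrX mulrN; apply.
  by rewrite lerN2 exprn_ile1; lra.
- rewrite -[X in _ --> X]subr0; apply: cvgB; first exact: cvg_cst.
  exact: cvg_expr.
- exact: cvg_cst.
Unshelve. all: by end_near. Qed.

(** With z = y^n, Bernoulli gives (2 y)^n <= (1 + z)^(2^n). As (1 - z) (1 + z) <= 1, the product of
    [step n y] and (2 y)^n is at most 1. *)
Lemma cvg_step_gt y : y <= 1 -> 2^-1 < y -> step n y @[n --> \oo] --> (0 : R).
Proof.
move=> y1 y12; have y0 : 0 < y by lra.
have z1 : `|(2 * y)^-1| < 1.
  by rewrite ger0_norm ?invr_ge0 ?invf_lt1; lra.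
apply: (@squeeze_cvgr _ _ _ _ (fun=> 0) (fun n => (2 * y)^-1 ^+ n)); last 2 first.
- exact: cvg_cst.
- exact: cvg_expr.
near=> n; have y01 : 0 <= y <= 1 by lra.
have /andP[s0 _] := step_itv n y01; rewrite s0 /=.
have yn0 : 0 <= y ^+ n by rewrite exprn_ge0 ?ltW.
have yn1 : y ^+ n <= 1 := exprn_ile1 n (ltW y0) y1.
have z0 : 0 < (2 * y) ^+ n by apply: exprn_gt0; lra.
rewrite exprVn -[leRHS]mul1r ler_pdivlMr//.
apply: (@le_trans _ _ (step n y * (1 + y ^+ n) ^+ (2 ^ n))).
  apply: ler_wpM2l => //; have := @bernoulli_inequality (y ^+ n) (2 ^ n) _.
  by rewrite exprMn natrX => h; apply: le_trans (h _); lra.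
rewrite /step -exprMn exprn_ile1//; nra.
Unshelve. all: by end_near. Qed.

End step_approximation.

Section trigonometric_polynomials.
Variable R : realType.
Local Notation mu := (mu01 R).

(** With arbitrary phases one generator covers sines and cosines, and a single product-to-sum
    formula gives closure under products. *)
Inductive trigpoly : (R -> R) -> Prop :=
| trigpoly_cos (k : int) (a : R) :
    trigpoly (fun x => cos (2 * pi * k%:~R * x - a))
| trigpoly_add f g : trigpoly f -> trigpoly g -> trigpoly (fun x => f x + g x)
| trigpoly_scale c f : trigpoly f -> trigpoly (fun x => c * f x).

Lemma trigpoly_cst c : trigpoly (fun=> c).
Proof.
have := trigpoly_scale c (trigpoly_cos 0 0); congr trigpoly; apply/funext => x.
by rewrite mulr0 mul0r subr0 cos0 mulr1.
Qed.

Lemma cosM (x y : R) : cos x * cos y = 2^-1 * cos (x + y) + 2^-1 * cos (x - y).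
Proof. by rewrite cosD cosB; field. Qed.

Lemma trigpoly_mul f g : trigpoly f -> trigpoly g -> trigpoly (fun x => f x * g x).
Proof.
move=> + tg; elim=> {f} [k a|f f' _ h _ h'|c f _ h]; last 2 first.
- have := trigpoly_add h h'; congr trigpoly; apply/funext => x; exact/esym/mulrDl.
- have := trigpoly_scale c h; congr trigpoly; apply/funext => x; exact: mulrA.
elim: tg => {g} [l b|f f' _ h _ h'|c f _ h]; last 2 first.
- have := trigpoly_add h h'; congr trigpoly; apply/funext => x; exact/esym/mulrDr.
- have := trigpoly_scale c h; congr trigpoly; apply/funext => x; exact: mulrCA.
have := trigpoly_add (trigpoly_scale 2^-1 (trigpoly_cos (k + l) (a + b)))
  (trigpoly_scale 2^-1 (trigpoly_cos (k - l) (a - b))).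
congr trigpoly; apply/funext => x; rewrite cosM intrD intrB.
by congr (_ * cos _ + _ * cos _); ring.
Qed.

Lemma trigpoly_exp f n : trigpoly f -> trigpoly (fun x => f x ^+ n).
Proof.
move=> tf; elim: n => [|n IH]; first exact: trigpoly_cst.
have := trigpoly_mul tf IH; congr trigpoly; apply/funext => x.
by rewrite exprS.
Qed.

Lemma trigpoly_step f n : trigpoly f -> trigpoly (fun x => step n (f x)).
Proof.
move=> tf; apply: trigpoly_exp; apply: trigpoly_add; first exact: trigpoly_cst.
have := trigpoly_scale (-1) (trigpoly_exp n tf); congr trigpoly.
by apply/funext => x; rewrite mulN1r.
Qed.

Lemma trigpoly_continuous f : trigpoly f -> continuous f.
Proof.
elim=> {f} [k a|f f' _ h _ h'|c f _ h] x.
- apply: continuous_comp; last exact: continuous_cos.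
  by apply: cvgB; [apply: cvgM; [exact: cvg_cst|exact: cvg_id]|exact: cvg_cst].
- by apply: cvgD; [exact: h|exact: h'].
- by apply: cvgM; [exact: cvg_cst|exact: h].
Qed.

Lemma trigpoly_measurable f : trigpoly f ->
  measurable_fun setT (f : measurableTypeR R -> R).
Proof. by move=> /trigpoly_continuous/continuous_measurable_fun. Qed.

Lemma trigpoly_bounded f : trigpoly f -> exists C, forall x, `|f x| <= C.
Proof.
elim=> {f} [k a|f f' _ [C h] _ [C' h']|c f _ [C h]].
- by exists 1 => x; rewrite cos_max.
- by exists (C + C') => x; rewrite (le_trans (ler_normD _ _))// lerD.
- by exists (`|c| * C) => x; rewrite normrM ler_wpM2l.
Qed.

Definition trig (k : int) (x : R) : R :=
  match k with
  | Posz 0 => 1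
  | Posz n => Num.sqrt 2 * cos (2 * pi * n%:R * x)
  | Negz n => Num.sqrt 2 * sin (2 * pi * n.+1%:R * x)
  end.

Lemma trigpoly_trig k : trigpoly (trig k).
Proof.
case: k => [[|n]|n]; first exact: trigpoly_cst.
- have := trigpoly_scale (Num.sqrt 2) (trigpoly_cos n.+1 0).
  by congr trigpoly; apply/funext => x; rewrite subr0.
- have := trigpoly_scale (Num.sqrt 2) (trigpoly_cos n.+1 (pi / 2)).
  congr trigpoly; apply/funext => x; rewrite cosB cos_pihalf sin_pihalf.
  by rewrite mulr0 mulr1 add0r.
Qed.

Lemma ae_lebesgue_mu01 (Q : R -> Prop) :
  {ae @lebesgue_measure R, forall x, Q x} -> {ae mu, forall x, Q x}.
Proof.
move=> [N [mN N0 QN]]; exists N; split => //.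
apply/eqP; rewrite eq_le measure_ge0 andbT.
by rewrite -N0; apply: le_measure; rewrite ?inE//; exact: measurableI.
Qed.

Section completeness.
Variable h : L2 R.
Hypothesis h0 : forall k, \int[mu]_x (h x * trig k x) = 0.

Lemma mul_trigpoly_integrable f : trigpoly f ->
  mu.-integrable setT (EFin \o (fun x => h x * f x)).
Proof.
move=> tf; apply: Lfun2M_integrable; first exact: Lspace_Lfun.
have [C fC] := trigpoly_bounded tf.
by apply: (@bounded_Lfun2 _ _ C); [exact: trigpoly_measurable|exact: aeW].
Qed.

Lemma Rintegral_mul_trigpoly f : trigpoly f -> \int[mu]_x (h x * f x) = 0.
Proof.
have I := mul_trigpoly_integrable.
have ZE c f' : trigpoly f' ->
    \int[mu]_x (h x * (c * f' x)) = c * \int[mu]_x (h x * f' x).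
  move=> tf; rewrite -RintegralZl//; last exact: I.
  by apply: eq_Rintegral => x _; rewrite mulrCA.
have DE f1 f2 : trigpoly f1 -> trigpoly f2 ->
    \int[mu]_x (h x * (f1 x + f2 x)) =
    \int[mu]_x (h x * f1 x) + \int[mu]_x (h x * f2 x).
  move=> t1 t2; rewrite -RintegralD//; try exact: I.
  by apply: eq_Rintegral => x _; rewrite mulrDr.
elim=> {f} [k a|f f' tf hf tf' hf'|c f tf hf]; last 2 first.
- by rewrite DE// hf hf' addr0.
- by rewrite ZE// hf mulr0.
have s2 : Num.sqrt 2 != 0 :> R by rewrite gt_eqF// sqrtr_gt0.
have key (n : nat) c1 c2 : \int[mu]_x (h x *
    (c1 * cos (2 * pi * n%:R * x) + c2 * sin (2 * pi * n%:R * x))) = 0.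
  case: n => [|n].
    transitivity (\int[mu]_x (h x * (c1 * trig 0 x))).
      by apply: eq_Rintegral => x _; rewrite mulr0 mul0r cos0 sin0 mulr0 addr0.
    by rewrite ZE ?h0 ?mulr0//; exact: trigpoly_trig.
  transitivity (\int[mu]_x (h x * (c1 / Num.sqrt 2 * trig (Posz n.+1) x +
      c2 / Num.sqrt 2 * trig (Negz n) x))).
    by apply: eq_Rintegral => x _ /=; rewrite !mulrA !divfK.
  have t1 := trigpoly_trig (Posz n.+1); have t2 := trigpoly_trig (Negz n).
  rewrite (DE _ _ (trigpoly_scale _ t1) (trigpoly_scale _ t2)).
  by rewrite (ZE _ _ t1) (ZE _ _ t2) !h0 !mulr0 addr0.
case: k => n.
  rewrite -(key n (cos a) (sin a)); apply: eq_Rintegral => x _.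
  by rewrite cosB mulrC [cos a * _]mulrC [sin a * _]mulrC mulrC.
rewrite -(key n.+1 (cos a) (- sin a)); apply: eq_Rintegral => x _.
rewrite NegzE mulrNz mulrN mulNr cosB cosN sinN.
by congr (_ * _); ring.
Qed.

Lemma mul_indicator_integrable (b : R) :
  mu.-integrable setT (EFin \o (fun x => h x * (x <= b)%R%:R)).
Proof.
apply: Lfun2M_integrable; first exact: Lspace_Lfun.
apply: (@bounded_Lfun2 _ _ 1); last first.
  by apply: aeW => x; case: (x <= b); rewrite ?normr1 ?normr0.
have mi : measurable_fun setT (\1_(`]-oo, b]%classic) : measurableTypeR R -> R).
  exact: measurable_indic.
rewrite (_ : (fun x => _) = \1_(`]-oo, b]%classic))//; apply/funext => x.
by rewrite indicE mem_setE in_itv.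
Qed.

(** The trigonometric polynomial y = 1/2 - sin (pi x) sin (pi (b - x)) / 2 has values in [0, 1] and,
    on (0, 1), is below 1/2 before b and above 1/2 after b. Hence the trigonometric polynomials
    [step n (y x)] converge boundedly to the indicator of x <= b except at b, and orthogonality
    passes to the limit by dominated convergence. *)
Lemma Rintegral_mul_indicator (b : R) : 0 < b < 1 ->
  \int[mu]_x (h x * (x <= b)%R%:R) = 0.
Proof.
move=> /andP[b0 b1].
pose y x : R := 2^-1 + 4^-1 * (cos (pi * b) - cos (2 * pi * x - pi * b)).
have ty : trigpoly y.
  apply: trigpoly_add; first exact: trigpoly_cst.
  apply: trigpoly_scale; apply: trigpoly_add; first exact: trigpoly_cst.
  have := trigpoly_scale (-1) (trigpoly_cos 1 (pi * b)).
  by congr trigpoly; apply/funext => x; rewrite mulN1r mulr1.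
have y01 x : 0 <= y x <= 1.
  have := cos_max (pi * b); have := cos_max (2 * pi * x - pi * b).
  by rewrite !ler_norml => /andP[? ?] /andP[? ?]; rewrite /y; lra.
have yE x : y x = 2^-1 - 2^-1 * (sin (pi * x) * sin (pi * (b - x))).
  rewrite /y (_ : 2 * pi * x - pi * b = pi * x - pi * (b - x)); last by ring.
  rewrite {1}(_ : pi * b = pi * x + pi * (b - x)); last by ring.
  by rewrite cosB cosD; field.
have pi0 := pi_gt0 R.
have sx (x : R) : 0 < x < 1 -> 0 < sin (pi * x).
  move=> /andP[x0 x1]; apply: sin_gt0_pi.
  by rewrite mulr_gt0//= gtr_pMr.
have lim (x : R) : 0 < x < 1 -> x != b ->
    step n (y x) @[n --> \oo] --> ((x <= b)%R%:R : R).
  move=> x01 xb; have /andP[y0 y1] := y01 x; have sx0 := sx x x01.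
  have [x0 x1] := andP x01.
  have [xltb|bltx|xb'] := ltgtP x b; last by rewrite xb' eqxx in xb.
  - apply: cvg_step_lt => //; rewrite yE ltrBlDr ltrDl mulr_gt0// mulr_gt0//.
    by apply: sx; lra.
  - apply: cvg_step_gt => //; rewrite yE ltrDl -mulrN mulr_gt0// -mulrN mulr_gt0//.
    by rewrite -sinN -mulrN opprB; apply: sx; lra.
have mind := measurable_int _ (mul_indicator_integrable b).
have hi : mu.-integrable setT (EFin \o (fun x => h x)).
  have := mul_trigpoly_integrable (trigpoly_cst 1).
  by congr (_.-integrable _ _); apply/funext => x /=; rewrite mulr1.
have mf n : measurable_fun setT (fun x : measurableTypeR R => (h x * step n (y x))%:E).
  exact: measurable_int (mul_trigpoly_integrable (trigpoly_step n ty)).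
have FF := ae_filter_ringOfSetsType mu.
have aeb : {ae mu, forall x, x != b}.
  exists [set b]; split => //; last by move=> x /= /negP; rewrite negbK => /eqP.
  apply/eqP; rewrite eq_le measure_ge0 andbT.
  rewrite -(lebesgue_measure_set1 b); apply: le_measure; rewrite ?inE//.
  exact: measurableI.
have cvgh : {ae mu, forall x, setT x ->
    (h x * step n (y x))%:E @[n --> \oo] --> (h x * (x <= b)%R%:R)%:E}.
  apply: (filterS2 _ _ (@ae_mu01 R) aeb) => x x01 xb _.
  apply: cvg_EFin; first exact: nearW.
  by apply: cvgM; [exact: cvg_cst|exact: lim].
have dom : {ae mu, forall x n, setT x ->
    (`|(h x * step n (y x))%:E| <= (`|h x|)%:E)%E}.
  apply: aeW => x n _; rewrite lee_fin normrM ler_piMr//.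
  by have /andP[? ?] := step_itv n (y01 x); rewrite ger0_norm.
have [_ _ cvgI] := dominated_convergence measurableT mf
  mind cvgh (integrable_norm hi) dom.
have I0 : (\int[mu]_x (h x * (x <= b)%R%:R)%:E = 0)%E.
  apply: (cvg_unique (@ereal_hausdorff R) cvgI).
  apply: cvg_near_cst; apply: nearW => n /=.
  have ts := trigpoly_step n ty; have hn := mul_trigpoly_integrable ts.
  rewrite -(fineK (integrable_fin_num measurableT hn)); congr EFin.
  exact: Rintegral_mul_trigpoly ts.
by rewrite /Rintegral I0.
Qed.

(** The integrals of h over (0, b] all vanish, and by Lebesgue's differentiation theorem h is almost
    everywhere the derivative of its primitive. *)
Lemma trig_complete : h = 0.
Proof.
have hi : mu.-integrable setT (EFin \o (fun x => h x)).
  have := mul_trigpoly_integrable (trigpoly_cst 1).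
  by congr (_.-integrable _ _); apply/funext => x /=; rewrite mulr1.
pose f : R -> R := (h : R -> R) \_ `]0, 1[%classic.
have fi : (@lebesgue_measure R).-integrable setT (EFin \o f).
  have := integrable_mu01 hi; rewrite integrable_mkcond//.
  by congr (_.-integrable _ _); apply/funext => x; rewrite /f /= !patchE; case: ifP.
have floc : locally_integrable [set: R] f.
  by apply: open_integrable_locally => //; exact: openT.
have fiN y : (@lebesgue_measure R).-integrable `]-oo, y] (EFin \o f).
  exact: integrableS fi.
have F0 (b : R) : 0 < b < 1 -> (\int[lebesgue_measure]_(t in `]-oo, b]) f t) = 0.
  move=> b01; rewrite -(Rintegral_mul_indicator b01) Rintegral_mu01; last first.
    exact: mul_indicator_integrable.
  rewrite [LHS]Rintegral_mkcond [RHS]Rintegral_mkcond; apply: eq_Rintegral => x _.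
  rewrite /f !patchE !mem_setE !in_itv /=.
  by case: (x <= b); case: (_ && _); rewrite ?mulr1 ?mulr0.
apply/Lspace_eqP; have FF := ae_filter_ringOfSetsType mu.
have ae1 := ae_lebesgue_mu01 (FTC1Ny fiN floc).
apply: (filterS3 _ _ ae1 (@ae_mu01 R) (Lspace_0E mu (lee1n 2))) => x [_ F'] x01 /(_ I) -> _ /=.
have x01' : x \in `]0, 1[%classic by rewrite mem_setE in_itv.
transitivity (f x); first by rewrite /f patchE x01'.
rewrite -F' derive1E (@near_eq_derive _ _ _ _ (cst 0)) ?derive_cst//.
have : nbhs x (`]0, 1[%classic : set R).
  by apply: open_nbhs_nbhs; split; [exact: interval_open|rewrite /= in_itv].
by apply: filterS => y /=; rewrite in_itv /= => y01; exact: F0.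
Qed.

End completeness.
End trigonometric_polynomials.

(** * Trigonometric sums and the Burgers drift *)

Section trigonometric_sums.
Variable R : realType.
Local Notation mu := (mu01 R).

Lemma continuous_integrable (g : R -> R) : continuous g ->
  mu.-integrable setT (EFin \o g).
Proof.
move=> cg; have cng : {within `[0, 1], continuous (fun x => `|g x|)}.
  by apply: continuous_subspaceT => x; apply: cvg_norm; exact: cg.
have [c _ gc] := EVT_max ler01 cng.
apply: (@bounded_integrable _ _ `|g c|); first exact: continuous_measurable_fun.
have FF := ae_filter_ringOfSetsType mu.
apply: (filterS _ (@ae_mu01 R)) => x /andP[x0 x1]; apply: gc.
by rewrite in_itv /= !ltW.
Qed.

Lemma trigpoly_sum (I : Type) (s : seq I) (f : I -> R -> R) :
  (forall i, trigpoly (f i)) -> trigpoly (fun x => \sum_(i <- s) f i x).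
Proof.
move=> tf; elim: s => [|i s IH].
  by have := trigpoly_cst (0 : R); congr trigpoly; apply/funext => x; rewrite big_nil.
have := trigpoly_add (tf i) IH; congr trigpoly; apply/funext => x.
by rewrite big_cons.
Qed.

Lemma trigpoly_Lfun2 (f : R -> R) : trigpoly f -> f \in Lfun mu 2%:E.
Proof.
move=> tf; have [C fC] := trigpoly_bounded tf.
by apply: (@bounded_Lfun2 _ _ C); [exact: trigpoly_measurable|exact: aeW].
Qed.

Lemma trigpoly_integrable (f : R -> R) : trigpoly f ->
  mu.-integrable setT (EFin \o f).
Proof.
move=> tf; have [C fC] := trigpoly_bounded tf.
by apply: (@bounded_integrable _ _ C); [exact: trigpoly_measurable|exact: aeW].
Qed.

(** Since the sign of k separates cosines from sines, differentiation is the exchange of k and -k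
    with one factor for both. *)
Lemma is_derive_trig k (x : R) :
  is_derive x 1 (@trig R k) (- (2 * pi * k%:~R) * trig (- k) x).
Proof.
have dlin (a : R) : is_derive x 1 (fun y => a * y) a.
  by have := is_deriveZ a (is_derive_id x 1); rewrite scaler1.
case: k => [[|n]|n].
- by rewrite mulr0 oppr0 mul0r; exact: is_derive_cst.
- pose a : R := 2 * pi * n.+1%:R.
  apply: (is_derive_eq (is_deriveZ (Num.sqrt 2)
    (is_derive1_comp (is_derive_cos (a * x)) (dlin a)))).
  by rewrite /= /GRing.scale /= -/a; ring.
- pose a : R := 2 * pi * n.+1%:R.
  apply: (is_derive_eq (is_deriveZ (Num.sqrt 2)
    (is_derive1_comp (is_derive_sin (a * x)) (dlin a)))).
  rewrite /= /GRing.scale /=.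
  by rewrite (_ : (Negz n)%:~R = - n.+1%:R)// mulrN opprK -/a; ring.
Qed.

Lemma trig_periodic k : trig k 1 = trig k 0 :> R.
Proof.
have E n : 2 * pi * n.+1%:R = 0 + pi *+ 2 *+ n.+1 :> R.
  by rewrite add0r -[RHS]mulr_natr -[pi *+ 2]mulr_natl.
case: k => [[|n]|n] //=; rewrite mulr1 mulr0 E periodicn//.
  exact: cosD2pi.
exact: sinD2pi.
Qed.

Lemma Rintegral_derive (f f' : R -> R) : (forall x : R, is_derive x 1 f (f' x)) ->
  continuous f' -> mu.-integrable setT (EFin \o f') ->
  \int[mu]_x f' x = f 1 - f 0.
Proof.
move=> df cf' if'; rewrite Rintegral_mu01// /Rintegral.
rewrite -(@integral_itv_bndoo R 0 1 _ true false); last first.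
  by apply: measurable_funTS; exact: measurable_int if'.
have cf : continuous f.
  move=> x; apply: differentiable_continuous; apply/derivable1_diffP.
  by have [] := df x.
rewrite (@continuous_FTC2 _ f' f)//.
- exact: continuous_subspaceT.
- split; first by move=> x _; have [] := df x.
    exact: cvg_at_right_filter (cf 0).
  exact: cvg_at_left_filter (cf 1).
- by move=> x _; rewrite derive1E; have [] := df x.
Qed.

(** Frequencies are a function on an index type rather than the index itself, so that
    differentiation alters [k] and [c] and keeps the list of indices. *)
Definition trigsum (I : Type) (s : seq I) (k : I -> int) (c : I -> R) (x : R) : R :=
  \sum_(i <- s) c i * trig (k i) x.

Section trigsum_theory.
Variables (I : Type) (s : seq I).
Implicit Types (k : I -> int) (c : I -> R).

Lemma trigpoly_trigsum k c : trigpoly (trigsum s k c).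
Proof. by apply: trigpoly_sum => i; apply: trigpoly_scale; exact: trigpoly_trig. Qed.

Definition dfreq k i : int := - k i.
Definition dcoef k c i : R := - (2 * pi * (k i)%:~R) * c i.

Lemma is_derive_trigsum k c (x : R) :
  is_derive x 1 (trigsum s k c) (trigsum s (dfreq k) (dcoef k c) x).
Proof.
rewrite /trigsum; elim: s => [|i s' IH].
  under eq_fun do rewrite big_nil; rewrite big_nil; exact: is_derive_cst.
under eq_fun do rewrite big_cons; rewrite big_cons.
apply: (is_derive_eq (is_deriveD (is_deriveZ (c i) (is_derive_trig (k i) x)) IH)).
congr (_ + _).
by rewrite /GRing.scale /= /dcoef mulrCA mulrA.
Qed.

Lemma trigsum_periodic k c : trigsum s k c 1 = trigsum s k c 0.
Proof. by apply: eq_bigr => i _; rewrite trig_periodic. Qed.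

Lemma trigsum_dd k c :
  trigsum s (dfreq (dfreq k)) (dcoef (dfreq k) (dcoef k c)) =
  trigsum s k (fun i => - (2 * pi * (k i)%:~R) ^+ 2 * c i).
Proof.
apply/funext => x; apply: eq_bigr => i _; rewrite /dcoef /dfreq opprK.
by rewrite mulrNz; congr (_ * _); ring.
Qed.

(** This is <w, w w'> = 0: f^2 f' is the derivative of f^3 / 3, and f is periodic. *)
Lemma Rintegral_trigsum_sqr_deriv k c :
  \int[mu]_x (trigsum s k c x ^+ 2 * trigsum s (dfreq k) (dcoef k c) x) = 0.
Proof.
set f := trigsum s k c; set f' := trigsum s (dfreq k) _.
have tf : trigpoly f by exact: trigpoly_trigsum.
have tg : trigpoly (fun x => f x ^+ 2 * f' x).
  apply: trigpoly_mul; first exact: trigpoly_exp.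
  exact: trigpoly_trigsum.
have df (x : R) : is_derive x 1 (fun x => 3^-1 * f x ^+ 3) (f x ^+ 2 * f' x).
  apply: (is_derive_eq (is_deriveZ 3^-1 (is_deriveX 3 (is_derive_trigsum k c x)))).
  by rewrite /GRing.scale /= -/f -/f'; field.
rewrite (Rintegral_derive df (trigpoly_continuous tg) (trigpoly_integrable tg)).
by rewrite /f trigsum_periodic subrr.
Qed.

(** Integration by parts without boundary terms: with g = -f'', the function f'^2 - f g is the
    derivative of the periodic f f'. *)
Lemma Rintegral_trigsum_deriv_sqr k c :
  \int[mu]_x (trigsum s (dfreq k) (dcoef k c) x ^+ 2) =
  \int[mu]_x (trigsum s k c x *
    trigsum s k (fun i => (2 * pi * (k i)%:~R) ^+ 2 * c i) x).
Proof.
set f := trigsum s k c; set f' := trigsum s (dfreq k) _; set g := trigsum s k _.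
have tf : trigpoly f by exact: trigpoly_trigsum.
have tf' : trigpoly f' by exact: trigpoly_trigsum.
have tg : trigpoly g by exact: trigpoly_trigsum.
have f''E (x : R) : is_derive x 1 f' (- g x).
  apply: (is_derive_eq (is_derive_trigsum (dfreq k) (dcoef k c) x)).
  rewrite trigsum_dd /g /trigsum -sumrN; apply: eq_bigr => i _.
  by rewrite !mulNr.
have t1 := trigpoly_exp 2 tf'; have t2 := trigpoly_mul tf tg.
apply/eqP; rewrite -subr_eq0 -RintegralB//; [|exact: trigpoly_integrable..].
have t3 : trigpoly (fun x => f' x ^+ 2 - f x * g x).
  have := trigpoly_add t1 (trigpoly_scale (-1) t2); congr trigpoly.
  by apply/funext => x; rewrite mulN1r.
have df (x : R) : is_derive x 1 (fun x => f x * f' x) (f' x ^+ 2 - f x * g x).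
  apply: (is_derive_eq (is_deriveM (is_derive_trigsum k c x) (f''E x))).
  by rewrite /GRing.scale /= -/f -/f'; ring.
rewrite (Rintegral_derive df (trigpoly_continuous t3) (trigpoly_integrable t3)).
by rewrite /f /f' !trigsum_periodic subrr.
Qed.

Lemma test_function_boundary (phi : R -> R) : test_function phi ->
  phi 0 = 0 /\ phi 1 = 0.
Proof.
move=> [_ [a [b [a0 b1 h]]]]; split; apply: h; rewrite in_itv /= negb_and -!ltNge.
  by rewrite a0.
by rewrite b1 orbT.
Qed.

(** The classical derivative is a weak one: f phi vanishes at 0 and 1, so its derivative has
    integral zero. *)
Lemma trigsum_weak_derivative k c (phi : R -> R) : test_function phi ->
  \int[mu]_x (trigsum s k c x * derive1 phi x) =
  - \int[mu]_x (trigsum s (dfreq k) (dcoef k c) x * phi x).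
Proof.
move=> tphi; have [phi0 phi1] := test_function_boundary tphi.
have [smooth _] := tphi.
set f := trigsum s k c; set f' := trigsum s (dfreq k) _.
have tf : trigpoly f by exact: trigpoly_trigsum.
have tf' : trigpoly f' by exact: trigpoly_trigsum.
have dphi (x : R) : is_derive x 1 phi (derive1 phi x).
  by rewrite derive1E; apply: derivableP; exact: (smooth 0).
have cont (g : R -> R) : (forall x, derivable g x 1) -> continuous g.
  by move=> dg x; apply/differentiable_continuous/derivable1_diffP.
have cphi : continuous phi by exact: cont (smooth 0).
have cphi' : continuous (derive1 phi) by exact: cont (smooth 1).
have c1 : continuous (fun x => f x * derive1 phi x).
  by move=> x; apply: cvgM; [exact: trigpoly_continuous|exact: cphi'].
have c2 : continuous (fun x => f' x * phi x).
  by move=> x; apply: cvgM; [exact: trigpoly_continuous|exact: cphi].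
apply/eqP; rewrite -subr_eq0 opprK -RintegralD//; [|exact: continuous_integrable..].
have df (x : R) : is_derive x 1 (fun x => f x * phi x)
    (f x * derive1 phi x + f' x * phi x).
  apply: (is_derive_eq (is_deriveM (is_derive_trigsum k c x) (dphi x))).
  by rewrite /GRing.scale /= -/f -/f'; ring.
have c3 : continuous (fun x => f x * derive1 phi x + f' x * phi x).
  by move=> x; apply: cvgD; [exact: c1|exact: c2].
by rewrite (Rintegral_derive df c3 (continuous_integrable c3)) phi0 phi1 !mulr0 subrr.
Qed.

End trigsum_theory.
End trigonometric_sums.

(** * Sums over integer frequencies and growth of the eigenvalues *)

Section integer_sums.
Variable R : realType.

Lemma ler_sum_subset (T : eqType) (s t : seq T) (f : T -> R) :
  uniq s -> {subset s <= t} -> (forall x, 0 <= f x) ->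
  \sum_(x <- s) f x <= \sum_(x <- t) f x.
Proof.
move=> + + f0; elim: s t => [t _ _|x s IH t /= /andP[xs us] st].
  by rewrite big_nil sumr_ge0.
have xt : x \in t by apply: st; rewrite mem_head.
rewrite (perm_big _ (perm_to_rem xt)) !big_cons lerD2l; apply: IH => // y ys.
have : y \in t by apply: st; rewrite inE ys orbT.
rewrite (perm_mem (perm_to_rem xt)) inE => /predU1P[yx|//].
by rewrite -yx ys in xs.
Qed.

(** The bound telescopes: 1 / (1 + i^2) <= 4 / (i + 1) - 4 / (i + 2). *)
Lemma sum_inv_sqr_nat n : \sum_(i < n) (1 + i%:R ^+ 2)^-1 <= 4 - 4 / n.+1%:R :> R.
Proof.
elim: n => [|n IH]; first by rewrite big_ord0 divr1 subrr.
rewrite big_ord_recr /=; apply: le_trans (lerD IH (lexx _)) _.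
rewrite -[n.+2%:R]natr1 -[n.+1%:R]natr1; have n0 : 0 <= n%:R :> R by [].
move: (n%:R : R) n0 => x x0.
have e1 : 0 < 1 + x ^+ 2 by nra.
have e2 : 0 < x + 1 by lra.
have e3 : 0 < x + 1 + 1 by lra.
rewrite -subr_ge0.
have -> : 4 - 4 / (x + 1 + 1) - (4 - 4 / (x + 1) + (1 + x ^+ 2)^-1) =
    (4 * (1 + x ^+ 2) - (x + 1) * (x + 1 + 1)) /
    ((x + 1) * (x + 1 + 1) * (1 + x ^+ 2)).
  by field; rewrite !gt_eqF.
by apply: divr_ge0; [nra|rewrite !mulr_ge0// ltW].
Qed.

Lemma sum_inv_sqr_int (s : seq int) : uniq s ->
  \sum_(k <- s) (1 + k%:~R ^+ 2)^-1 <= 8 :> R.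
Proof.
move=> us; pose f (k : int) : R := (1 + k%:~R ^+ 2)^-1.
have f0 k : 0 <= f k by rewrite invr_ge0 addr_ge0// sqr_ge0.
pose M := (\max_(k <- s) `|k|).+1%N.
have sM k : k \in s -> (`|k| < M)%N.
  by move=> ks; rewrite ltnS; exact: (@leq_bigmax_seq _ s xpredT absz k ks isT).
clearbody M; pose t := [seq Posz n | n <- iota 0 M] ++ [seq Negz n | n <- iota 0 M].
apply: (@le_trans _ _ (\sum_(k <- t) f k)).
  apply: ler_sum_subset => // k /sM kM; rewrite mem_cat.
  case: k kM => n nM; apply/orP; [left|right]; apply/mapP; exists n => //.
    by rewrite mem_iota.
  by rewrite mem_iota add0n /=; exact: ltnW.
have hM := sum_inv_sqr_nat M; have hM' := sum_inv_sqr_nat M.+1.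
have i0 n : 0 <= 4 / n.+1%:R :> R by rewrite divr_ge0.
have iotaE : iota 0 M = index_iota 0 M by rewrite /index_iota subn0.
rewrite big_cat !big_map /= iotaE !big_mkord.
have -> : 8 = 4 + 4 :> R by ring.
apply: lerD; first by apply: le_trans hM _; rewrite lerBlDr lerDl.
(* Negative frequencies start at -1; the term of index 0 is prepended in order to reuse the bound
   for naturals. *)
apply: le_trans (_ : \sum_(i < M.+1) (1 + i%:R ^+ 2)^-1 <= 4); last first.
  by apply: le_trans hM' _; rewrite lerBlDr lerDl.
rewrite big_ord_recl; apply: ler_wpDl; first by rewrite invr_ge0 addr_ge0// sqr_ge0.
apply: ler_sum => i _; rewrite /f NegzE mulrNz sqrrN.
by rewrite lift0.
Qed.

End integer_sums.

Section eigenvalues.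
Variable R : realType.
Variables (eta gamma : R).
Hypotheses (heta : 0 < eta) (hgamma : 4^-1 <= gamma).

Definition frequency_eigenvalue (k : int) : R :=
  4 * k%:~R ^+ 2 * pi ^+ 2 - 16 * k%:~R ^+ 4 * pi ^+ 4 - eta.

(** At k = 0 the eigenvalue is -eta, and eta^(-gamma) in the maximum compensates eta^gamma. For
    other k, minus the eigenvalue is at least k^4 >= 1, so its power gamma >= 1/4 is at least |k|,
    and 1 + k^2 <= 2 k^2. *)
Lemma frequency_le (k : int) :
  1 + k%:~R ^+ 2 <= 2 * Num.max 1 (eta `^ (- gamma)) ^+ 2 *
    ((- frequency_eigenvalue k) `^ gamma) ^+ 2.
Proof.
set m := Num.max _ _; have m1 : 1 <= m by rewrite le_max lexx.
have [->|k0] := eqVneq k 0.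
  rewrite /frequency_eigenvalue !expr0n /= !mulr0 !mul0r subrr sub0r opprK addr0.
  have e0 : 0 < eta `^ gamma by exact: powR_gt0.
  have em : 1 <= m * eta `^ gamma.
    rewrite -[leLHS](mulVf (lt0r_neq0 e0)) ler_wpM2r ?(ltW e0)// -powRN.
    by rewrite le_max lexx orbT.
  nra.
pose x : R := k%:~R ^+ 2; pose q : R := pi ^+ 2.
have x1 : 1 <= x.
  have : 1 <= k ^+ 2 by rewrite -gtz0_ge1 exprn_even_gt0.
  by rewrite -(ler_int R) rmorphXn.
have q4 : 4 <= q by have := pi_ge2 R; rewrite /q; nra.
pose a := - frequency_eigenvalue k.
have ax : x ^+ 2 <= a.
  have -> : a = 16 * (q * x) ^+ 2 - 4 * (q * x) + eta.
    by rewrite /a /frequency_eigenvalue /q /x; ring.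
  have h : 4 <= q * x by nra.
  have hx : x <= q * x by nra.
  move: (q * x) h hx => z h hx; clearbody x; have h1 : x ^+ 2 <= z ^+ 2 by nra.
  have h2 : 4 * z <= z ^+ 2 by nra.
  by have e0 : 0 < eta := heta; have z2 := sqr_ge0 z; lra.
have a1 : 1 <= a by nra.
have a0 : 0 <= a by lra.
pose b := a `^ 4^-1.
have b0 : 0 <= b by exact: powR_ge0.
have b4 : b ^+ 4 = a by rewrite -powR_mulrn// -powRrM mulVf// powRr1.
have bg : b <= a `^ gamma by exact: ler_powR.
have bx : x <= b ^+ 2.
  rewrite -ler_sqr ?nnegrE ?sqr_ge0// ?(le_trans ler01)//.
  by rewrite (_ : (b ^+ 2) ^+ 2 = b ^+ 4) ?b4// -exprM.
rewrite -/a -/x; move: (a `^ gamma) bg => L bL.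
have b2 : b ^+ 2 <= L ^+ 2 by nra.
have m2 : 1 <= m ^+ 2 by nra.
have L2 : L ^+ 2 <= m ^+ 2 * L ^+ 2 by have := sqr_ge0 L; nra.
lra.
Qed.

End eigenvalues.

(** * The Burgers drift on the range of a finite projection *)

Section burgers.
Variable R : realType.
Local Notation U := (L2 R).
Local Notation mu := (mu01 R).
Variable e : int -> U.
Hypothesis he : forall k, (e k : R -> R) = trig k %[ae mu].

Lemma inner_basis (v : U) k : inner (e k) v = \int[mu]_x (trig k x * v x).
Proof. exact (@inner_ael _ _ v _ (trigpoly_measurable (trigpoly_trig R k)) (he k)). Qed.

(** A basis vector different from all e_k would be orthogonal to the whole trigonometric system,
    hence zero by completeness, against its norm 1. *)
Lemma basis_eq_trig (H HH : set U) h : orthonormal_basis HH H ->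
  (forall k, HH (e k)) -> HH h -> exists k, e k = h.
Proof.
move=> [_ oHH _] eHH hHH; apply: contrapT => ne.
have h0 : h = 0.
  apply: trig_complete => k; have := oHH _ _ (eHH k) hHH.
  have -> : (e k == h) = false by apply/eqP => ek; apply: ne; exists k.
  move=> /= ekh; transitivity (inner (e k) h) => //.
  by rewrite inner_basis; apply: eq_Rintegral => x _; rewrite mulrC.
have := oHH _ _ hHH hHH; rewrite eqxx h0 inner0l => /esym/eqP.
by rewrite oner_eq0.
Qed.

Variables (H : set U) (HH : set U) (kap : U -> int) (projH : U -> U) (I : {fset U}).
Hypothesis hH : closed_subspace H.
Hypothesis hHH : orthonormal_basis HH H.
Hypothesis hkap : forall h, HH h -> e (kap h) = h.
Hypothesis hprojH : orthogonal_projection H projH.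
Hypothesis hI : [set` I] `<=` HH.

Lemma orthonormal_I : Defs.orthonormal [set` I].
Proof. by case: hHH => _ o _ u v /hI Hu /hI Hv; exact: o. Qed.

Lemma basis_sub h : h \in I -> H h.
Proof. by case: hHH => HHH _ _ hi; apply: HHH; exact: hI. Qed.

Lemma fproj_sub v : H (fproj I v).
Proof.
case: hH => H0 HZ _; rewrite /fproj big_seq; elim/big_ind : _ => //.
- by move=> u w Hu Hw; rewrite -[u]scale1r; exact: HZ.
- by move=> h hi; rewrite -[_ *: _]addr0; apply: HZ => //; exact: basis_sub.
Qed.

Lemma inner_projH p g : H p -> inner p (projH g) = inner p g.
Proof.
move=> Hp; have [_ /(_ p Hp)] := hprojH g.
by rewrite innerBl !(innerC _ p) => /eqP; rewrite subr_eq0 => /eqP.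
Qed.

(** The vector p lies in H, so |p|^2 = <p, projH g> = <p, g> <= |p| |g|. *)
Lemma norm_fproj_projH g : `|fproj I (projH g)| <= `|g|.
Proof.
set p := fproj I _.
have pg : `|p| ^+ 2 = inner p g.
  rewrite -inner_norm -[RHS](inner_projH _ (fproj_sub _)).
  by apply/esym; exact: inner_fproj_id orthonormal_I _ _.
have [p0|p0] := eqVneq `|p| 0; first by rewrite p0.
rewrite -(@ler_pM2l _ `|p|) ?lt0r ?p0//= -expr2 pg.
exact: le_trans (ler_norm _) (inner_cauchy_schwarz _ _).
Qed.

(** The smooth, everywhere defined representative of P_I w; [rep'] is its classical derivative. *)
Definition rep (w : U) : R -> R := trigsum I kap (fun h => inner h w).
Definition rep' (w : U) : R -> R := trigsum I (dfreq kap) (dcoef kap (fun h => inner h w)).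

Lemma trigpoly_rep w : trigpoly (rep w).
Proof. exact: trigpoly_trigsum. Qed.

Lemma trigpoly_rep' w : trigpoly (rep' w).
Proof. exact: trigpoly_trigsum. Qed.

Lemma sum_scale_ae (s : seq U) (c : U -> R) : {subset s <= I} ->
  ((\sum_(h <- s) c h *: h : U) : R -> R) = trigsum s kap c %[ae mu].
Proof.
have FF := ae_filter_ringOfSetsType mu.
elim: s => [_|h s IH sI].
  rewrite big_nil; apply: filterS (Lspace_0E mu (lee1n 2)) => x /(_ Logic.I) -> _.
  by rewrite /trigsum big_nil.
have hHH' : HH h by apply: hI; apply: sI; rewrite mem_head.
have {}IH := IH (fun k (ks : k \in s) => sI k (mem_behead (s := h :: s) ks)).
have e1 : {ae mu, forall x, (c h *: h : U) x = c h * trig (kap h) x}.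
  apply: (filterS2 _ _ (Lspace_scaleE (c h) h) (he (kap h))) => x.
  by rewrite (hkap hHH') => /(_ Logic.I) -> /(_ Logic.I) /= ->.
rewrite big_cons; have e2 := Lspace_addE (c h *: h) (\sum_(k <- s) c k *: k).
apply: (filterS3 _ _ e1 e2 IH) => x a1 /(_ Logic.I) a2 /(_ Logic.I) a3 _.
by rewrite a2 /= a1 a3 /trigsum big_cons.
Qed.

Lemma rep_ae w : w = fproj I w -> (w : R -> R) = rep w %[ae mu].
Proof.
move=> wE; have E x : (w : R -> R) x = (fproj I w : R -> R) x by rewrite {1}wE.
have FF := ae_filter_ringOfSetsType mu.
have h := sum_scale_ae (fun h => inner h w) (fun h (hI' : h \in I) => hI').
by apply: (filterS _ h) => x hx Tx; rewrite E; exact: hx.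
Qed.

Definition deriv_class w : U := L2_class (rep' w).

Lemma deriv_class_ae w : (deriv_class w : R -> R) = rep' w %[ae mu].
Proof. by apply: L2_classE; apply: trigpoly_Lfun2; exact: trigpoly_rep'. Qed.

(** Together with [fproj_ess_bounded], this puts the values of the scheme where the hypothesis on F
    supplies its explicit formula. *)
Lemma fproj_weak_derivative w : w = fproj I w -> weak_derivative w (deriv_class w).
Proof.
move=> wE phi tphi; have [smooth _] := tphi.
have cont (g : R -> R) : (forall x, derivable g x 1) -> continuous g.
  by move=> dg x; apply/differentiable_continuous/derivable1_diffP.
have m0 : measurable_fun setT (phi : measurableTypeR R -> R).
  by apply: continuous_measurable_fun; exact: cont (smooth 0).
have m1 : measurable_fun setT (derive1 phi : measurableTypeR R -> R).
  by apply: continuous_measurable_fun; exact: cont (smooth 1).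
have FF := ae_filter_ringOfSetsType mu.
have mul_ae (u f g : measurableTypeR R -> R) : measurable_fun setT u ->
    measurable_fun setT f -> measurable_fun setT g -> u = f %[ae mu] ->
    \int[mu]_x (u x * g x) = \int[mu]_x (f x * g x).
  move=> mu' mf mg uf; apply: Rintegral_ae_eq; try exact: measurable_funM.
  by apply: (filterS _ uf) => x /= /(_ Logic.I) ->.
rewrite (mul_ae _ _ _ (L2_measurable w) (trigpoly_measurable (trigpoly_rep w)) m1 (rep_ae wE)).
rewrite (mul_ae _ _ _ (L2_measurable (deriv_class w))
  (trigpoly_measurable (trigpoly_rep' w)) m0 (deriv_class_ae w)).
exact: trigsum_weak_derivative.
Qed.

Lemma fproj_ess_bounded w : w = fproj I w -> ess_bounded w.
Proof.
move=> wE; have [C fC] := trigpoly_bounded (trigpoly_rep w).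
rewrite /ess_bounded /finite_norm unlock; case: ifP => // _.
apply: (@le_lt_trans _ _ C%:E); last by rewrite ltry.
apply/ess_supP; have FF := ae_filter_ringOfSetsType mu.
by apply: (filterS _ (rep_ae wE)) => x /= /(_ Logic.I) ->; rewrite lee_fin.
Qed.

Variable eta : R.
Definition drift_class (w : U) : U :=
  L2_class (fun x => eta * w x - w x * deriv_class w x).

Lemma drift_ae (w : U) : w = fproj I w ->
  (fun x => eta * w x - w x * deriv_class w x) =
  (fun x => eta * rep w x - rep w x * rep' w x) %[ae mu].
Proof.
move=> wE; have FF := ae_filter_ringOfSetsType mu.
apply: (filterS2 _ _ (rep_ae wE) (deriv_class_ae w)) => x /(_ Logic.I) -> /(_ Logic.I) -> _.
by [].
Qed.

Lemma trigpoly_drift w : trigpoly (fun x => eta * rep w x - rep w x * rep' w x).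
Proof.
have t1 := trigpoly_scale eta (trigpoly_rep w).
have t2 := trigpoly_scale (-1) (trigpoly_mul (trigpoly_rep w) (trigpoly_rep' w)).
have := trigpoly_add t1 t2; congr trigpoly; apply/funext => x.
by rewrite mulN1r.
Qed.

Lemma drift_class_ae (w : U) : w = fproj I w ->
  (drift_class w : R -> R) =
  (fun x => eta * rep w x - rep w x * rep' w x) %[ae mu].
Proof.
move=> wE; have FF := ae_filter_ringOfSetsType mu.
have m1 : measurable_fun setT
    (fun x : measurableTypeR R => eta * w x - w x * deriv_class w x).
  apply: measurable_funB; first by apply: measurable_funM => //; exact: L2_measurable.
  by apply: measurable_funM; exact: L2_measurable.
have [C fC] := trigpoly_bounded (trigpoly_drift w).
have L : (fun x => eta * w x - w x * deriv_class w x) \in Lfun mu 2%:E.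
  apply: (@bounded_Lfun2 _ _ C) => //.
  by apply: (filterS _ (drift_ae wE)) => x /(_ Logic.I) ->.
apply: (filterS2 _ _ (L2_classE L) (drift_ae wE)) => x /(_ Logic.I) a1 /(_ Logic.I) a2 _.
by rewrite a1 a2.
Qed.

Lemma inner_drift p w : p = fproj I p -> w = fproj I w ->
  inner p (drift_class w) = eta * inner p w - \int[mu]_x (rep p x * (rep w x * rep' w x)).
Proof.
move=> pE wE.
rewrite (inner_ae (trigpoly_measurable (trigpoly_rep p))
  (trigpoly_measurable (trigpoly_drift w)) (rep_ae pE) (drift_class_ae wE)).
rewrite (inner_ae (trigpoly_measurable (trigpoly_rep p))
  (trigpoly_measurable (trigpoly_rep w)) (rep_ae pE) (rep_ae wE)).
have t1 := trigpoly_mul (trigpoly_rep p) (trigpoly_rep w).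
have t2 := trigpoly_mul (trigpoly_rep p) (trigpoly_mul (trigpoly_rep w) (trigpoly_rep' w)).
rewrite -RintegralZl//; last exact: trigpoly_integrable.
rewrite -RintegralB//; last 2 first.
- exact: trigpoly_integrable (trigpoly_scale eta t1).
- exact: trigpoly_integrable.
by apply: eq_Rintegral => x _; ring.
Qed.

Lemma inner_drift_self w : w = fproj I w ->
  inner w (drift_class w) = eta * `|w| ^+ 2.
Proof.
move=> wE; rewrite inner_drift// inner_norm -[RHS]subr0; congr (_ - _).
rewrite -[RHS](Rintegral_trigsum_sqr_deriv I kap (fun h => inner h w)).
by apply: eq_Rintegral => x _; rewrite mulrA expr2.
Qed.

(** A squared W^(1,2) norm of P_I w in terms of Fourier coefficients, up to the factor (2 pi)^2 on
    the derivative. *)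
Definition freq_norm (w : U) : R :=
  \sum_(h <- I) (1 + (kap h)%:~R ^+ 2) * inner h w ^+ 2.

Lemma freq_norm_ge0 w : 0 <= freq_norm w.
Proof.
by apply: sumr_ge0 => h _; rewrite mulr_ge0 ?sqr_ge0// addr_ge0// sqr_ge0.
Qed.

Lemma sum_freq_le : \sum_(h <- I) (1 + (kap h)%:~R ^+ 2)^-1 <= 8 :> R.
Proof.
rewrite -(big_map kap xpredT (fun k : int => (1 + k%:~R ^+ 2)^-1)).
apply: sum_inv_sqr_int; rewrite map_inj_in_uniq ?fset_uniq//.
by move=> h h' /hI hh /hI hh' /(congr1 e); rewrite !hkap.
Qed.

Lemma trig_sqr_le k (x : R) : trig k x ^+ 2 <= 2.
Proof.
have b (y : R) : `|y| <= 1 -> (Num.sqrt 2 * y) ^+ 2 <= 2.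
  move=> y1; rewrite exprMn sqr_sqrtr// -[leRHS]mulr1 ler_pM2l//.
  by rewrite -(real_normK (num_real y)) exprn_ile1.
case: k => [[|n]|n] /=; first by rewrite expr1n ler1n.
  by apply: b; exact: cos_max.
by apply: b; exact: sin_max.
Qed.

(** The embedding of W^(1,2) into L^oo: Cauchy-Schwarz with the weights 1 + k^2. The constant is 16
    = 2 * 8, from [trig_sqr_le] and [sum_freq_le]. *)
Lemma rep_sqr_le w x : rep w x ^+ 2 <= 16 * freq_norm w.
Proof.
pose s h : R := Num.sqrt (1 + (kap h)%:~R ^+ 2).
have s0 h : 0 < s h by rewrite sqrtr_gt0 ltr_pwDl// sqr_ge0.
have s2 h : s h ^+ 2 = 1 + (kap h)%:~R ^+ 2.
  by rewrite sqr_sqrtr// addr_ge0// sqr_ge0.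
rewrite /rep /trigsum (eq_bigr (fun h => (s h * inner h w) * (trig (kap h) x / s h))); last first.
  by move=> h _; field; rewrite gt_eqF.
apply: le_trans (sum_mul_cauchy_schwarz _ _ _) _.
rewrite mulrC; apply: ler_pM.
- by apply: sumr_ge0 => h _; exact: sqr_ge0.
- by apply: sumr_ge0 => h _; exact: sqr_ge0.
- have -> : 16 = 2 * 8 :> R by ring.
  apply: le_trans (_ : \sum_(h <- I) 2 * (1 + (kap h)%:~R ^+ 2)^-1 <= _); last first.
    by rewrite -mulr_sumr ler_pM2l//; exact: sum_freq_le.
  apply: ler_sum => h _; rewrite exprMn exprVn s2 ler_wpM2r ?trig_sqr_le//.
  by rewrite invr_ge0 addr_ge0// sqr_ge0.
- rewrite le_eqVlt; apply/orP; left; apply/eqP; apply: eq_bigr => h _.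
  by rewrite exprMn s2.
Qed.

Lemma Rintegral_rep'_sqr w : w = fproj I w ->
  \int[mu]_x (rep' w x ^+ 2) <= (2 * pi) ^+ 2 * freq_norm w.
Proof.
move=> wE; rewrite /rep' Rintegral_trigsum_deriv_sqr.
have hs := sum_scale_ae (fun h => (2 * pi * (kap h)%:~R) ^+ 2 * inner h w)
  (fun h (hi : h \in I) => hi).
rewrite -(inner_ae (trigpoly_measurable (trigpoly_rep w))
  (trigpoly_measurable (trigpoly_trigsum _ _ _)) (rep_ae wE) hs).
rewrite inner_sumr /freq_norm mulr_sumr; apply: ler_sum => h _.
rewrite innerZr (innerC w).
rewrite [leLHS](_ : _ = (2 * pi) ^+ 2 * ((kap h)%:~R ^+ 2 * inner h w ^+ 2)); last by ring.
by rewrite ler_wpM2l ?sqr_ge0// ler_wpM2r ?sqr_ge0// lerDr.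
Qed.

(** From (x + y)^2 <= 2 x^2 + 2 y^2; in w w' the factor w is bounded uniformly and w' in L2, each at
    the cost of one [freq_norm]. Hence the square of [freq_norm], and 32 = 2 * 16. *)
Lemma norm_drift_sqr w : w = fproj I w ->
  `|drift_class w| ^+ 2 <=
  2 * eta ^+ 2 * `|w| ^+ 2 + 32 * (2 * pi) ^+ 2 * freq_norm w ^+ 2.
Proof.
move=> wE; set D := freq_norm w; have D0 : 0 <= D by exact: freq_norm_ge0.
have td := trigpoly_drift w; have tr := trigpoly_rep w; have tr' := trigpoly_rep' w.
have t1 := trigpoly_mul td td.
have t2 := trigpoly_scale (2 * eta ^+ 2) (trigpoly_mul tr tr).
have t3 := trigpoly_scale (32 * D) (trigpoly_exp 2 tr').
rewrite -inner_norm (inner_ae (trigpoly_measurable td) (trigpoly_measurable td)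
  (drift_class_ae wE) (drift_class_ae wE)).
apply: (@le_trans _ _ (\int[mu]_x
    (2 * eta ^+ 2 * (rep w x * rep w x) + 32 * D * rep' w x ^+ 2))).
  apply: le_mu01_Rintegral.
  - exact: trigpoly_integrable t1.
  - exact: trigpoly_integrable (trigpoly_add t2 t3).
  - apply: aeW => x; have := rep_sqr_le w x; rewrite -/D.
    move: (rep w x) (rep' w x) => a b a2.
    apply: (@le_trans _ _ (2 * (eta * a) ^+ 2 + 2 * (a * b) ^+ 2)).
      by have := sqr_ge0 (eta * a + a * b); nra.
    by have := ler_wpM2r (sqr_ge0 b) a2; nra.
rewrite RintegralD//; [|exact: trigpoly_integrable..].
rewrite RintegralZl//; last exact: trigpoly_integrable (trigpoly_mul tr tr).
rewrite RintegralZl//; last exact: trigpoly_integrable (trigpoly_exp 2 tr').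
rewrite -inner_norm -(inner_ae (trigpoly_measurable tr) (trigpoly_measurable tr)
  (rep_ae wE) (rep_ae wE)) lerD2l.
apply: (@le_trans _ _ (32 * D * ((2 * pi) ^+ 2 * D))).
  by apply: ler_wpM2l; [rewrite mulr_ge0|exact: Rintegral_rep'_sqr].
by rewrite le_eqVlt; apply/orP; left; apply/eqP; ring.
Qed.

Lemma Rintegral_trigpoly_sum (T : Type) (s : seq T) (f : T -> R -> R) :
  (forall i, trigpoly (f i)) ->
  \int[mu]_x (\sum_(i <- s) f i x) = \sum_(i <- s) \int[mu]_x f i x.
Proof.
move=> tf; elim: s => [|i s IH].
  rewrite big_nil; transitivity (\int[mu]_x (0 * 0 : R)).
    by apply: eq_Rintegral => x _; rewrite big_nil mulr0.
  by rewrite RintegralZl ?mul0r//; exact: trigpoly_integrable (trigpoly_cst 0).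
rewrite big_cons -IH -RintegralD//.
- by apply: eq_Rintegral => x _; rewrite big_cons.
- exact: trigpoly_integrable (tf i).
- exact: trigpoly_integrable (trigpoly_sum s tf).
Qed.

(** Serves measurability: since [a] does not depend on w, a coordinate of the drift is a fixed
    quadratic polynomial in the coordinates of w. *)
Lemma inner_drift_coord p : p = fproj I p ->
  exists a : U -> U -> R, forall w, w = fproj I w ->
  inner p (drift_class w) =
  eta * inner p w - \sum_(h <- I) \sum_(h' <- I) a h h' * inner h w * inner h' w.
Proof.
move=> pE; exists (fun h h' => - (2 * pi * (kap h')%:~R) *
  \int[mu]_x (rep p x * (trig (kap h) x * trig (- kap h') x))) => w wE.
rewrite inner_drift//; congr (_ - _).
have t0 := trigpoly_rep p.
pose g (h h' : U) x :=
  - (2 * pi * (kap h')%:~R) * inner h w * inner h' w *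
    (rep p x * (trig (kap h) x * trig (- kap h') x)).
have tg0 h h' := trigpoly_mul t0
  (trigpoly_mul (trigpoly_trig R (kap h)) (trigpoly_trig R (- kap h'))).
have tg h h' : trigpoly (g h h') by exact: trigpoly_scale (tg0 h h').
transitivity (\int[mu]_x (\sum_(h <- I) \sum_(h' <- I) g h h' x)).
  apply: eq_Rintegral => x _; rewrite [rep w x]/trigsum [rep' w x]/trigsum.
  rewrite big_distrlr /= mulr_sumr; apply: eq_bigr => h _.
  by rewrite mulr_sumr; apply: eq_bigr => h' _; rewrite /g /dcoef /dfreq; ring.
rewrite Rintegral_trigpoly_sum; last by move=> h; exact: trigpoly_sum.
apply: eq_bigr => h _; rewrite Rintegral_trigpoly_sum//.
apply: eq_bigr => h' _; rewrite RintegralZl//; last exact: trigpoly_integrable (tg0 h h').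
by ring.
Qed.

End burgers.

(** * Functional calculus, truncation and noise *)

Section functional_calculus.
Variable R : realType.
Local Notation U := (L2 R).
Variables (B : set U) (lam : U -> R) (I : {fset U}).
Hypotheses (onB : Defs.orthonormal B) (IB : [set` I] `<=` B).

Let onI : Defs.orthonormal [set` I].
Proof. by move=> u v /IB Hu /IB Hv; exact: onB. Qed.

Definition fcalc_fin (phi : R -> R) (v : U) : U :=
  \sum_(h <- I) (phi (lam h) * inner h v) *: h.

(** Coordinates along basis vectors outside I vanish, so the net of partial sums is constant from I
    on. *)
Lemma fcalc_fproj phi v : v = fproj I v -> fcalc B lam phi v = fcalc_fin phi v.
Proof.
move=> vE; rewrite /fcalc.
have FF : ProperFilter (@totally U) := totally_filter.
apply/cvg_lim; first exact: norm_hausdorff.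
apply: cvg_near_cst; exists I => // J /= IJ.
have out h : B h -> h \notin I -> inner h v = 0.
  move=> Bh hI; rewrite vE inner_sumr big_seq big1// => k kI.
  rewrite innerZr (onB Bh (IB kI)).
  by case: eqP => [hk|]; [rewrite hk kI in hI|rewrite mulr0].
rewrite /fcalc_fin big_mkcond /= (big_fsetID _ (mem I)) /=.
rewrite [X in _ + X]big_seq_cond [X in _ + X]big1 ?addr0; last first.
  move=> h; rewrite andbT => /imfsetP[k /= /andP[kJ kI] ->].
  by case: ifP => // /set_mem Bk; rewrite (out k Bk kI)// mulr0 scale0r.
have -> : [fset x | x in J & x \in I]%fset = I.
  apply/fsetP => x; apply/imfsetP/idP => [[y /= /andP[_ yI] ->] //|xI].
  by exists x => //=; rewrite inE /= xI andbT (fsubsetP IJ).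
by apply: eq_big_seq => h hI; rewrite mem_set//; exact: IB.
Qed.

Lemma norm_fcalc_fin phi v :
  `|fcalc_fin phi v| ^+ 2 = \sum_(h <- I) phi (lam h) ^+ 2 * inner h v ^+ 2.
Proof.
rewrite (norm_sum_orthonormal onI (fun h => phi (lam h) * inner h v)).
by apply: eq_bigr => h _; rewrite exprMn.
Qed.

Lemma fcalc_finD phi u v : fcalc_fin phi (u + v) = fcalc_fin phi u + fcalc_fin phi v.
Proof.
rewrite /fcalc_fin -big_split /=; apply: eq_bigr => h _.
by rewrite innerDr mulrDr scalerDl.
Qed.

Lemma fcalc_finZ phi a v : fcalc_fin phi (a *: v) = a *: fcalc_fin phi v.
Proof.
rewrite /fcalc_fin scaler_sumr; apply: eq_bigr => h _.
by rewrite innerZr mulrCA scalerA.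
Qed.

Lemma fcalc_fin_sum phi (T : Type) (s : seq T) (f : T -> U) :
  fcalc_fin phi (\sum_(i <- s) f i) = \sum_(i <- s) fcalc_fin phi (f i).
Proof.
elim: s => [|i s IH]; last by rewrite !big_cons fcalc_finD IH.
by rewrite !big_nil -[X in fcalc_fin phi X](scale0r (0 : U)) fcalc_finZ scale0r.
Qed.

Lemma fproj_fprojD u v : u = fproj I u -> v = fproj I v -> u + v = fproj I (u + v).
Proof.
move=> uE vE; rewrite [in LHS]uE [in LHS]vE /fproj -big_split /=.
by apply: eq_bigr => h _; rewrite innerDr scalerDl.
Qed.

Lemma fproj_fprojZ a v : v = fproj I v -> a *: v = fproj I (a *: v).
Proof.
move=> vE; rewrite [in LHS]vE /fproj scaler_sumr.
by apply: eq_bigr => h _; rewrite innerZr scalerA.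
Qed.

Lemma norm_semigroup_fin (k t : R) v : 0 <= t -> (forall h, B h -> lam h <= - k) ->
  v = fproj I v ->
  `|fcalc_fin (fun l => expR (t * l)) v| ^+ 2 <= expR (- (2 * k * t)) * `|v| ^+ 2.
Proof.
move=> t0 lk vE; rewrite norm_fcalc_fin [in leRHS]vE norm_fproj// mulr_sumr.
rewrite !big_seq; apply: ler_sum => h hI; rewrite ler_wpM2r ?sqr_ge0//.
rewrite -expRM_natl ler_expR.
have h1 : t * lam h <= t * - k by apply: ler_wpM2l => //; exact: lk (IB hI).
by lra.
Qed.

Lemma Hs_fproj (H : set U) s v : H v -> v = fproj I v -> Hs B H lam s v.
Proof.
move=> Hv vE; split => //.
rewrite (esumID [set` I]); last first.
  by move=> h _; rewrite lee_fin mulr_ge0 ?sqr_ge0 ?powR_ge0.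
rewrite [X in (_ + X)%E]esum1 ?adde0; last first.
  move=> h [Bh /= /negP hI]; congr EFin.
  rewrite vE inner_sumr big_seq big1 ?normr0 ?expr0n ?mulr0//.
  move=> k kI; rewrite innerZr (onB Bh (IB kI)).
  by case: eqP => [hk|]; [rewrite hk kI in hI|rewrite mulr0].
have -> : B `&` [set` I] = [set` I] by apply/setIidPr.
rewrite esum_fset//.
rewrite -fsbig_seq ?fset_uniq// sumEFin ltry//.
Qed.

Lemma Hs_norm_fproj s v : v = fproj I v ->
  Hs_norm B lam s v ^+ 2 = \sum_(h <- I) ((- lam h) `^ s) ^+ 2 * inner h v ^+ 2.
Proof. by move=> vE; rewrite /Hs_norm fcalc_fproj// norm_fcalc_fin. Qed.

(** On the finite-dimensional range of P_I the H_s norm is dominated by the norm of H, with a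
    constant depending on I. This relates H_s-open sets to open sets of L2. *)
Lemma Hs_norm_fproj_le s v : v = fproj I v ->
  Hs_norm B lam s v <= (\sum_(h <- I) (- lam h) `^ s) * `|v|.
Proof.
move=> vE; rewrite /Hs_norm fcalc_fproj// mulr_suml.
apply: le_trans (ler_norm_sum _ _ _) _; rewrite !big_seq; apply: ler_sum => h hI.
have h1 : `|h| = 1.
  have := onI hI hI; rewrite eqxx inner_norm => /eqP.
  by rewrite sqrp_eq1// => /eqP.
rewrite normrZ h1 mulr1 normrM ger0_norm ?powR_ge0// ler_wpM2l ?powR_ge0//.
by apply: le_trans (inner_cauchy_schwarz _ _) _; rewrite h1 mul1r.
Qed.

End functional_calculus.

Lemma measurable_of_open d (T : measurableType d) (R : realType) (f : T -> R) :
  (forall O : set R, open O -> measurable (f @^-1` O)) -> measurable_fun setT f.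
Proof.
move=> fO mT; apply: (measurability _ (RGenOpens.measurableE R)) => //.
move=> _ [_ [a [b ->]] <-]; rewrite setTI; apply: fO.
exact: interval_open.
Qed.

(** * Measurability of the truncation *)

Section truncation.
Variables (d : measure_display) (Omega : measurableType d) (R : realType).
Local Notation U := (L2 R).
Variables (G : set (set Omega)) (X : Omega -> U).
Hypotheses (sG : sigma_algebra setT G) (mX : borel_measurable_wrt G X).

Lemma borel_comp_continuous (phi : U -> R) : continuous phi ->
  measurable_fun setT (phi \o X : g_sigma_algebraType G -> R).
Proof.
move=> cphi; apply: measurable_of_open => O oO.
rewrite (measurable_g_measurableTypeE sG).
by rewrite comp_preimage; apply: mX; apply: open_comp => // v _; exact: cphi.
Qed.

Lemma lipschitz_continuous (V W : normedModType R) (C : R) (phi : V -> W) :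
  0 <= C -> (forall v w, `|phi v - phi w| <= C * `|v - w|) -> continuous phi.
Proof.
move=> C0 lip v A /nbhs_ballP [r /= r0 rA].
(* The denominator is C + 1 because C may vanish. *)
have rC : 0 < r / (C + 1) by rewrite divr_gt0// ltr_wpDl.
suff : nbhs v (phi @^-1` A) by [].
apply/nbhs_ballP; exists (r / (C + 1)) => //= w; rewrite -ball_normE /= => vw.
apply: rA; rewrite -ball_normE /=; apply: le_lt_trans (lip _ _) _.
apply: (@le_lt_trans _ _ (C * (r / (C + 1)))); first by rewrite ler_wpM2l// ltW.
rewrite mulrCA gtr_pMr// ltr_pdivrMr ?mul1r ?ltrDl//.
by rewrite ltr_wpDl.
Qed.

Lemma continuous_inner (h : U) : continuous (inner h).
Proof.
apply: (@lipschitz_continuous _ _ `|h|) => // v w.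
by rewrite -innerBr; exact: inner_cauchy_schwarz.
Qed.

Lemma borel_inner (h : U) :
  measurable_fun setT ((fun om => inner h (X om)) : g_sigma_algebraType G -> R).
Proof. exact: borel_comp_continuous (@continuous_inner h). Qed.

Variables (B H : set U) (lam : U -> R) (I : {fset U}) (s : R).
Hypotheses (onB : Defs.orthonormal B) (IB : [set` I] `<=` B).
Hypothesis Hproj : forall v, H (fproj I v).
Hypothesis XE : forall om, X om = fproj I (X om).

(** X is measurable for the topology of L2, S for that of H_s. As X = P_I X, the preimage of an
    H_s-open set O equals that of the set of all v with P_I v in O, which is open in L2 by
    [Hs_norm_fproj_le]; the sets with preimage in G form a sigma-algebra. *)
Lemma Hs_borel_preimage S : Hs_borel B H lam s S -> G (X @^-1` S).
Proof.
have HsX v : Hs B H lam s (fproj I v).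
  apply: (Hs_fproj lam onB IB) => //; apply/esym/fproj_id => u w /IB Bu /IB Bw.
  exact: onB.
have [G0 GD GU] := sG.
apply: (@smallest_sub _ (sigma_algebra (Hs B H lam s)) _ [set S | G (X @^-1` S)]);
  first split.
- by rewrite /= preimage_set0.
- move=> A GA /=; rewrite (_ : X @^-1` _ = setT `\` X @^-1` A); first exact: GD.
  apply/seteqP; split => om /= [_ nA]; split => //.
  by rewrite XE; exact: HsX.
- by move=> F GF /=; rewrite preimage_bigcup; exact: GU.
move=> O [OHs oO] /=.
rewrite (_ : X @^-1` O = X @^-1` [set v | O (fproj I v)]); last first.
  by apply/seteqP; split=> om /=; rewrite -XE.
apply: mX; rewrite openE => v /= Ov; have [e e0 Oe] := oO _ Ov.
pose C := \sum_(h <- I) (- lam h) `^ s.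
have C0 : 0 <= C by apply: sumr_ge0 => h _; exact: powR_ge0.
have eC : 0 < e / (C + 1) by rewrite divr_gt0// ltr_wpDl.
apply/nbhs_ballP; exists (e / (C + 1)) => //= w; rewrite -ball_normE /= => vw.
apply: Oe; first exact: HsX.
have onI : Defs.orthonormal [set` I] by move=> u u' /IB Bu /IB Bw; exact: onB.
have dE : fproj I w - fproj I v = fproj I (w - v).
  rewrite /fproj -sumrB; apply: eq_bigr => h _.
  by rewrite innerBr scalerBl.
rewrite dE; apply: le_lt_trans (Hs_norm_fproj_le lam onB IB s _) _.
  by rewrite fproj_id.
apply: (@le_lt_trans _ _ (C * (e / (C + 1)))).
  rewrite ler_wpM2l//; apply: le_trans (norm_fproj_le onI _) _.
  by rewrite distrC ltW.
rewrite mulrCA gtr_pMr// ltr_pdivrMr ?mul1r ?ltrDl//.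
by rewrite ltr_wpDl.
Qed.

Lemma measurable_truncation (r : U -> R) (th : R) :
  (forall A : set R, measurable A -> Hs_borel B H lam s (Hs B H lam s `&` r @^-1` A)) ->
  measurable_fun setT
    ((fun om => if r (X om) <= th then 1 else 0) : g_sigma_algebraType G -> R).
Proof.
move=> mr.
have HsX v : Hs B H lam s (fproj I v).
  apply: (Hs_fproj lam onB IB) => //; apply/esym/fproj_id => u w /IB Bu /IB Bw.
  exact: onB.
have mth : G [set om | r (X om) <= th].
  have := Hs_borel_preimage (mr `]-oo, th]%classic (measurable_itv _)).
  congr G; apply/seteqP; split => [om /= [_]|om /=]; first by rewrite in_itv.
  by move=> h; split; [rewrite XE; exact: HsX|rewrite in_itv].
have mi : measurable_fun setT
    (\1_[set om | r (X om) <= th] : g_sigma_algebraType G -> R).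
  by apply: measurable_indic; rewrite (measurable_g_measurableTypeE sG).
rewrite (_ : (fun om => _) = \1_[set om | r (X om) <= th])//; apply/funext => om.
by rewrite indicE; case: ifP => h; [rewrite mem_set|rewrite memNset//= h].
Qed.

End truncation.

(** * The multiplicative noise *)

Section multiplication_noise.
Variable R : realType.
Local Notation U := (L2 R).
Local Notation mu := (mu01 R).
Variables (b : R -> R -> R) (C : R).
Hypothesis hbm : measurable_fun ((`]0, 1[%classic : set R) `*` [set: R])
  (fun z : R * R => b z.1 z.2).
Hypothesis C0 : 0 <= C.
Hypothesis b_bounded : forall x y, 0 < x < 1 -> `|b x y| <= C.
Hypothesis b_lipschitz : forall x y z, 0 < x < 1 ->
  `|b x y - b x z| <= C * `|y - z|.

Lemma Lspace_subE (u v : U) (f g : R -> R) :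
  (u : R -> R) = f %[ae mu] -> (v : R -> R) = g %[ae mu] ->
  ((u - v : U) : R -> R) = (fun x => f x - g x) %[ae mu].
Proof.
move=> uf vg; have FF := ae_filter_ringOfSetsType mu.
have N : {ae mu, forall x, (- v : U) x = - v x}.
  rewrite -scaleN1r; apply: (filterS _ (Lspace_scaleE (-1) v)) => x /(_ Logic.I) ->.
  by rewrite /= /GRing.scale /= mulN1r.
apply: (filterS3 _ _ (Lspace_addE u (- v)) N (filterI uf vg)).
by move=> x /(_ Logic.I) -> /= -> [/(_ Logic.I) -> /(_ Logic.I) ->] _.
Qed.

Lemma ae_integrable (f g : measurableTypeR R -> R) : measurable_fun setT g ->
  {ae mu, forall x, f x = g x} -> mu.-integrable setT (EFin \o f) ->
  mu.-integrable setT (EFin \o g).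
Proof.
move=> mg fg /integrableP[mf fi]; apply/integrableP; split; first exact/measurable_EFinP.
have FF := ae_filter_ringOfSetsType mu.
rewrite (_ : (\int[mu]_x _)%E = (\int[mu]_x `|(EFin \o f) x|)%E)//.
apply: ge0_ae_eq_integral => //.
- by apply: measurableT_comp => //; exact/measurable_EFinP.
- exact: measurableT_comp.
- by apply: (filterS _ fg) => x /= ->.
Qed.

Lemma L2_class_ae_eq (f g : R -> R) : f = g %[ae mu] -> L2_class f = L2_class g.
Proof.
move=> fg; rewrite /L2_class; congr xget; apply/seteqP.
have FF := ae_filter_ringOfSetsType mu.
split => w wf; apply: (filterS2 _ _ wf fg) => x /= /(_ Logic.I) h1 /(_ Logic.I) h2 _.
  by rewrite h1.
by rewrite h1.
Qed.

(** Cut off outside (0, 1), as measurability and bounds of b are available only for x in that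
    interval. *)
Definition nemytskii (w : U) : measurableTypeR R -> R :=
  (fun x : R => b x (w x)) \_ `]0, 1[%classic.

Lemma nemytskiiE w x : 0 < x < 1 -> nemytskii w x = b x (w x).
Proof. by move=> x01; rewrite /nemytskii patchE mem_set// /= in_itv. Qed.

Lemma nemytskii_ae w : nemytskii w = (fun x => b x (w x)) %[ae mu].
Proof.
have FF := ae_filter_ringOfSetsType mu.
by apply: (filterS _ (@ae_mu01 R)) => x x01 _; exact: nemytskiiE.
Qed.

Lemma nemytskii_measurable w : measurable_fun setT (nemytskii w).
Proof.
have m01 : measurable (`]0, 1[%classic : set (measurableTypeR R)) by [].
apply/(measurable_restrictT _ m01).
have mi : measurable_fun setT (fun x : measurableTypeR R => x : R) by exact: measurable_id.
have mp := measurable_fun_pair mi (L2_measurable w).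
have mp' : measurable_fun (`]0, 1[%classic : set (measurableTypeR R))
    (fun x : measurableTypeR R => ((x : R), w x)) by exact: measurable_funTS.
apply: (measurable_comp _ _ hbm mp') => //; first exact: measurableX.
by move=> _ [x x01 <-].
Qed.

Lemma nemytskii_bounded w : {ae mu, forall x, `|nemytskii w x| <= C}.
Proof.
have FF := ae_filter_ringOfSetsType mu.
by apply: (filterS _ (@ae_mu01 R)) => x x01; rewrite nemytskiiE//; exact: b_bounded.
Qed.

Lemma nemytskii_Lfun2 w : nemytskii w \in Lfun mu 2%:E.
Proof. exact: bounded_Lfun2 (nemytskii_measurable w) (nemytskii_bounded w). Qed.

Lemma nemytskiiM_Lfun2 (w s : U) : (fun x => nemytskii w x * s x) \in Lfun mu 2%:E.
Proof.
exact: Lfun2_bounded_mul (Lspace_Lfun s) (nemytskii_measurable w) (nemytskii_bounded w).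
Qed.

Lemma noise_classE (w s : U) :
  L2_class (fun x => b x (w x) * s x) = L2_class (fun x => nemytskii w x * s x).
Proof.
apply: L2_class_ae_eq; have FF := ae_filter_ringOfSetsType mu.
by apply: (filterS _ (nemytskii_ae w)) => x /(_ Logic.I) ->.
Qed.

Lemma norm_noise_class (w s : U) M : (forall x y, 0 < x < 1 -> `|b x y| ^+ 2 <= M) ->
  `|L2_class (fun x => b x (w x) * s x) : U| ^+ 2 <= M * `|s| ^+ 2.
Proof.
move=> bM; rewrite noise_classE.
rewrite -[X in _ * X]Rintegral_sqr -RintegralZl//; last exact: Lfun2_integrable_sqr (Lspace_Lfun s).
apply: (norm_class_sqr_le (nemytskiiM_Lfun2 w s)).
  rewrite (_ : EFin \o _ = (fun x => M%:E * (s x ^+ 2)%:E)%E); last by apply/funext.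
  by apply: integrableZl => //; exact: Lfun2_integrable_sqr (Lspace_Lfun s).
have FF := ae_filter_ringOfSetsType mu.
apply: (filterS _ (@ae_mu01 R)) => x x01; rewrite nemytskiiE// exprMn.
by rewrite ler_wpM2r ?sqr_ge0// -(real_normK (num_real _)) bM.
Qed.

Lemma nemytskii_lipschitz (v w : U) :
  `|L2_class (nemytskii v) - L2_class (nemytskii w) : U| <= C * `|v - w|.
Proof.
rewrite -ler_sqr ?nnegrE ?mulr_ge0// exprMn -!inner_norm.
have FF := ae_filter_ringOfSetsType mu.
have ae1 : ((L2_class (nemytskii v) - L2_class (nemytskii w) : U) : R -> R) =
    (fun x => nemytskii v x - nemytskii w x) %[ae mu].
  exact: Lspace_subE (L2_classE (nemytskii_Lfun2 v)) (L2_classE (nemytskii_Lfun2 w)).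
have ae2 : ((v - w : U) : R -> R) = (fun x => v x - w x) %[ae mu].
  exact: Lspace_subE (ae_eq_refl _ _ _) (ae_eq_refl _ _ _).
have m1 : measurable_fun setT (fun x : measurableTypeR R => nemytskii v x - nemytskii w x).
  by apply: measurable_funB; exact: nemytskii_measurable.
have m2 : measurable_fun setT (fun x : measurableTypeR R => v x - w x).
  by apply: measurable_funB; exact: L2_measurable.
have iN : mu.-integrable setT (EFin \o (fun x =>
    (nemytskii v x - nemytskii w x) * (nemytskii v x - nemytskii w x))).
  have := L2M_integrable (L2_class (nemytskii v) - L2_class (nemytskii w))
    (L2_class (nemytskii v) - L2_class (nemytskii w)).
  apply: ae_integrable; first by apply: measurable_funM.
  by apply: (filterS _ ae1) => x /(_ Logic.I) ->.
have iW : mu.-integrable setT (EFin \o (fun x => (v x - w x) * (v x - w x))).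
  have := L2M_integrable (v - w) (v - w).
  apply: ae_integrable; first by apply: measurable_funM.
  by apply: (filterS _ ae2) => x /(_ Logic.I) ->.
rewrite (inner_ae m1 m1 ae1 ae1) (inner_ae m2 m2 ae2 ae2).
rewrite -RintegralZl//; apply: le_mu01_Rintegral => //.
  rewrite (_ : EFin \o _ =
    (fun x => (C ^+ 2)%:E * ((v x - w x) * (v x - w x))%:E)%E); last by apply/funext.
  exact: integrableZl.
apply: (filterS _ (@ae_mu01 R)) => x x01; rewrite !nemytskiiE// -!expr2 -exprMn.
rewrite -(real_normK (num_real (b x (v x) - _))).
rewrite -(real_normK (num_real (C * _))) lerXn2r ?nnegrE// normrM (ger0_norm C0).
exact: b_lipschitz.
Qed.

(** The factor s is only square integrable. Moving it onto the bounded [trig k] leaves w inside the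
    Nemytskii operator alone, which is Lipschitz on L2; so each coordinate of the noise is
    continuous in w. *)
Lemma noise_coord (h s w : U) (k : int) : (h : R -> R) = trig k %[ae mu] ->
  inner h (L2_class (fun x => b x (w x) * s x)) =
  inner (L2_class (nemytskii w)) (L2_class (fun x => trig k x * s x)).
Proof.
move=> hk; have tk := trigpoly_measurable (trigpoly_trig R k).
have [K trigK] := trigpoly_bounded (trigpoly_trig R k).
have Lt : (fun x => trig k x * s x) \in Lfun mu 2%:E.
  by apply: (Lfun2_bounded_mul (Lspace_Lfun s) tk); exact: aeW.
rewrite noise_classE (inner_ae tk (Lfun2_measurable (nemytskiiM_Lfun2 w s)) hk
  (L2_classE (nemytskiiM_Lfun2 w s))).
rewrite (inner_ae (nemytskii_measurable w) (Lfun2_measurable Lt)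
  (L2_classE (nemytskii_Lfun2 w)) (L2_classE Lt)).
by apply: eq_Rintegral => x _; rewrite mulrCA.
Qed.

Lemma continuous_noise_coord (g : U) :
  continuous (fun w => inner (L2_class (nemytskii w)) g).
Proof.
apply: (@lipschitz_continuous _ _ _ (C * `|g|)); first by rewrite mulr_ge0.
move=> v w; rewrite -innerBl; apply: le_trans (inner_cauchy_schwarz _ _) _.
by rewrite mulrAC ler_wpM2r// nemytskii_lipschitz.
Qed.

End multiplication_noise.

(** * One step of the scheme *)

Ltac nonneg := repeat first [ done | exact: ltW | exact: sqr_ge0
  | exact: expR_ge0 | exact: powR_ge0 | apply: exprn_ge0 | apply: divr_ge0 | apply: mulr_ge0
  | apply: addr_ge0 ].

Section step_exponent.
Variable R : realType.

(** Squared, the claim is e^(2 x) (1 - x) >= 1, and (1 + 2 x) (1 - x) = 1 + x (1 - 2 x) >= 1. *)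
Lemma inv_sqrt_le (x : R) : 0 <= x -> x <= 2^-1 -> (Num.sqrt (1 - x))^-1 <= expR x.
Proof.
move=> x0 x1; have D0 : 0 < 1 - x by lra.
have s0 : 0 < Num.sqrt (1 - x) by rewrite sqrtr_gt0.
rewrite invf_ple ?posrE ?expR_gt0// -expRN.
rewrite -(ger0_norm (expR_ge0 (- x))) -sqrtr_sqr ler_wsqrtr//.
have h := expR_ge1Dx (2 * x).
have e : expR (- x) ^+ 2 = (expR (2 * x))^-1.
  by rewrite -expRM_natl mulrN expRN.
rewrite e -[leLHS]mul1r ler_pdivrMr ?expR_gt0//.
apply: (@le_trans _ _ ((1 - x) * (1 + 2 * x))); first by nra.
by rewrite ler_wpM2l// ltW.
Qed.

Variables (eps eta vt k T C1 C2 K : R).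

(** The constant in |v|^2 = O(q). Here h^2 |F|^2 <= C2 h (h q^2) is at most T K C2, and q >= 1. *)
Definition increment_constant : R := (1 + 2 * T * eta) * C1 + T * K * C2.
(* The first summand pays for the large values of a h vt (see below) and for
   the denominators 1 - 2 a h vt, the next two for 2 a h vt itself by Young's
   inequality against 2 k h n^2, and the last for the term h^2 |F|^2 of n^2. *)
Definition step_rate : R :=
  80 * vt ^+ 2 * eps ^+ 3 * (1 + increment_constant) ^+ 2 * K + 2 * vt * eps +
  eps * vt ^+ 2 / (2 * k) + eps * (C2 * K).

Variables (h q y2 f2 n rho' : R).
Hypotheses (eps0 : 0 < eps) (eta0 : 0 < eta) (vt0 : 0 <= vt) (k0 : 0 < k)
  (C10 : 0 <= C1) (C20 : 0 <= C2) (K0 : 0 <= K) (h0 : 0 < h) (hT : h <= T)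
  (q1 : 1 <= q) (hq : h * q ^+ 2 <= K) (y20 : 0 <= y2) (f20 : 0 <= f2)
  (y2q : y2 <= C1 * q) (f2q : f2 <= C2 * q ^+ 2) (n0 : 0 <= n)
  (n2 : n ^+ 2 = (1 + 2 * h * eta) * y2 + h ^+ 2 * f2)
  (rho'0 : 0 < rho') (rho'e : rho' <= eps).

(** The weights: [rho'] at tau, [rho] at t, [rt] after the contraction of the semigroup has been
    used, and [a] in front of |Z|^2. The variables [y2], [f2], [n] stand for |Y_tau|^2, |P_I F|^2
    and |v|. *)
Let rho := rho' * expR (- (2 * (eta + eps * vt) * h)).
Let rt := rho * expR (- (2 * k * h)).
Let a := rt * (1 + n).

Let T0 : 0 < T. Proof. exact: lt_le_trans hT. Qed.

Let rt0 : 0 < rt. Proof. by rewrite /rt /rho !mulr_gt0 ?expR_gt0. Qed.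

Let rt_rho : rt <= rho.
Proof.
rewrite /rt ger_pMr; last by rewrite /rho mulr_gt0 ?expR_gt0.
by rewrite -expR0 ler_expR oppr_le0 !mulr_ge0// ltW.
Qed.

Let rho_rho' : rho <= rho'.
Proof.
rewrite /rho ger_pMr// -expR0 ler_expR oppr_le0 mulr_ge0 ?(ltW h0)//.
by rewrite mulr_ge0// addr_ge0 ?mulr_ge0 ?(ltW eta0) ?(ltW eps0).
Qed.

Let rt_eps : rt <= eps.
Proof. exact: le_trans rt_rho (le_trans rho_rho' rho'e). Qed.

Let increment_constant_ge0 : 0 <= increment_constant.
Proof.
rewrite /increment_constant addr_ge0 ?mulr_ge0 ?(ltW T0)//.
by rewrite addr_ge0 ?mulr_ge0 ?(ltW T0) ?(ltW eta0).
Qed.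

Let n2_le : n ^+ 2 <= increment_constant * q.
Proof.
have h0' := h0; have hT' := hT; have q1' := q1; have C20' := C20; have K0' := K0.
have C10' := C10; have y20' := y20; have eta0' := eta0; have T0' := T0.
rewrite n2 /increment_constant [leRHS]mulrDl; apply: lerD.
  rewrite -[leRHS]mulrA; apply: ler_pM => //; first by nra.
  by rewrite lerD2l; nra.
apply: (@le_trans _ _ (h ^+ 2 * (C2 * q ^+ 2))).
  by rewrite ler_wpM2l ?sqr_ge0.
have -> : h ^+ 2 * (C2 * q ^+ 2) = h * (h * q ^+ 2) * C2 by ring.
apply: (@le_trans _ _ (T * K * C2 * 1)); last by rewrite ler_wpM2l ?mulr_ge0 ?(ltW T0).
rewrite mulr1 ler_wpM2r// ler_pM ?(ltW h0)//.
by rewrite mulr_ge0 ?(ltW h0)// sqr_ge0.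
Qed.

Let h2q2 : h ^+ 2 * q ^+ 2 <= h * K.
Proof.
have -> : h ^+ 2 * q ^+ 2 = h * (h * q ^+ 2) by ring.
by rewrite ler_wpM2l ?(ltW h0).
Qed.

Let n1_le : 1 + n <= 2 * (1 + increment_constant) * q.
Proof.
have n2' := n2_le; have q1' := q1; have c3 := increment_constant_ge0; have n0' := n0.
have : 1 + n <= 2 * (1 + n ^+ 2) by nra.
nra.
Qed.

Let n12_le : (1 + n) ^+ 2 <= 2 * (1 + increment_constant) * q.
Proof.
have n2' := n2_le; have q1' := q1; have c3 := increment_constant_ge0.
have : (1 + n) ^+ 2 <= 2 * (1 + n ^+ 2) by have := sqr_ge0 (1 - n); nra.
nra.
Qed.

(** Both 1 + n and (1 + n)^2 are O(q), since n^2 is; so the cube is only O(q^2), and h^2 q^2 <= K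
    h. *)
Let cube_le : h ^+ 2 * (1 + n) ^+ 3 <= 4 * (1 + increment_constant) ^+ 2 * K * h.
Proof.
have h3 : (1 + n) ^+ 3 <= (2 * (1 + increment_constant) * q) * (2 * (1 + increment_constant) * q).
  by rewrite exprS ler_pM ?sqr_ge0 ?addr_ge0.
apply: (@le_trans _ _ (h ^+ 2 *
    ((2 * (1 + increment_constant) * q) * (2 * (1 + increment_constant) * q)))).
  by rewrite ler_wpM2l ?sqr_ge0.
have -> : h ^+ 2 * (2 * (1 + increment_constant) * q * (2 * (1 + increment_constant) * q)) =
  4 * (1 + increment_constant) ^+ 2 * (h ^+ 2 * q ^+ 2) by ring.
rewrite -[leRHS]mulrA [K * h]mulrC ler_wpM2l// mulr_ge0// sqr_ge0//.
Qed.

(** The decay factors in [rt] are spent here: the last factor on the left is at most e^(2 h vt eps +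
    2 k h), which cancels two of them, and the remaining e^(-2 eta h) cancels the growth of n^2 due
    to the linear part of the drift. *)
Let main_le : rt * n ^+ 2 * (1 + 2 * h * vt * rt + 2 * k * h) <=
  rho' * y2 + eps * (C2 * K) * h.
Proof.
have e1 : 1 + 2 * h * vt * rt + 2 * k * h <= expR (2 * h * vt * eps + 2 * k * h).
  apply: le_trans (expR_ge1Dx _); rewrite addrA lerD2r lerD2l.
  by rewrite ler_wpM2l// !mulr_ge0 ?(ltW h0).
apply: (@le_trans _ _ (rt * n ^+ 2 * expR (2 * h * vt * eps + 2 * k * h))).
  by rewrite ler_wpM2l// mulr_ge0 ?sqr_ge0// ltW.
have -> : rt * n ^+ 2 * expR (2 * h * vt * eps + 2 * k * h) =
    rho' * expR (- (2 * eta * h)) * n ^+ 2.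
  have assoc (r A B E m : R) : r * A * B * m * E = r * (A * B * E) * m by ring.
  by rewrite /rt /rho assoc -!expRD; congr (_ * expR _ * _); ring.
have e2 : n ^+ 2 <= expR (2 * eta * h) * y2 + h * K * C2.
  rewrite n2; apply: lerD.
    by rewrite ler_wpM2r//; apply: le_trans (expR_ge1Dx _); rewrite mulrAC.
  apply: (@le_trans _ _ (h ^+ 2 * q ^+ 2 * C2)); last by rewrite ler_wpM2r.
  by rewrite -mulrA ler_wpM2l ?sqr_ge0// mulrC.
apply: le_trans (ler_wpM2l _ e2) _; first by rewrite mulr_ge0 ?expR_ge0// ltW.
rewrite mulrDr; apply: lerD.
  by rewrite mulrA -[_ * _ * expR _]mulrA -expRD addNr expR0 mulr1.
have -> : eps * (C2 * K) * h = eps * (h * K * C2) by ring.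
rewrite ler_wpM2r ?mulr_ge0 ?(ltW h0)//; apply: le_trans rho'e.
by rewrite ger_pMr// -expR0 ler_expR oppr_le0 !mulr_ge0 ?(ltW eta0) ?(ltW h0).
Qed.

Let eps3_le : rt ^+ 3 <= eps ^+ 3.
Proof. by rewrite lerXn2r ?nnegrE ?(ltW eps0) ?(ltW rt0). Qed.

Lemma step_exponent_small : 4 * a * h * vt <= 1 ->
  2 * a * h * vt + rt * n ^+ 2 + rt ^+ 2 * n ^+ 2 * (2 * h * vt / (1 - 2 * a * h * vt))
  <= rho' * y2 + step_rate * h.
Proof.
move=> small; set x := 2 * a * h * vt.
have a0 : 0 <= a by rewrite /a mulr_ge0 ?(ltW rt0)// addr_ge0.
have x0 : 0 <= x.
  by rewrite /x; apply: mulr_ge0 => //; apply: mulr_ge0; [exact: mulr_ge0|exact: ltW].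
have x1 : x <= 2^-1 by rewrite /x; lra.
have D0 : 0 < 1 - x by lra.
have inv : (1 - x)^-1 <= 1 + 2 * x.
  by rewrite -[leLHS]mul1r ler_pdivrMr//; nra.
(* The leading part w of the second-order term goes into [main_le]; the excess 2 x w, due to the
   denominator 1 - x, is cubic in 1 + n and falls under [cube_le]. *)
set w := rt ^+ 2 * n ^+ 2 * (2 * h * vt).
have w0 : 0 <= w by rewrite /w; nonneg.
have e1 : rt ^+ 2 * n ^+ 2 * (2 * h * vt / (1 - x)) <= w * (1 + 2 * x).
  by rewrite mulrA ler_wpM2l.
have e2 : w * (2 * x) <= 32 * vt ^+ 2 * eps ^+ 3 * (1 + increment_constant) ^+ 2 * K * h.
  have -> : w * (2 * x) = 8 * vt ^+ 2 * rt ^+ 3 * (h ^+ 2 * (n ^+ 2 * (1 + n))).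
    by rewrite /w /x /a; ring.
  have -> : 32 * vt ^+ 2 * eps ^+ 3 * (1 + increment_constant) ^+ 2 * K * h =
    8 * vt ^+ 2 * eps ^+ 3 * (4 * (1 + increment_constant) ^+ 2 * K * h) by ring.
  apply: ler_pM.
  - by nonneg.
  - by nonneg.
  - by apply: ler_wpM2l => //; nonneg.
  - apply: le_trans cube_le; rewrite ler_wpM2l ?sqr_ge0// [(1 + n) ^+ 3]exprSr.
    rewrite ler_wpM2r ?addr_ge0// lerXn2r ?nnegrE ?addr_ge0//.
    by rewrite lerDr.
have young : 2 * vt * n <= 2 * k * n ^+ 2 + vt ^+ 2 / (2 * k).
  have -> : 2 * k * n ^+ 2 + vt ^+ 2 / (2 * k) =
      2 * vt * n + (2 * k * n - vt) ^+ 2 / (2 * k).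
    by field; rewrite gt_eqF.
  by rewrite lerDl; nonneg.
have e3 : x <= rt * n ^+ 2 * (2 * k * h) + 2 * vt * eps * h +
    eps * vt ^+ 2 / (2 * k) * h.
  have -> : x = rt * h * (2 * vt * n) + 2 * vt * h * rt by rewrite /x /a; ring.
  apply: (@le_trans _ _ (rt * h * (2 * k * n ^+ 2 + vt ^+ 2 / (2 * k)) +
    2 * vt * h * eps)).
    apply: lerD; first by apply: ler_wpM2l => //; nonneg.
    by apply: ler_wpM2l => //; nonneg.
  have kk : 0 <= vt ^+ 2 / (2 * k) by nonneg.
  have := ler_wpM2r (mulr_ge0 (ltW h0) kk) rt_eps.
  have -> : eps * vt ^+ 2 / (2 * k) * h = eps * (h * (vt ^+ 2 / (2 * k))) by ring.
  lra.
have m := main_le.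
have P0 : 0 <= 48 * vt ^+ 2 * eps ^+ 3 * (1 + increment_constant) ^+ 2 * K * h.
  by nonneg.
have wE : w = rt * n ^+ 2 * (2 * h * vt * rt) by rewrite /w; ring.
(* The leading constant 80 of [step_rate] is split as 32 + 48 here and as 64 + 16 when [a] is large,
   where 64 is asked for. *)
have -> : step_rate * h = 32 * vt ^+ 2 * eps ^+ 3 * (1 + increment_constant) ^+ 2 * K * h +
  48 * vt ^+ 2 * eps ^+ 3 * (1 + increment_constant) ^+ 2 * K * h + 2 * vt * eps * h +
  eps * vt ^+ 2 / (2 * k) * h + eps * (C2 * K) * h by rewrite /step_rate; ring.
rewrite mulrDr mulr1 in e1; rewrite !mulrDr mulr1 -wE in m.
lra.
Qed.

(** Here 1 < (4 a h vt)^2, so a <= 16 vt^2 h^2 a^3 is O(h) by [cube_le]; and the terms rt (n + 1/4)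
    are at most a. *)
Lemma step_exponent_large : 1 < 4 * a * h * vt ->
  rt * (n ^+ 2 + n + 4^-1) <= rho' * y2 + step_rate * h.
Proof.
move=> large; have a0 : 0 <= a by rewrite /a mulr_ge0 ?(ltW rt0)// addr_ge0.
have e1 : a <= 64 * vt ^+ 2 * eps ^+ 3 * (1 + increment_constant) ^+ 2 * K * h.
  apply: (@le_trans _ _ (a * (4 * a * h * vt) ^+ 2)).
    by rewrite ler_peMr// exprn_ege1// ltW.
  have -> : a * (4 * a * h * vt) ^+ 2 =
    16 * vt ^+ 2 * rt ^+ 3 * (h ^+ 2 * (1 + n) ^+ 3) by rewrite /a; ring.
  have -> : 64 * vt ^+ 2 * eps ^+ 3 * (1 + increment_constant) ^+ 2 * K * h =
    16 * vt ^+ 2 * eps ^+ 3 * (4 * (1 + increment_constant) ^+ 2 * K * h) by ring.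
  apply: ler_pM => //.
  - by nonneg.
  - by nonneg.
  - by apply: ler_wpM2l => //; nonneg.
have m := main_le.
have e2 : rt * n ^+ 2 <= rho' * y2 + eps * (C2 * K) * h.
  apply: le_trans m; apply: ler_peMr; first by nonneg.
  by rewrite -addrA lerDl; nonneg.
have e3 : rt * (n ^+ 2 + n + 4^-1) <= rt * n ^+ 2 + a.
  by rewrite /a -mulrDr ler_pM2l//; lra.
have P0 : 0 <= 16 * vt ^+ 2 * eps ^+ 3 * (1 + increment_constant) ^+ 2 * K * h.
  by nonneg.
have P1 : 0 <= 2 * vt * eps * h by nonneg.
have P2 : 0 <= eps * vt ^+ 2 / (2 * k) * h.
  by nonneg.
have -> : step_rate * h = 64 * vt ^+ 2 * eps ^+ 3 * (1 + increment_constant) ^+ 2 * K * h +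
  16 * vt ^+ 2 * eps ^+ 3 * (1 + increment_constant) ^+ 2 * K * h + 2 * vt * eps * h +
  eps * vt ^+ 2 / (2 * k) * h + eps * (C2 * K) * h by rewrite /step_rate; ring.
lra.
Qed.

End step_exponent.

(** * Pointwise bounds for the tamed increment *)

Section tamed_increment.
Variables (R : realType) (V : Type) (I : seq V) (v z : V -> R) (n : R).
Hypotheses (n0 : 0 <= n) (n2 : n ^+ 2 = \sum_(i <- I) v i ^+ 2).
Let zz := \sum_(i <- I) z i ^+ 2.
Let p := \sum_(i <- I) v i * z i.
Let t := Num.sqrt zz.
Let s := (1 + zz)^-1.

Let zz0 : 0 <= zz. Proof. by apply: sumr_ge0 => i _; exact: sqr_ge0. Qed.

Let tt : t ^+ 2 = zz. Proof. exact: sqr_sqrtr. Qed.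

Let t0 : 0 <= t. Proof. exact: sqrtr_ge0. Qed.

Let p_le : `|p| <= n * t.
Proof.
rewrite -ler_sqr ?nnegrE ?mulr_ge0// real_normK ?num_real// exprMn tt n2.
exact: sum_mul_cauchy_schwarz.
Qed.

Let s0 : 0 < s. Proof. by rewrite invr_gt0 ltr_pwDl. Qed.

Let sE : s * (1 + t ^+ 2) = 1.
Proof. by rewrite tt mulVf// gt_eqF// ltr_pwDl. Qed.

Let st : 2 * (s * t) <= 1.
Proof.
have h1 := sE; have h2 := s0; have h3 := sqr_ge0 (1 - t).
have : s * (1 - t) ^+ 2 >= 0 by apply: mulr_ge0 => //; exact: ltW.
nra.
Qed.

Let expand : \sum_(i <- I) (v i + s * z i) ^+ 2 = n ^+ 2 + 2 * s * p + s ^+ 2 * zz.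
Proof.
rewrite n2 /p /zz !mulr_sumr -!big_split /=; apply: eq_bigr => i _; ring.
Qed.

(* Since 1 - s = s |z|^2 and 2 s |z| <= 1, replacing s <v, z> by <v, z> costs at
   most |v| |z|^2 / 2. *)
Lemma tamed_increment_le :
  \sum_(i <- I) (v i + s * z i) ^+ 2 <= n ^+ 2 + 2 * p + (1 + n) * zz.
Proof.
rewrite expand -!addrA lerD2l -tt.
have s1 : s <= 1 by rewrite invf_le1 ?lerDl// ltr_pwDl.
have h1 : 2 * (s - 1) * p <= n * t ^+ 2.
  have -> : s - 1 = - (s * t ^+ 2) by have h := sE; rewrite -{1}h; ring.
  apply: le_trans (ler_norm _) _.
  rewrite !normrM normrN (ger0_norm (mulr_ge0 (ltW s0) (sqr_ge0 t))) normr_nat.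
  apply: (@le_trans _ _ (2 * (s * t ^+ 2) * (n * t))).
    apply: ler_wpM2l; last exact: p_le.
    by rewrite !mulr_ge0 ?sqr_ge0// ltW.
  have -> : 2 * (s * t ^+ 2) * (n * t) = (2 * (s * t)) * (n * t ^+ 2) by ring.
  by apply: ler_piMl; [rewrite mulr_ge0// sqr_ge0|exact: st].
have h2 : s ^+ 2 * t ^+ 2 <= t ^+ 2.
  by apply: ler_piMl; [exact: sqr_ge0|rewrite exprn_ile1// ltW].
lra.
Qed.

(** As 2 s |z| <= 1, the tamed increment has norm at most 1/2: the cross term is at most n and the
    square at most 1/4. *)
Lemma tamed_increment_bounded :
  \sum_(i <- I) (v i + s * z i) ^+ 2 <= n ^+ 2 + n + 4^-1.
Proof.
rewrite expand -!addrA lerD2l -tt; apply: lerD.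
  apply: le_trans (ler_norm _) _.
  rewrite normrM normrM (ger0_norm (ltW s0)) normr_nat.
  apply: (@le_trans _ _ (2 * s * (n * t))).
    by apply: ler_wpM2l; [rewrite mulr_ge0// ltW|exact: p_le].
  have -> : 2 * s * (n * t) = (2 * (s * t)) * n by ring.
  by apply: ler_piMl => //; exact: st.
have st0 : 0 <= s * t by rewrite mulr_ge0// ltW.
by rewrite -exprMn; have := st; nra.
Qed.

End tamed_increment.

(** * Exponential moment of one step, in coordinates *)

Section step_expectation.
Context d (Omega : measurableType d) (R : realType) (P : probability Omega R).
Variables (U V : choiceType) (G : set (set Omega)) (I : seq V) (J : seq U).
Variables (X : U -> Omega -> R) (b : U -> V -> Omega -> R).
Variables (y f : V -> Omega -> R) (chi : Omega -> bool) (Z : Omega -> R).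
Variables (eps eta vt k T C1 C2 K h q rho' : R).

Let yy om := \sum_(i <- I) y i om ^+ 2.
Let ff om := \sum_(i <- I) f i om ^+ 2.
Let v i om := y i om + h * f i om.
Let W i om := \sum_(u <- J) X u om * b u i om.
Let ww om := \sum_(i <- I) W i om ^+ 2.
Let n om := Num.sqrt (\sum_(i <- I) v i om ^+ 2).
Let rho := rho' * expR (- (2 * (eta + eps * vt) * h)).
Let rt := rho * expR (- (2 * k * h)).
Let a om := rt * (1 + n om).
Let E0 om := rho' * yy om + step_rate eps eta vt k T C1 C2 K * h.

Hypotheses (eps0 : 0 < eps) (eta0 : 0 < eta) (vt0 : 0 <= vt) (k0 : 0 < k)
  (C10 : 0 <= C1) (C20 : 0 <= C2) (K0 : 0 <= K) (h0 : 0 < h) (hT : h <= T)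
  (q1 : 1 <= q) (hq : h * q ^+ 2 <= K)
  (rho'0 : 0 < rho') (rho'e : rho' <= eps).
Hypotheses (sG : sigma_algebra setT G) (Gm : G `<=` measurable) (uJ : uniq J)
  (mX : forall u, u \in J -> measurable_fun setT (X u))
  (ind : independent_normal P G h X J).
Hypotheses
  (mchi : measurable_fun setT
    ((fun om => if chi om then 1 else 0) : g_sigma_algebraType G -> R))
  (my : forall i, measurable_fun setT (y i : g_sigma_algebraType G -> R))
  (mf : forall i, measurable_fun setT (f i : g_sigma_algebraType G -> R))
  (mb : forall u i, measurable_fun setT (b u i : g_sigma_algebraType G -> R))
  (mZ : measurable_fun setT Z).
Hypotheses (b_vt : forall om, \sum_(u <- J) \sum_(i <- I) b u i om ^+ 2 <= vt)
  (yq : forall om, chi om -> yy om <= C1 * q)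
  (fq : forall om, chi om -> ff om <= C2 * q ^+ 2)
  (yf : forall om, chi om -> \sum_(i <- I) y i om * f i om = eta * yy om)
  (ZE : {ae P, forall om, Z om <= expR (- (2 * k * h)) *
     (if chi om then \sum_(i <- I) (v i om + (1 + ww om)^-1 * W i om) ^+ 2
      else yy om)}).

Let yy0 om : 0 <= yy om. Proof. by apply: sumr_ge0 => i _; exact: sqr_ge0. Qed.
Let ff0 om : 0 <= ff om. Proof. by apply: sumr_ge0 => i _; exact: sqr_ge0. Qed.
Let n0 om : 0 <= n om. Proof. exact: sqrtr_ge0. Qed.
Let nv om : n om ^+ 2 = \sum_(i <- I) v i om ^+ 2.
Proof. by rewrite sqr_sqrtr// sumr_ge0// => i _; exact: sqr_ge0. Qed.

Let n2 om : chi om -> n om ^+ 2 = (1 + 2 * h * eta) * yy om + h ^+ 2 * ff om.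
Proof.
move=> c; rewrite nv; transitivity (yy om + 2 * h * (\sum_(i <- I) y i om * f i om) +
    h ^+ 2 * ff om); last by rewrite yf//; ring.
rewrite /yy /ff !mulr_sumr -!big_split /=; apply: eq_bigr => i _.
by rewrite /v; ring.
Qed.

Let rt0 : 0 < rt. Proof. by rewrite /rt /rho !mulr_gt0 ?expR_gt0. Qed.

Let a0 om : 0 < a om. Proof. by rewrite /a mulr_gt0// ltr_pwDl. Qed.

(* A is the event on which the Gaussian expectation is finite with a uniform
   margin; the indicator IA makes the weights vanish outside of it. *)
Let A om : bool := chi om && (4 * a om * h * vt <= 1).
Let IA om : R := if A om then 1 else 0.
Let aA om := IA om * a om.
Let zA i om := IA om * (rt / a om * v i om).
Let KA om := IA om * expR (rt * n om ^+ 2 - rt ^+ 2 * n om ^+ 2 / a om).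
Let S om := \sum_(u <- J) \sum_(i <- I) b u i om ^+ 2.
Let D om := 1 - 2 * aA om * (h * S om).

Let large om : chi om -> ~~ A om -> 1 < 4 * a om * h * vt.
Proof. by move=> c; rewrite /A c /= -ltNge. Qed.

Let S0 om : 0 <= S om.
Proof. by apply: sumr_ge0 => u _; apply: sumr_ge0 => i _; exact: sqr_ge0. Qed.

Let step_rate_ge0 : 0 <= step_rate eps eta vt k T C1 C2 K.
Proof. by rewrite /step_rate; nonneg. Qed.

(** On A the bound [tamed_increment_le] is completed to a square: a |(rt / a) v + W|^2 plus the
    past-measurable remainder rt n^2 - rt^2 n^2 / a, which [KA] collects. Off A, either the
    truncation is inactive and [step_exponent_large] applies, or the step is a mere contraction. *)
Let pointwise om :
  Z om <= expR (- (2 * k * h)) *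
     (if chi om then \sum_(i <- I) (v i om + (1 + ww om)^-1 * W i om) ^+ 2
      else yy om) ->
  expR (rho * Z om) <= (1 - IA om) * expR (E0 om) +
    KA om * expR (aA om * \sum_(i <- I) (zA i om + W i om) ^+ 2).
Proof.
move=> Zle.
have rho0 : 0 <= rho by rewrite /rho; nonneg.
have {}Zle := ler_wpM2l rho0 Zle; rewrite mulrA -/rt in Zle.
have rt_rho' : rt <= rho'.
  rewrite /rt /rho -mulrA -expRD ger_pMr// -expR0 ler_expR -opprD oppr_le0.
  by nonneg.
case: (boolP (A om)) => Aom.
  have c : chi om by case/andP: Aom.
  rewrite /KA /aA /zA /IA Aom subrr mul0r add0r !mul1r -expRD ler_expR.
  apply: le_trans Zle _; rewrite c.
  apply: le_trans (ler_wpM2l (ltW rt0) (tamed_increment_le (W^~ om) (n0 om) (nv om))) _.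
  have ane : a om != 0 by rewrite gt_eqF.
  have -> : \sum_(i <- I) (1 * (rt / a om * v i om) + W i om) ^+ 2 =
      (rt / a om) ^+ 2 * n om ^+ 2 + 2 * (rt / a om) * (\sum_(i <- I) v i om * W i om) + ww om.
    rewrite nv !mulr_sumr /ww -!big_split /=; apply: eq_bigr => i _.
    by rewrite mul1r; ring.
  rewrite le_eqVlt; apply/orP; left; apply/eqP; rewrite -/(ww om).
  rewrite [X in _ = _ + X]mulrDr [X in _ = _ + (X + _)]mulrDr.
  have -> : a om * ((rt / a om) ^+ 2 * n om ^+ 2) = rt ^+ 2 * n om ^+ 2 / a om.
    by field.
  have -> : a om * (2 * (rt / a om) * (\sum_(i <- I) v i om * W i om)) =
    2 * rt * (\sum_(i <- I) v i om * W i om) by field.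
  by rewrite /a; ring.
rewrite /KA /IA (negbTE Aom) subr0 mul1r !mul0r addr0 ler_expR.
apply: le_trans Zle _; case: ifP => [c|_].
  apply: le_trans (ler_wpM2l (ltW rt0) (tamed_increment_bounded (W^~ om) (n0 om) (nv om))) _.
  exact: (step_exponent_large eps0 eta0 vt0 k0 C10 C20 K0 h0 hT q1 hq (yy0 om)
    (yq c) (fq c) (n0 om) (n2 c) rho'0 rho'e (large c Aom)).
rewrite /E0 -[leLHS]addr0 lerD//; last by rewrite mulr_ge0// ltW.
by rewrite ler_wpM2r.
Qed.

Let aA_vt om : A om -> 4 * a om * h * vt <= 1.
Proof. by case/andP. Qed.

Let aA0 om : 0 <= aA om.
Proof. by rewrite /aA /IA; case: ifP => _; rewrite ?mul1r ?mul0r// ltW. Qed.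

Let D_vt om : A om -> 1 - 2 * a om * h * vt <= D om.
Proof.
move=> Aom; rewrite /D /aA /IA Aom mul1r lerD2l lerN2 -[_ * h * vt]mulrA.
apply: ler_wpM2l; first by rewrite mulr_ge0// ltW.
by apply: ler_wpM2l (b_vt om); exact: ltW.
Qed.

Let D0 om : 0 < D om.
Proof.
case: (boolP (A om)) => Aom; last by rewrite /D /aA /IA (negbTE Aom) mul0r mulr0 mul0r subr0.
by apply: lt_le_trans (D_vt Aom); have := aA_vt Aom; lra.
Qed.

(** After replacing D by its lower bound [D1], the remainder in [KA] and the completed square
    combine to rt^2 n^2 (1 / D1 - 1) / a, which equals 2 h vt rt^2 n^2 / D1. The factor 1 / a is
    thereby removed and [step_exponent_small] applies. *)
Let gaussian_bound om :
  KA om / Num.sqrt (D om) * expR (aA om / D om * \sum_(i <- I) zA i om ^+ 2) <=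
  IA om * expR (E0 om).
Proof.
rewrite /KA; case: (boolP (A om)) => Aom; last by rewrite /IA (negbTE Aom) !mul0r.
have c : chi om by case/andP: Aom.
have smallA := aA_vt Aom; have DD := D_vt Aom; have D0' := D0 om.
have E := step_exponent_small eps0 eta0 vt0 k0 C10 C20 K0 h0 hT q1 hq (yy0 om)
  (yq c) (fq c) (n0 om) (n2 c) rho'0 rho'e smallA.
set D1 := 1 - 2 * a om * h * vt in DD *.
have D10 : 0 < D1 by rewrite /D1; lra.
have x0 : 0 <= 2 * a om * h * vt by have := ltW (a0 om) => ?; nonneg.
have -> : aA om / D om * \sum_(i <- I) zA i om ^+ 2 = rt ^+ 2 * n om ^+ 2 / a om / D om.
  have -> : \sum_(i <- I) zA i om ^+ 2 = (rt / a om) ^+ 2 * n om ^+ 2.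
    rewrite nv mulr_sumr; apply: eq_bigr => i _.
    by rewrite /zA /IA Aom mul1r exprMn.
  by rewrite /aA /IA Aom; field; rewrite !gt_eqF.
rewrite /IA Aom !mul1r.
apply: (@le_trans _ _ (expR (rt * n om ^+ 2 - rt ^+ 2 * n om ^+ 2 / a om) *
   expR (2 * a om * h * vt) * expR (rt ^+ 2 * n om ^+ 2 / a om / D1))).
  apply: ler_pM; rewrite ?expR_ge0//.
  - rewrite ler_wpM2l ?expR_ge0//.
    apply: le_trans (_ : (Num.sqrt D1)^-1 <= _).
      by rewrite lef_pV2 ?posrE ?sqrtr_gt0// ler_wsqrtr.
    by apply: inv_sqrt_le => //; lra.
  - rewrite ler_expR ler_wpM2l//; last by rewrite lef_pV2.
    by have := ltW (a0 om) => ?; nonneg.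
rewrite -!expRD ler_expR /E0; apply: le_trans E; rewrite -/rho -/rt -/(a om) -/D1.
rewrite le_eqVlt; apply/orP; left; apply/eqP.
have e1 : rt ^+ 2 * n om ^+ 2 / a om / D1 - rt ^+ 2 * n om ^+ 2 / a om =
    rt ^+ 2 * n om ^+ 2 * (2 * h * vt / D1).
  by rewrite /D1; field; rewrite !gt_eqF.
by rewrite -e1; ring.
Qed.

Local Notation GT := (g_sigma_algebraType G).

Let mv i : measurable_fun setT (v i : GT -> R).
Proof. by apply: measurable_funD (my i) _; exact: measurable_funM. Qed.

Let mn : measurable_fun setT (n : GT -> R).
Proof.
apply: measurable_fun_sqrt; apply: measurable_fun_sum => i.
by apply: measurable_funX; exact: mv.
Qed.

Let ma : measurable_fun setT (a : GT -> R).
Proof. by apply: measurable_funM => //; exact: measurable_funD. Qed.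

Let mIA : measurable_fun setT (IA : GT -> R).
Proof.
have -> : IA = (fun om => (if chi om then 1 else 0) *
    (if 4 * a om * h * vt <= 1 then 1 else 0)) :> (GT -> R).
  by apply/funext => om; rewrite /IA /A; case: (chi om) => /=; rewrite ?mul1r ?mul0r.
apply: (@measurable_funM _ GT) => //; apply: measurable_fun_ifT => //.
apply: measurable_fun_ler => //.
by do 2 apply: measurable_funM => //; exact: measurable_funM.
Qed.

Let maA : measurable_fun setT (aA : GT -> R).
Proof. exact: (@measurable_funM _ GT). Qed.

Let mquot (g : GT -> R) : measurable_fun setT g ->
  measurable_fun setT ((fun om => g om / a om) : GT -> R).
Proof.
move=> mg; apply: (@measurable_funM _ GT) => //.
exact: (@measurable_fun_invr _ GT).
Qed.

Let mzA i : measurable_fun setT (zA i : GT -> R).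
Proof.
apply: (@measurable_funM _ GT) => //; apply: (@measurable_funM _ GT); last exact: mv.
exact: mquot.
Qed.

Let mKA : measurable_fun setT (KA : GT -> R).
Proof.
apply: (@measurable_funM _ GT) => //; apply: (measurableT_comp (@measurable_expR R)).
apply: (@measurable_funB _ GT).
  by apply: (@measurable_funM _ GT) => //; exact: measurable_funX.
apply: mquot; apply: (@measurable_funM _ GT) => //; exact: measurable_funX.
Qed.

Let mE0 : measurable_fun setT (E0 : GT -> R).
Proof.
apply: (@measurable_funD _ GT) => //; apply: (@measurable_funM _ GT) => //.
by apply: (@measurable_fun_sum _ GT) => i; exact: measurable_funX.
Qed.

Lemma step_expectation :
  (\int[P]_om (expR (rho * Z om))%:E <=
   (expR (step_rate eps eta vt k T C1 C2 K * h))%:E *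
   \int[P]_om (expR (rho' * yy om))%:E)%E.
Proof.
have mG (g : Omega -> R) : measurable_fun setT (g : GT -> R) -> measurable_fun setT g.
  exact: measurable_fun_g_sigma_sub.
have IA01 om : 0 <= IA om <= 1 by rewrite /IA; case: ifP => _; rewrite lexx ler01.
have KA0 om : 0 <= KA om by rewrite /KA mulr_ge0 ?expR_ge0//; case/andP: (IA01 om).
have mbP u i : measurable_fun setT (b u i) by apply: mG; exact: mb.
have mW i : measurable_fun setT (W i).
  (* Measurability of [X u] is given for u in J only, hence the conditional summand. *)
  have -> : W i = fun om => \sum_(u <- J) if u \in J then X u om * b u i om else 0.
    by apply/funext => om; rewrite /W big_seq [RHS]big_seq; apply: eq_bigr => u ->.
  apply: measurable_fun_sum => u; case: (boolP (u \in J)) => [uJ'|_ //].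
  by apply: measurable_funM => //; exact: mX.
pose e1 om := (1 - IA om) * expR (E0 om).
pose e2 om := KA om * expR (aA om * \sum_(i <- I) (zA i om + W i om) ^+ 2).
have me1 : measurable_fun setT e1.
  apply: mG; apply: (@measurable_funM _ GT); first exact: (@measurable_funB _ GT).
  exact: (measurableT_comp (@measurable_expR R)).
have me2 : measurable_fun setT e2.
  apply: measurable_funM; first exact: mG.
  apply: (measurableT_comp (@measurable_expR R)); apply: measurable_funM; first exact: mG.
  apply: measurable_fun_sum => i; apply: measurable_funX.
  by apply: measurable_funD => //; apply: mG.
have e10 om : 0 <= e1 om by rewrite mulr_ge0 ?expR_ge0// subr_ge0; case/andP: (IA01 om).
have e20 om : 0 <= e2 om by rewrite mulr_ge0 ?expR_ge0.
apply: (@le_trans _ _ (\int[P]_om (e1 om + e2 om)%:E)%E).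
  apply: ae_ge0_le_integral => //.
  - apply/measurable_EFinP; apply: (measurableT_comp (@measurable_expR R)).
    exact: measurable_funM.
  - by move=> om _; rewrite lee_fin addr_ge0.
  - by apply/measurable_EFinP; exact: measurable_funD.
  - have FF := ae_filter_ringOfSetsType P.
    by apply: (filterS _ ZE) => om /pointwise le _; rewrite lee_fin.
under eq_integral do rewrite EFinD.
rewrite ge0_integralD//; last 4 first.
- by move=> om _; rewrite lee_fin.
- by apply/measurable_EFinP.
- by move=> om _; rewrite lee_fin.
- by apply/measurable_EFinP.
have mD : measurable_fun setT D.
  apply: mG; apply: (@measurable_funB _ GT) => //.
  apply: (@measurable_funM _ GT); first exact: (@measurable_funM _ GT).
  apply: (@measurable_funM _ GT) => //.
  apply: (@measurable_fun_sum _ GT) => u; apply: (@measurable_fun_sum _ GT) => i.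
  by apply: measurable_funX; exact: mb.
pose e3 om := KA om / Num.sqrt (D om) *
  expR (aA om / D om * \sum_(i <- I) zA i om ^+ 2).
have e30 om : 0 <= e3 om.
  by rewrite mulr_ge0 ?expR_ge0//; apply: divr_ge0 => //; exact: sqrtr_ge0.
have me3 : measurable_fun setT e3.
  apply: measurable_funM.
    apply: measurable_funM; first exact: mG.
    apply: measurable_fun_invr; first by move=> om; rewrite sqrtr_gt0.
    exact: measurable_fun_sqrt.
  apply: (measurableT_comp (@measurable_expR R)); apply: measurable_funM.
    by apply: measurable_funM; [exact: mG|exact: measurable_fun_invr].
  by apply: measurable_fun_sum => i; apply: measurable_funX; exact: mG.
have h1 : (\int[P]_om (e2 om)%:E <= \int[P]_om (e3 om)%:E)%E.
  exact: (expectation_expR_normal_vector (I := I) h0 uJ aA0 mX sG Gm ind KA0 mKA maA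
    mzA mb (D := D) (fun=> erefl) D0).
apply: le_trans (leeD2l (\int[P]_om (e1 om)%:E)%E h1) _.
rewrite -ge0_integralD//; last 4 first.
- by move=> om _; rewrite lee_fin.
- by apply/measurable_EFinP.
- by move=> om _; rewrite lee_fin.
- by apply/measurable_EFinP.
have myy : measurable_fun setT yy.
  by apply: measurable_fun_sum => i; apply: measurable_funX; exact: mG.
rewrite -ge0_integralZl_EFin ?expR_ge0//; last first.
  apply/measurable_EFinP; apply: (measurableT_comp (@measurable_expR R)).
  exact: measurable_funM.
apply: ge0_le_integral => //.
- by move=> om _; rewrite -EFinD lee_fin addr_ge0.
- by under eq_fun do rewrite -EFinD; apply/measurable_EFinP; exact: measurable_funD.
- under eq_fun do rewrite -EFinM; apply/measurable_EFinP; apply: measurable_funM => //.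
  by apply: (measurableT_comp (@measurable_expR R)); exact: measurable_funM.
move=> om _; rewrite -EFinD -EFinM lee_fin.
have -> : expR (step_rate eps eta vt k T C1 C2 K * h) * expR (rho' * yy om) =
    e1 om + IA om * expR (E0 om).
  by rewrite /e1 /E0 -expRD addrC; ring.
by rewrite lerD2l; exact: gaussian_bound.
Qed.

End step_expectation.

(** * Partitions and constants *)

Section partition_theory.
Variable R : realType.
Implicit Types (theta : {fset R}) (T t : R).

Lemma prev_pointP T theta t : partition_of T theta -> 0 < t ->
  [/\ prev_point theta t \in theta, 0 <= prev_point theta t, prev_point theta t < t
    & forall s, s \in theta -> s < t -> s <= prev_point theta t].
Proof.
move=> [bnd th0 thT] t0.
(* The default value 0 of the maximum is itself a grid point below t. *)
have [pth pt] : prev_point theta t \in theta /\ prev_point theta t < t.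
  rewrite /prev_point big_seq_cond; elim/big_ind : _ => //.
    by move=> x y [xth xt] [yth yt]; case: (leP x y).
  by move=> x /andP[].
split => //; first by case/andP: (bnd _ pth).
by move=> s sth st; rewrite /prev_point; apply: le_bigmax_seq.
Qed.

Lemma sub_prev_point_le_mesh T theta t : partition_of T theta -> 0 < t <= T ->
  t - prev_point theta t <= mesh theta.
Proof.
move=> pth /andP[t0 tT]; have [pm p0 pt pmax] := prev_pointP pth t0.
have [bnd th0 thT] := pth.
(* The first grid point from t on; the default T is itself one. The interval between
   [prev_point theta t] and [nx] is then one of the gaps that enter the mesh. *)
pose nx := \big[Num.min/T]_(s <- theta | t <= s) s.
have [nth nt] : nx \in theta /\ t <= nx.
  rewrite /nx big_seq_cond; elim/big_ind : _ => //.
    by move=> x y [xth xt] [yth yt]; case: (leP x y).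
  by move=> x /andP[].
have nmin s : s \in theta -> t <= s -> nx <= s.
  by move=> sth ts; exact: (ge_bigmin_seq _ s _ id sth).
apply: (@le_trans _ _ (nx - prev_point theta t)); first by rewrite lerD2r.
rewrite /mesh; apply: le_trans (le_bigmax_seq _ _ xpredT _ pm erefl).
apply: (le_bigmax_seq _ nx _ (fun b => b - prev_point theta t) nth).
rewrite (lt_le_trans pt nt) /=; apply/allP => s sth; apply/negP => /andP[ps sn].
have [st|ts] := ltP s t; first by have := pmax s sth st; rewrite leNgt ps.
by have := nmin s sth ts; rewrite leNgt sn.
Qed.

(** Induction on the number of grid points strictly below t. Passing to the previous point p lowers
    it, since p lies below t but not below itself; the exponents add up along the way. *)
Lemma partition_induction T theta (C : R) (f : R -> \bar R) :
  partition_of T theta ->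
  (forall t, 0 < t <= T ->
    (f t <= (expR (C * (t - prev_point theta t)))%:E * f (prev_point theta t))%E) ->
  forall t, 0 <= t <= T -> (f t <= (expR (C * t))%:E * f 0%R)%E.
Proof.
move=> pth step t; have [m] := ubnP (count (fun s => s < t) theta).
elim: m t => // m IH t cm /andP[]; rewrite le_eqVlt => /predU1P[<- _|t0 tT].
  by rewrite mulr0 expR0 mul1e.
have [pm p0 pt pmax] := prev_pointP pth t0; set p := prev_point theta t in pm p0 pt pmax *.
have stepT := step t; rewrite t0 tT in stepT; apply: le_trans (stepT isT) _; rewrite -/p.
have pT : 0 <= p <= T by rewrite p0 (le_trans (ltW pt)).
have cp : (count (fun s => (s < p)%R) theta < m)%N.
  rewrite -ltnS; apply: leq_trans cm; rewrite ltnS.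
  have := count_predUI (fun s => s < p) (pred1 p) theta.
  rewrite (@eq_count _ (predI _ _) pred0) ?count_pred0 ?addn0; last first.
    by move=> s /=; case: eqP => [->|]; rewrite ?ltxx ?andbF.
  have p1 : (0 < count (pred1 p) theta)%N by rewrite -has_count has_pred1.
  move=> eqn; apply: (@leq_trans (count (predU (fun s => s < p) (pred1 p)) theta)).
    by rewrite eqn -[X in (X < _)%N]addn0 ltn_add2l.
  by apply: sub_count => s /= /orP[sp|/eqP->//]; exact: lt_trans pt.
apply: le_trans (lee_wpmul2l _ (IH _ cp pT)) _; first by rewrite lee_fin expR_ge0.
by rewrite muleA -EFinM -expRD -mulrDr subrK.
Qed.

End partition_theory.

(** * One step of the scheme in L2 *)

Section scheme_step.
Context d (Omega : measurableType d) (R : realType) (P : probability Omega R).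
Local Notation U := (L2 R).
Variables (G G' : set (set Omega)) (B : set U) (lam : U -> R) (I J : {fset U}).
Variables (X : U -> Omega -> R) (f : U -> U) (g : U -> U -> U).
Variables (Y Y' : Omega -> U) (chi : Omega -> bool).
Variables (eps eta vt k T C1 C2 K h q rho' : R).
Hypotheses (onB : Defs.orthonormal B) (IB : [set` I] `<=` B)
  (lamk : forall h, B h -> lam h <= - k).
Hypotheses (eps0 : 0 < eps) (eta0 : 0 < eta) (vt0 : 0 <= vt) (k0 : 0 < k)
  (C10 : 0 <= C1) (C20 : 0 <= C2) (K0 : 0 <= K) (h0 : 0 < h) (hT : h <= T)
  (q1 : 1 <= q) (hq : h * q ^+ 2 <= K)
  (rho'0 : 0 < rho') (rho'e : rho' <= eps).
Hypotheses (sG : sigma_algebra setT G) (Gm : G `<=` measurable)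
  (sG' : sigma_algebra setT G') (G'm : G' `<=` measurable)
  (mX : forall u, u \in J -> measurable_fun setT (X u))
  (ind : independent_normal P G h X J).
Hypotheses (mY : borel_measurable_wrt G Y) (mY' : borel_measurable_wrt G' Y')
  (mchi : measurable_fun setT
    ((fun om => if chi om then 1 else 0) : g_sigma_algebraType G -> R))
  (mf : forall i, i \in I ->
    measurable_fun setT ((fun om => inner i (f (Y om))) : g_sigma_algebraType G -> R))
  (mg : forall u i, i \in I -> measurable_fun setT
    ((fun om => inner i (g (Y om) u)) : g_sigma_algebraType G -> R)).
Hypotheses (YI : forall om, Y om = fproj I (Y om)).
Hypotheses (g_vt : forall om, \sum_(u <- J) `|fproj I (g (Y om) u)| ^+ 2 <= vt)
  (Yq : forall om, chi om -> `|Y om| ^+ 2 <= C1 * q)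
  (fq : forall om, chi om -> `|fproj I (f (Y om))| ^+ 2 <= C2 * q ^+ 2)
  (Yf : forall om, chi om -> inner (Y om) (f (Y om)) = eta * `|Y om| ^+ 2).
Let chiR om : R := if chi om then 1 else 0.
Let sgrp := semigroup B lam h.
Hypothesis YE : {ae P, forall om, Y' om =
  sgrp (Y om + chiR om *: (h *: fproj I (f (Y om)))) +
  (1 + `|\sum_(u <- J) X u om *: fproj I (g (Y om) u)| ^+ 2)^-1 *:
  \sum_(u <- J) X u om *: sgrp (chiR om *: fproj I (g (Y om) u))}.

Let onI : Defs.orthonormal [set` I].
Proof. by move=> u v /IB Bu /IB Bv; exact: onB. Qed.

Let fproj_coord (v : U) i : inner i (fproj I v) =
  \sum_(l <- I) inner l v * inner i l.
Proof. by rewrite /fproj inner_sumr; apply: eq_bigr => l _; rewrite innerZr. Qed.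

(** [step_expectation] asks for measurable coordinates along every i; those outside I are
    combinations of the ones in I. *)
Let measurable_fproj_coord (v : Omega -> U) i :
  (forall l, l \in I ->
    measurable_fun setT ((fun om => inner l (v om)) : g_sigma_algebraType G -> R)) ->
  measurable_fun setT ((fun om => inner i (fproj I (v om))) : g_sigma_algebraType G -> R).
Proof.
move=> mv; pose w l om := if l \in I then inner l (v om) * inner i l else 0.
have -> : (fun om => inner i (fproj I (v om))) =
    (fun om => \sum_(l <- I) w l om) :> (g_sigma_algebraType G -> R).
  apply/funext => om; rewrite fproj_coord big_seq [RHS]big_seq.
  by apply: eq_bigr => l; rewrite /w => ->.
apply: measurable_fun_sum => l; rewrite /w; case: (boolP (l \in I)) => // lI.
by apply: measurable_funM => //; exact: mv.
Qed.

(** On the range of P_I the semigroup, defined by a limit, is the finite sum [E]. Its linearity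
    allows it to be pulled out of drift and noise together, and then it contracts. *)
Let step_norm (s : R) (y dy : U) (z : U -> U) (c : bool) om :
  y = fproj I y ->
  `|sgrp (y + (if c then 1 else 0) *: (h *: fproj I dy)) +
    s *: \sum_(u <- J) X u om *: sgrp ((if c then 1 else 0) *: fproj I (z u))| ^+ 2 <=
  expR (- (2 * k * h)) *
  `|y + (if c then 1 else 0) *: (h *: fproj I dy +
      s *: \sum_(u <- J) X u om *: fproj I (z u))| ^+ 2.
Proof.
move=> yE; set cR : R := if c then 1 else 0.
have pI v : fproj I v = fproj I (fproj I v) by rewrite fproj_id.
have pZ a v : v = fproj I v -> a *: v = fproj I (a *: v) by exact: fproj_fprojZ.
have pD u v : u = fproj I u -> v = fproj I v -> u + v = fproj I (u + v).
  exact: fproj_fprojD.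
have pS (F : U -> U) : (forall u, F u = fproj I (F u)) ->
    \sum_(u <- J) F u = fproj I (\sum_(u <- J) F u).
  move=> FE; elim/big_ind : _ => //.
    by rewrite /fproj big1// => i _; rewrite inner0r scale0r.
pose E v := fcalc_fin lam I (fun l => expR (h * l)) v.
have sE v : v = fproj I v -> sgrp v = E v by exact: fcalc_fproj.
rewrite sE; last by apply: (pD) => //; do 2 apply: (pZ); exact: pI.
have -> : \sum_(u <- J) X u om *: sgrp (cR *: fproj I (z u)) =
    E (cR *: \sum_(u <- J) X u om *: fproj I (z u)).
  rewrite /E fcalc_finZ fcalc_fin_sum scaler_sumr; apply: eq_bigr => u _.
  rewrite sE; last by apply: (pZ); exact: pI.
  by rewrite /E !fcalc_finZ !scalerA mulrC.
have EZ a v : a *: E v = E (a *: v) by rewrite /E fcalc_finZ.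
have ED u v : E u + E v = E (u + v) by rewrite /E fcalc_finD.
rewrite EZ ED [s *: (_ *: _)]scalerA [s * _]mulrC -scalerA -addrA -scalerDr.
apply: (norm_semigroup_fin onB IB (ltW h0) lamk).
apply: (pD) => //; apply: (pZ); apply: (pD); first by apply: (pZ); exact: pI.
by apply: (pZ); apply: pS => u; apply: (pZ); exact: pI.
Qed.

Lemma scheme_step :
  (\int[P]_om (expR (rho' * expR (- (2 * (eta + eps * vt) * h)) * `|Y' om| ^+ 2))%:E <=
   (expR (step_rate eps eta vt k T C1 C2 K * h))%:E *
   \int[P]_om (expR (rho' * `|Y om| ^+ 2))%:E)%E.
Proof.
have nE v : v = fproj I v -> `|v| ^+ 2 = \sum_(i <- I) inner i v ^+ 2.
  by move=> vE; rewrite [in LHS]vE norm_fproj.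
under [in leRHS]eq_integral do rewrite (nE _ (YI _)).
have := @step_expectation _ Omega R P U U G I J X
  (fun u i om => inner i (fproj I (g (Y om) u))) (fun i om => inner i (Y om))
  (fun i om => inner i (fproj I (f (Y om)))) chi (fun om => `|Y' om| ^+ 2)
  eps eta vt k T C1 C2 K h q rho'.
apply => //.
- by move=> i; exact: borel_inner.
- by move=> i; apply: measurable_fproj_coord => l; exact: mf.
- by move=> u i; apply: measurable_fproj_coord => l; exact: mg.
- apply: measurable_funX; apply: (measurable_fun_g_sigma_sub sG' G'm).
  by apply: borel_comp_continuous => //; exact: norm_continuous.
- move=> om; apply: le_trans (g_vt om); rewrite le_eqVlt; apply/orP; left; apply/eqP.
  by apply: eq_bigr => u _; rewrite nE// fproj_id.
- by move=> om c; rewrite -nE//; exact: Yq.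
- by move=> om c; rewrite -nE ?fproj_id//; exact: fq.
- move=> om c; rewrite -nE// -Yf// [in RHS]YI inner_fproj_id// -YI.
  rewrite [X in inner X _]YI /fproj inner_suml; apply: eq_bigr => i _.
  by rewrite innerZl.
have FF := ae_filter_ringOfSetsType P.
apply: (filterS _ YE) => om ->; apply: le_trans (step_norm _ _ _ _ _ (YI om)) _.
rewrite ler_wpM2l ?expR_ge0// le_eqVlt; apply/orP; left; apply/eqP.
case: ifP => c; last by rewrite scale0r addr0 nE.
rewrite scale1r; set z := \sum_(u <- J) _.
have pI v : fproj I v = fproj I (fproj I v) by rewrite fproj_id.
have zE : z = fproj I z.
  rewrite /z; elim/big_ind : _ => //.
  - by rewrite /fproj big1// => i _; rewrite inner0r scale0r.
  - by move=> u v; exact: fproj_fprojD.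
  - by move=> u _; apply: fproj_fprojZ; exact: pI.
rewrite nE; last first.
  apply: fproj_fprojD => //; apply: fproj_fprojD; first by apply: fproj_fprojZ; exact: pI.
  exact: fproj_fprojZ.
have zi i : inner i z = \sum_(u <- J) X u om * inner i (fproj I (g (Y om) u)).
  by rewrite /z inner_sumr; apply: eq_bigr => u _; rewrite innerZr.
have z2 : `|z| ^+ 2 = \sum_(i <- I) (\sum_(u <- J) X u om * inner i (fproj I (g (Y om) u))) ^+ 2.
  by rewrite nE//; apply: eq_bigr => i _; rewrite zi.
apply: eq_bigr => i _; congr (_ ^+ 2).
by rewrite !innerDr !innerZr addrA zi -z2.
Qed.

End scheme_step.

(** Since |S u|^2 = <u, S S u> = <u, Q u>, the sum is a partial sum of the trace. *)
Lemma sum_norm_sqrt_operator_le (R : realType) (B : set (L2 R)) (Q S : L2 R -> L2 R)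
    (J : {fset L2 R}) :
  nonneg_trace_class B Q -> is_sqrt_operator Q S -> [set` J] `<=` B ->
  \sum_(u <- J) `|S u| ^+ 2 <= fine (etrace B Q).
Proof.
move=> [[_ _ Q0] trQ] [[_ symS _] SS] JB.
have fin : etrace B Q \is a fin_num.
  by rewrite ge0_fin_numE//; apply: esum_ge0 => u _; rewrite lee_fin.
rewrite -lee_fin fineK// -sumEFin /etrace; apply: esum_ge; exists [set` J].
  by split => //; exact: finite_fset.
rewrite fsbig_seq ?fset_uniq// le_eqVlt; apply/orP; left; apply/eqP.
by apply: eq_fsbigr => u _; rewrite -inner_norm -symS SS.
Qed.

(** * Constants of the noise, the truncation and the drift *)

Section noise_constants.
Variables (R : realType) (b : R -> R -> R).
Hypothesis hb : (ereal_sup [set q | exists x y z : R, [/\ 0 < x < 1, z != y &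
  q = (`|b x y| + `|b x y - b x z| / `|y - z|)%:E]]%R < +oo)%E.

Lemma bounded_lipschitz_constant : exists2 C : R, 0 <= C &
  (forall x y, 0 < x < 1 -> `|b x y| <= C) /\
  (forall x y z, 0 < x < 1 -> `|b x y - b x z| <= C * `|y - z|).
Proof.
have Soo := hb; move: Soo; set S := ereal_sup _ => Soo.
have le x y z : 0 < x < 1 -> z != y ->
    ((`|b x y| + `|b x y - b x z| / `|y - z|)%:E <= S)%E.
  by move=> x01 zy; apply: ereal_sup_ubound; exists x, y, z.
have half : 0 < (2^-1 : R) < 1 by apply/andP; split; lra.
(* A second point, through which the bound on |b| is read off the supremum over pairs y, z. *)
have zy1 (y : R) : y + 1 != y by rewrite -subr_eq0 addrAC subrr add0r oner_eq0.
have S0 : (0 <= S)%E by apply: le_trans (le _ 0 _ half (zy1 0)); rewrite lee_fin addr_ge0.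
have Sf : S \is a fin_num by rewrite ge0_fin_numE.
exists (fine S); first exact: fine_ge0.
have {}le x y z : 0 < x < 1 -> z != y ->
    `|b x y| + `|b x y - b x z| / `|y - z| <= fine S.
  by move=> x01 zy; rewrite -lee_fin fineK//; exact: le.
split=> [x y x01|x y z x01].
  by apply: le_trans (le x y (y + 1) x01 (zy1 y)); rewrite lerDl divr_ge0.
have [->|zy] := eqVneq z y; first by rewrite subrr normr0 mulr_ge0 ?fine_ge0.
rewrite -ler_pdivrMr ?normr_gt0 ?subr_eq0 1?eq_sym//.
by apply: le_trans (le x y z x01 zy); rewrite lerDr.
Qed.

Lemma le_sup_sqr x y : 0 < x < 1 ->
  `|b x y| ^+ 2 <= sup [set q | exists x y : R, 0 < x < 1 /\ q = `|b x y| ^+ 2].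
Proof.
move=> x01; have [C C0 [bC _]] := bounded_lipschitz_constant.
apply: ub_le_sup; last by exists x, y.
by exists (C ^+ 2) => _ [x' [y' [x'01 ->]]]; rewrite lerXn2r ?nnegrE//; exact: bC.
Qed.

End noise_constants.

Section truncation_constants.
Variables (R : realType) (delta T h m : R).
Hypotheses (hdelta : 0 < delta < 18^-1) (h0 : 0 < h) (hT : h <= T) (hm : h <= m).

(** The truncation level q expressed by the step length h instead of the mesh, which is at least h.
    The maximum with 1 gives q >= 1 also for long steps. *)
Definition trunc_scale : R := Num.max 1 (h `^ (- delta)).

Lemma trunc_scale_ge1 : 1 <= trunc_scale.
Proof. by rewrite le_max lexx. Qed.

Lemma powR_mesh_le : m `^ (- delta) <= trunc_scale.
Proof.
rewrite le_max; apply/orP; right; rewrite !powRN lef_pV2 ?posrE ?powR_gt0//.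
  by apply: ge0_ler_powR; rewrite ?nnegrE ?(ltW h0)//; [case/andP: hdelta => /ltW|
    exact: ltW (lt_le_trans h0 hm)].
exact: lt_le_trans hm.
Qed.

(** For h <= 1 the product is h^(1 - 2 delta) <= 1; for h > 1 the level is 1 and h <= T. *)
Lemma mulr_trunc_scale_sqr_le : h * trunc_scale ^+ 2 <= Num.max 1 T.
Proof.
have [d0 d1] := andP hdelta.
have [h1|h1] := leP h 1; last first.
  rewrite /trunc_scale max_l ?expr1n ?mulr1 ?le_max ?hT ?orbT//.
  by rewrite -[leRHS](powRr0 h); apply: ler_powR; [exact: ltW|rewrite oppr_le0 ltW].
rewrite /trunc_scale max_r; last first.
  by rewrite -[leLHS](powRr0 h); apply: ger_powR; [rewrite h0|rewrite oppr_le0 ltW].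
rewrite le_max; apply/orP; left.
rewrite -powR_mulrn ?powR_ge0// -powRrM -{1}(powRr1 (ltW h0)) -powRD; last first.
  by rewrite (gt_eqF h0) implybT.
by rewrite -[leRHS](powRr0 h); apply: ger_powR; [rewrite h0|lra].
Qed.

End truncation_constants.

(** Nonemptiness of B keeps the supremum from being -oo, so that it is a real number. *)
Lemma eigenvalues_bounded_away (R : realType) (T : Type) (B : set T) (lam : T -> R) :
  B !=set0 -> (ereal_sup [set (lam h)%:E | h in B] < 0)%E ->
  exists2 k, 0 < k & forall h, B h -> lam h <= - k.
Proof.
move=> [h0 Bh0]; set S := ereal_sup _ => S0.
have le h : B h -> ((lam h)%:E <= S)%E by move=> Bh; apply: ereal_sup_ubound; exists h.
have Sf : S \is a fin_num.
  rewrite fin_numE; apply/andP; split; last by rewrite -ltey (lt_trans S0).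
  by rewrite -ltNye; apply: lt_le_trans (ltNyr _) (le _ Bh0).
exists (- fine S); first by rewrite oppr_gt0 -lte_fin fineK.
by move=> h Bh; rewrite opprK -lee_fin fineK//; exact: le.
Qed.

Section truncated_drift.
Variables (R : realType) (e : int -> L2 R) (HH : set (L2 R)) (kap : L2 R -> int).
Variables (lam : L2 R -> R) (I : {fset L2 R}) (eta gamma : R).
Hypotheses (he : forall k, (e k : R -> R) = trig k %[ae (mu01 R)])
  (onHH : Defs.orthonormal HH) (hkap : forall h, HH h -> e (kap h) = h)
  (hI : [set` I] `<=` HH) (heta : 0 < eta) (hgamma : 4^-1 <= gamma)
  (hlame : forall k, lam (e k) = frequency_eigenvalue eta k).
Let m := Num.max 1 (eta `^ (- gamma)).

Lemma freq_norm_le w : w = fproj I w ->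
  freq_norm kap I w <= 2 * m ^+ 2 * Hs_norm HH lam gamma w ^+ 2.
Proof.
move=> wE; rewrite (Hs_norm_fproj lam onHH hI)// mulr_sumr /freq_norm !big_seq.
apply: ler_sum => h hI'; rewrite [leRHS]mulrA ler_wpM2r ?sqr_ge0//.
rewrite -[X in lam X](hkap (hI hI')) hlame; exact: frequency_le.
Qed.

(** Both eta |w| and m N^2 are at most r. Inserting [freq_norm_le] into [norm_drift_sqr] leaves the
    coefficients 2 and 32 (2 pi)^2 (2 m)^2 = 2 (16 pi m)^2 in front of their squares. *)
Lemma norm_drift_class_le w (r : R) : w = fproj I w ->
  eta * `|w| + 5 * m * Hs_norm HH lam gamma w ^+ 2 <= r ->
  `|drift_class kap I eta w| ^+ 2 <= (2 + 2 * (16 * pi * m) ^+ 2) * r ^+ 2.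
Proof.
move=> wE; have := freq_norm_le wE; set N := Hs_norm _ _ _ _ => fN rE.
apply: le_trans (norm_drift_sqr he hkap hI eta wE) _; rewrite [leRHS]mulrDl.
have m0 : 0 <= m by rewrite le_max ler01.
have x0 : 0 <= eta * `|w| by rewrite mulr_ge0// ltW.
have y0 : 0 <= 5 * m * N ^+ 2 by apply: mulr_ge0; [exact: mulr_ge0|exact: sqr_ge0].
apply: lerD.
  rewrite -mulrA -exprMn ler_wpM2l// lerXn2r ?nnegrE//; lra.
have f0 := freq_norm_ge0 kap I w.
apply: (@le_trans _ _ (32 * (2 * pi) ^+ 2 * (2 * m ^+ 2 * N ^+ 2) ^+ 2)).
  apply: ler_wpM2l; first by apply: mulr_ge0 => //; exact: sqr_ge0.
  by rewrite lerXn2r ?nnegrE// (le_trans f0).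
have -> : 32 * (2 * pi) ^+ 2 * (2 * m ^+ 2 * N ^+ 2) ^+ 2 =
    2 * (16 * pi * m) ^+ 2 * (m * N ^+ 2) ^+ 2 by ring.
apply: ler_wpM2l; first by apply: mulr_ge0 => //; exact: sqr_ge0.
have z0 : 0 <= m * N ^+ 2 by apply: mulr_ge0 => //; exact: sqr_ge0.
by rewrite lerXn2r ?nnegrE//; lra.
Qed.

End truncated_drift.

(* No measurability is needed, since the integral of a nonnegative function is
   the supremum of the integrals of the simple functions below it. *)
Lemma ge0_le_integral_sup d (T : measurableType d) (R : realType)
    (mu : {measure set T -> \bar R}) (f g : T -> \bar R) :
  (forall x, 0 <= f x)%E -> (forall x, f x <= g x)%E ->
  (\int[mu]_x f x <= \int[mu]_x g x)%E.
Proof.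
move=> f0 fg; rewrite !ge0_integralTE//; last by move=> x; exact: le_trans (fg x).
apply: ereal_sup_le => _ [h hf <-]; exists h => // x.
exact: le_trans (hf x) (fg x).
Qed.

(** * The uniform exponential moment bound *)

Theorem corollary4p13 (R : realType)
  (eta gamma T eps delta c vartheta : R)
  (heta : 0 < eta) (hgamma : 4^-1 <= gamma) (hT : 0 < T) (heps : 0 < eps)
  (hdelta : 0 < delta < 18^-1)
  (UU : set (L2 R)) (hUU : orthonormal_basis UU setT)
  (H : set (L2 R)) (hH : closed_subspace H)
  (HH : set (L2 R)) (hHH : orthonormal_basis HH H) (hHH0 : HH !=set0)
  (lam : L2 R -> R)
  (hlam : (ereal_sup [set (lam h)%:E | h in HH] < 0)%E)
  (d : measure_display) (Omega : measurableType d) (P : probability Omega R)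
  (Filt : R -> set (set Omega)) (hFilt : filtration T Filt)
  (W : R -> L2 R -> Omega -> R) (hW : cylindrical_wiener P T Filt W)
  (Q : L2 R -> L2 R) (hQ : nonneg_trace_class UU Q)
  (sqrtQ : L2 R -> L2 R) (hsqrtQ : is_sqrt_operator Q sqrtQ)
  (projH : L2 R -> L2 R) (hprojH : orthogonal_projection H projH)
  (r : L2 R -> R)
  (hr0 : forall v : L2 R, Hs HH H lam gamma v -> 0 <= r v)
  (hrm : forall A : set R, measurable A ->
     Hs_borel HH H lam gamma (Hs HH H lam gamma `&` r @^-1` A))
  (b : R -> R -> R)
  (hbm : measurable_fun ((`]0, 1[%classic : set R) `*` [set: R])
           (fun z : R * R => b z.1 z.2))
  (hb : (ereal_sup [set q | exists x y z : R, [/\ 0 < x < 1, z != y &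
           q = (`|b x y| + `|b x y - b x z| / `|y - z|)%:E]]%R < +oo)%E)
  (hvartheta : vartheta = fine (etrace UU Q) *
     sup [set q | exists x y : R, 0 < x < 1 /\ q = `|b x y| ^+ 2])
  (hc : 2 * Num.max 1 (Num.max (eps * Num.sqrt vartheta) eps) <= c)
  (F : L2 R -> L2 R)
  (hFH : forall w : L2 R, Hs HH H lam gamma w -> H (F w))
  (hF : forall w dw : L2 R, Hs HH H lam gamma w -> weak_derivative w dw ->
     ess_bounded w ->
     F w = projH (L2_class (fun x => eta * w x - w x * dw x)))
  (B : L2 R -> L2 R -> L2 R)
  (hBHS : forall w : L2 R, Hs HH H lam gamma w -> hilbert_schmidt UU H (B w))
  (hB : forall (v : R -> R) (w u : L2 R),
     measurable_fun (`]0, 1[%classic : set R) v ->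
     (w : R -> R) = v %[ae (mu01 R)] -> Hs HH H lam gamma w ->
     B w u = projH (L2_class (fun x => b x (v x) * sqrtQ u x)))
  (xi : Omega -> L2 R)
  (hxi : forall om, Hs HH H lam gamma (xi om))
  (hxim : forall O : set (L2 R), Hs_open HH H lam gamma O -> Filt 0 (xi @^-1` O))
  (hxiexp : ('E_P[fun om => expR (eps * `|xi om| ^+ 2)%R] < +oo)%E)
  (Y : {fset R} -> {fset L2 R} -> {fset L2 R} -> R -> Omega -> L2 R)
  (hYrange : forall (theta : {fset R}) (I J : {fset L2 R}) (t : R) om, partition_of T theta ->
     [set` I] `<=` HH -> [set` J] `<=` UU -> 0 <= t <= T ->
     (fproj I @` H) (Y theta I J t om))
  (hYadapted : forall (theta : {fset R}) (I J : {fset L2 R}) (t : R), partition_of T theta ->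
     [set` I] `<=` HH -> [set` J] `<=` UU -> 0 <= t <= T ->
     borel_measurable_wrt (Filt t) (Y theta I J t))
  (hYcont : forall (theta : {fset R}) (I J : {fset L2 R}) om, partition_of T theta ->
     [set` I] `<=` HH -> [set` J] `<=` UU ->
     {within `[0, T], continuous (fun t => Y theta I J t om)})
  (hY0 : forall (theta : {fset R}) (I J : {fset L2 R}) om, partition_of T theta ->
     [set` I] `<=` HH -> [set` J] `<=` UU ->
     Y theta I J 0 om = fproj I (xi om))
  (hY : forall (theta : {fset R}) (I J : {fset L2 R}) (t : R), partition_of T theta ->
     [set` I] `<=` HH -> [set` J] `<=` UU -> 0 < t <= T ->
     let tau := prev_point theta t in
     let Ytau := Y theta I J tau in
     let chi om : R :=
       if r (Ytau om) <= c * mesh theta `^ (- delta) then 1 else 0 in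
     {ae P, forall om, Y theta I J t om =
        semigroup HH lam (t - tau)
          (Ytau om + chi om *: ((t - tau) *: fproj I (F (Ytau om)))) +
        (1 + `|elementary_integral W J
                 (fun om' u => fproj I (B (Ytau om') u)) tau t om| ^+ 2)^-1 *:
        elementary_integral W J
          (fun om' u => semigroup HH lam (t - tau)
             (chi om' *: fproj I (B (Ytau om') u))) tau t om})
  (e : int -> L2 R) (heHH : forall k, HH (e k))
  (he0 : (e 0 : R -> R) = (fun=> 1) %[ae (mu01 R)])
  (hecos : forall n : nat, (0 < n)%N ->
     (e n%:Z : R -> R) = (fun x => Num.sqrt 2 * cos (2 * pi * n%:R * x))
       %[ae (mu01 R)])
  (hesin : forall n : nat, (0 < n)%N ->
     (e (- n%:Z) : R -> R) = (fun x => Num.sqrt 2 * sin (2 * pi * n%:R * x))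
       %[ae (mu01 R)])
  (hlame : forall k : int, lam (e k) =
     4 * k%:~R ^+ 2 * pi ^+ 2 - 16 * k%:~R ^+ 4 * pi ^+ 4 - eta)
  (hr : forall v : L2 R, Hs HH H lam gamma v ->
     Num.max (Num.sqrt vartheta + eps * `|v| ^+ 2)
       (eta * `|v| + 5 * Num.max 1 (eta `^ (- gamma)) *
          Hs_norm HH lam gamma v ^+ 2) <= r v) :
  (ereal_sup [set q | exists (theta : {fset R}) (I J : {fset L2 R}) (t : R),
     [/\ partition_of T theta, [set` I] `<=` HH, [set` J] `<=` UU, 0 <= t <= T &
      q = ('E_P[fun om => (expR (eps * `|Y theta I J t om| ^+ 2 /
             expR (2 * (eta + eps * vartheta) * t)))%R])%E]]%R < +oo)%E.
Proof.
have he k : (e k : R -> R) = trig k %[ae (mu01 R)].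
  case: k => [[|n]|n]; [exact: he0|exact: hecos|].
  by rewrite NegzE; exact: hesin.
have [kap hkap] : exists kap, forall h, HH h -> e (kap h) = h.
  exists (fun h => xget 0 [set k | e k = h]) => h /(basis_eq_trig he hHH heHH) ek.
  exact: (xgetPex 0 ek).
have [k k0 lamk] := eigenvalues_bounded_away hHH0 hlam.
have [C C0 [bC bL]] := bounded_lipschitz_constant hb.
have bM := le_sup_sqr hb; set M := sup _ in hvartheta bM.
have [_ onHH _] := hHH; have [_ onUU _] := hUU.
have half : 0 < (2^-1 : R) < 1 by apply/andP; split; lra.
have M0 : 0 <= M by apply: le_trans (bM 2^-1 0 half); exact: sqr_ge0.
have tr0 : 0 <= fine (etrace UU Q).
  by apply: fine_ge0; apply: esum_ge0 => u _; rewrite lee_fin; case: hQ => -[].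
have vt0 : 0 <= vartheta by rewrite hvartheta mulr_ge0.
have c0 : 0 < c.
  apply: lt_le_trans hc; rewrite mulr_gt0// lt_max ltr01//.
have [sGF GmF GG] := hFilt.
pose m := Num.max 1 (eta `^ (- gamma)).
(* On the truncation event r <= c q: there eps |Y|^2 <= r gives [C1], and [norm_drift_class_le]
   gives [C2]. *)
pose C1 := c / eps; pose C2 := (2 + 2 * (16 * pi * m) ^+ 2) * c ^+ 2.
pose Cs := step_rate eps eta vartheta k T C1 C2 (Num.max 1 T).
have C10 : 0 <= C1 by rewrite /C1 divr_ge0// ltW.
have CF0 : 0 <= 2 + 2 * (16 * pi * m) ^+ 2.
  by apply: addr_ge0 => //; apply: mulr_ge0 => //; exact: sqr_ge0.
have C20 : 0 <= C2 by apply: mulr_ge0 => //; exact: sqr_ge0.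
have K0 : 0 <= Num.max 1 T by rewrite le_max ler01.
pose E theta I J t : \bar R := (\int[P]_om (expR (eps *
  `|Y theta I J t om| ^+ 2 / expR (2 * (eta + eps * vartheta) * t)))%:E)%E.
have step theta I J t : partition_of T theta -> [set` I] `<=` HH ->
    [set` J] `<=` UU -> 0 < t <= T ->
    (E theta I J t <= (expR (Cs * (t - prev_point theta t)))%:E *
       E theta I J (prev_point theta t))%E.
  move=> pth IH JU tT; have hm := sub_prev_point_le_mesh pth tT.
  have [t0 tT'] := andP tT; have := hY theta I J t pth IH JU tT.
  have [_ p0 pt _] := prev_pointP pth t0.
  set tau := prev_point theta t in hm p0 pt *; move=> YE; cbv zeta in YE.
  have tauT : 0 <= tau <= T by rewrite p0 (le_trans (ltW pt)).
  have tT0 : 0 <= t <= T by rewrite (ltW t0).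
  have h0 : 0 < t - tau by rewrite subr_gt0.
  have hT' : t - tau <= T by rewrite lerBlDr (le_trans tT')// lerDl.
  set y := Y theta I J tau in YE *.
  have onI : Defs.orthonormal [set` I] by move=> u v /IH Bu /IH Bv; exact: onHH.
  have yI om : y om = fproj I (y om).
    by have [x _ xE] := hYrange theta I J tau om pth IH JU tauT; rewrite /y -xE fproj_id.
  have HI w : w = fproj I w -> H w.
    by move=> ->; exact: (fproj_sub hH hHH IH).
  have HsI w : w = fproj I w -> Hs HH H lam gamma w.
    by move=> wE; apply: (Hs_fproj lam onHH IH _ _ wE); exact: HI.
  have FE w : w = fproj I w -> F w = projH (drift_class kap I eta w).
    move=> wE; apply: hF; first exact: HsI.
      exact: (fproj_weak_derivative he hkap IH wE).
    exact: (fproj_ess_bounded he hkap IH wE).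
  have BE w u : w = fproj I w ->
      B w u = projH (L2_class (fun x => b x (w x) * sqrtQ u x)).
    move=> wE; apply: hB; [|exact: ae_eq_refl|exact: HsI].
    by apply: measurable_funTS; exact: L2_measurable.
  have hIi i : i \in I -> i = fproj I i.
    move=> iI; rewrite /fproj (bigD1_seq i) ?fset_uniq//= onI// eqxx scale1r.
    rewrite big_seq_cond big1 ?addr0// => j /andP[jI ji].
    by rewrite onI// (negbTE ji) scale0r.
  have my : borel_measurable_wrt (Filt tau) y by exact: hYadapted.
  have sG := sGF _ tauT; have Gm := GmF _ tauT.
  have rho'0 : 0 < eps / expR (2 * (eta + eps * vartheta) * tau).
    by rewrite divr_gt0 ?expR_gt0.
  have rho'e : eps / expR (2 * (eta + eps * vartheta) * tau) <= eps.
    rewrite ler_pdivrMr ?expR_gt0// ler_peMr ?(ltW heps)// -expR0 ler_expR.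
    by rewrite !mulr_ge0// addr_ge0 ?mulr_ge0// ltW.
  have ry om : Num.max (Num.sqrt vartheta + eps * `|y om| ^+ 2)
      (eta * `|y om| + 5 * m * Hs_norm HH lam gamma (y om) ^+ 2) <= r (y om).
    by apply: hr; exact: HsI.
  have rq om : r (y om) <= c * mesh theta `^ (- delta) ->
      r (y om) <= c * trunc_scale delta (t - tau).
    move=> /le_trans; apply; rewrite ler_wpM2l ?(ltW c0)//.
    exact: powR_mesh_le.
  have := @scheme_step _ Omega R P (Filt tau) (Filt t) HH lam I J
    (fun u om => W t u om - W tau u om) F B y (Y theta I J t)
    (fun om => r (y om) <= c * mesh theta `^ (- delta)) eps eta vartheta k T C1 C2
    (Num.max 1 T) (t - tau) (trunc_scale delta (t - tau))
    (eps / expR (2 * (eta + eps * vartheta) * tau)).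
  rewrite -/Cs => S.
  have {}S : (\int[P]_om (expR (eps / expR (2 * (eta + eps * vartheta) * tau) *
      expR (- (2 * (eta + eps * vartheta) * (t - tau))) * `|Y theta I J t om| ^+ 2))%:E <=
      (expR (Cs * (t - tau)))%:E *
      \int[P]_om (expR (eps / expR (2 * (eta + eps * vartheta) * tau) * `|y om| ^+ 2))%:E)%E.
    apply: S => //.
    - exact: trunc_scale_ge1.
    - exact: mulr_trunc_scale_sqr_le.
    - exact: sGF.
    - exact: GmF.
    - move=> u uJ; apply: measurable_funB; apply: measurable_of_open => O oO.
        by apply: (GmF _ tT0); exact: (wiener_adapted hW).
      by apply: Gm; exact: (wiener_adapted hW).
    - move=> A0 A1 GA mA; apply: (wiener_increments hW) => //.
      by move=> u v /JU Bu /JU Bv; exact: onUU.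
    - exact: hYadapted.
    - exact: (measurable_truncation sG my onHH IH (fproj_sub hH hHH IH) yI _ hrm).
    - move=> i iI; have [a aE] := inner_drift_coord he hkap IH eta (hIi i iI).
      apply: (eq_measurable_fun (fun om : g_sigma_algebraType (Filt tau) =>
        eta * inner i (y om) -
        \sum_(h <- I) \sum_(h' <- I) a h h' * inner h (y om) * inner h' (y om))).
        by move=> om _; rewrite FE// (inner_projH hprojH)// ?aE//; exact: HI (hIi i iI).
      apply: measurable_funB; first by apply: measurable_funM => //; exact: borel_inner.
      apply: measurable_fun_sum => l; apply: measurable_fun_sum => l'.
      by apply: measurable_funM; [apply: measurable_funM => //|]; exact: borel_inner.
    - move=> u i iI.
      apply: (eq_measurable_fun (fun om : g_sigma_algebraType (Filt tau) =>
          inner (L2_class (nemytskii b (y om))) (L2_class (fun x => trig (kap i) x * sqrtQ u x)))).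
        have ei : (i : R -> R) = trig (kap i) %[ae (mu01 R)].
          by have := he (kap i); rewrite (hkap i (IH i iI)).
        move=> om _; rewrite BE// (inner_projH hprojH); last exact: HI (hIi i iI).
        exact/esym/(noise_coord hbm bC).
      have := @continuous_noise_coord _ _ _ hbm C0 bC bL
        (L2_class (fun x => trig (kap i) x * sqrtQ u x)).
      exact: (borel_comp_continuous sG my).
    (* Pointwise |b|^2 <= M, so the sum of |P_I B u|^2 is at most M times that of |sqrtQ u|^2, hence
       at most M times the trace of Q. *)
    - move=> om; rewrite hvartheta mulrC.
      apply: (@le_trans _ _ (M * \sum_(u <- J) `|sqrtQ u| ^+ 2)); last first.
        by rewrite ler_wpM2l//; exact: sum_norm_sqrt_operator_le.
      rewrite mulr_sumr; apply: ler_sum => u _; rewrite BE//.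
      apply: le_trans (norm_noise_class hbm bC (y om) (sqrtQ u) bM).
      by rewrite lerXn2r ?nnegrE//; exact: (norm_fproj_projH hH hHH hprojH IH).
    - move=> om /rq rle; have := ry om; rewrite ge_max => /andP[r1 _].
      rewrite /C1 mulrAC ler_pdivlMr// mulrC; apply: le_trans rle.
      by apply: le_trans r1; rewrite lerDr sqrtr_ge0.
    - move=> om /rq rle; have := ry om; rewrite ge_max => /andP[_ r2].
      have r0 := hr0 _ (HsI _ (yI om)).
      rewrite FE//; apply: (@le_trans _ _ (`|drift_class kap I eta (y om)| ^+ 2)).
        by rewrite lerXn2r ?nnegrE//; exact: (norm_fproj_projH hH hHH hprojH IH).
      apply: le_trans (norm_drift_class_le he onHH hkap IH heta hgamma hlame (yI om) r2) _.
      rewrite /C2 -[leRHS]mulrA -exprMn; apply: ler_wpM2l => //.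
      by rewrite lerXn2r ?nnegrE// (le_trans r0).
    - move=> om _; rewrite FE// (inner_projH hprojH); last exact: HI.
      exact: (inner_drift_self he hkap IH).
  have expE : expR (2 * (eta + eps * vartheta) * t) =
      expR (2 * (eta + eps * vartheta) * tau) *
      expR (2 * (eta + eps * vartheta) * (t - tau)).
    by rewrite -expRD; congr expR; ring.
  rewrite /E -/y; apply: le_trans (le_trans _ S) _.
    rewrite le_eqVlt; apply/orP; left; apply/eqP; apply: eq_integral => om _.
    congr (expR _)%:E; rewrite expE expRN; field.
    by rewrite !gt_eqF ?expR_gt0.
  rewrite le_eqVlt; apply/orP; left; apply/eqP; congr (_ * _)%E.
  by apply: eq_integral => om _; congr (expR _)%:E; rewrite mulrAC.
have Cs0 : 0 <= Cs by rewrite /Cs /step_rate; nonneg.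
have EE (X : Omega -> R) : ('E_P[X] = \int[P]_om (X om)%:E)%E by rewrite unlock.
(* The uniform bound is e^(Cs T) times the exponential moment of xi: the weight equals eps at time
   0, and |P_I xi| <= |xi|. *)
apply: (@le_lt_trans _ _ ((expR (Cs * T))%:E *
    'E_P[fun om => expR (eps * `|xi om| ^+ 2)%R])%E); last first.
  by apply: lte_mul_pinfty => //; rewrite lee_fin expR_ge0.
apply: ge_ereal_sup => _ [theta [I [J [t [pth IH JU tT ->]]]]].
rewrite EE; apply: le_trans (partition_induction pth (fun s => step theta I J s pth IH JU) tT) _.
have [t0 tT'] := andP tT.
apply: lee_pmul => //.
- exact: integral_ge0.
- by rewrite lee_fin ler_expR ler_wpM2l.
rewrite EE; apply: ge0_le_integral_sup => om; first by rewrite lee_fin expR_ge0.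
rewrite lee_fin ler_expR mulr0 expR0 divr1 ler_wpM2l ?(ltW heps)//.
have onI : Defs.orthonormal [set` I] by move=> u v /IH Bu /IH Bv; exact: onHH.
by rewrite hY0// lerXn2r ?nnegrE//; exact: norm_fproj_le.
Qed.
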